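(* Suppose that the spectral density matrix operator $\mathscr F_{\mathbf X,\theta}$, $\theta\in[-\pi,\pi]$, exists and $\mathcal M(\mathscr F_{\mathbf X})<\infty$, that the marginal-covariance functions $\Sigma_{0,jj}$ are continuous on $\mathcal U^2$ and bounded uniformly in $j\in\{1,\dots,p\}$ and $(u,v)\in\mathcal U^2$, and that $\lambda_0=\max_{1\le j\le p}\int_{\mathcal U}\Sigma_{0,jj}(u,u)\,du<\infty$. Then there exists some universal constant $\tilde c>0$ such that for any $\eta>0$ and each $j,k=1,\dots,p$, $$P\left\{\|\widehat\Sigma_{0,jk}-\Sigma_{0,jk}\|_{\mathcal S}>2\mathcal M_1(\mathscr F_{\mathbf X})\lambda_0\eta\right\}\le4\exp\{-\tilde cn\min(\eta^2,\eta)\},$$ and $$P\left\{\|\widehat{\boldsymbol\Sigma}_0-\boldsymbol\Sigma_0\|_{\max}>2\mathcal M_1(\mathscr F_{\mathbf X})\lambda_0\eta\right\}\le4p^2\exp\{-\tilde cn\min(\eta^2,\eta)\}.$$ In particular, if the sample size satisfies $n\ge\rho^2\log p$, where $\rho$ is some constant with $\rho>\sqrt2\,\tilde c^{-1/2}$, then with probability greater than $1-4p^{2-\tilde c\rho^2}$, $$\|\widehat{\boldsymbol\Sigma}_0-\boldsymbol\Sigma_0\|_{\max}\le2\mathcal M_1(\mathscr F_{\mathbf X})\lambda_0\,\rho\sqrt{\frac{\log p}{n}}.$$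
   Context: $\mathcal U$ is a compact interval, $\mathbb H=L_2(\mathcal U)$ is real with $\langle f,g\rangle=\int_{\mathcal U}f(u)g(u)\,du$, and $\mathbb H^p$ has inner product $\langle\mathbf f,\mathbf g\rangle=\sum_{j=1}^p\langle f_j,g_j\rangle$; $\|\mathbf f\|_0=\sum_{j=1}^pI(\|f_j\|\ne0)$. For a kernel $K$ on $\mathcal U^2$, $\|K\|_{\mathcal S}=(\iint K(u,v)^2\,du\,dv)^{1/2}$ (Hilbert–Schmidt norm); for a $p\times p$ matrix of kernels $\mathbf A=(A_{jk})$, $\|\mathbf A\|_{\max}=\max_{j,k}\|A_{jk}\|_{\mathcal S}$. $\{\mathbf X_t(\cdot)\}_{t\in\mathbb Z}$, $\mathbf X_t=(X_{t1},\dots,X_{tp})^{T}$, is a sequence of $p$-dimensional mean-zero, covariance-stationary (jointly) Gaussian random curves on $\mathcal U$, with autocovariance matrix functions $\boldsymbol\Sigma_h(u,v)=\mathrm{Cov}\{\mathbf X_t(u),\mathbf X_{t+h}(v)\}=(\Sigma_{h,jk}(u,v))_{1\le j,k\le p}$, $h\in\mathbb Z$, and operators $\boldsymbol\Xi_h(\boldsymbol\Phi)(u)=\int_{\mathcal U}\boldsymbol\Sigma_h(u,v)\boldsymbol\Phi(v)\,dv$ on $\mathbb H^p$. The spectral density matrix operator at $\theta\in[-\pi,\pi]$ is $\mathscr F_{\mathbf X,\theta}(\boldsymbol\Phi)=\frac1{2\pi}\sum_{h\in\mathbb Z}\boldsymbol\Xi_h(\boldsymbol\Phi)\exp(-ih\theta)$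 (it ''exists'' when this series converges). Let $\mathbb H_0^p=\{\boldsymbol\Phi\in\mathbb H^p:\langle\boldsymbol\Phi,\boldsymbol\Xi_0(\boldsymbol\Phi)\rangle\in(0,\infty)\}$. The functional stability measure is $$\mathcal M(\mathscr F_{\mathbf X})=2\pi\cdot\operatorname*{ess\,sup}_{\theta\in[-\pi,\pi],\,\boldsymbol\Phi\in\mathbb H_0^p}\frac{\langle\boldsymbol\Phi,\mathscr F_{\mathbf X,\theta}(\boldsymbol\Phi)\rangle}{\langle\boldsymbol\Phi,\boldsymbol\Xi_0(\boldsymbol\Phi)\rangle},$$ and $\mathcal M_1(\mathscr F_{\mathbf X})$ is the same quantity with the supremum restricted to $\boldsymbol\Phi\in\mathbb H_0^p$ with $\|\boldsymbol\Phi\|_0\le1$. Based on observations $\mathbf X_1,\dots,\mathbf X_n$, $\widehat{\boldsymbol\Sigma}_0(u,v)=n^{-1}\sum_{t=1}^n\mathbf X_t(u)\mathbf X_t(v)^{T}=(\widehat\Sigma_{0,jk}(u,v))_{1\le j,k\le p}$. *)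

(* Defs.v *)
From HB Require Import structures.
From mathcomp Require Import all_boot all_order all_algebra.
From mathcomp Require Import all_classical all_reals all_analysis.
From mathcomp Require Import ess_sup_inf complex.

Set Implicit Arguments.
Unset Strict Implicit.
Unset Printing Implicit Defensive.

Import Order.TTheory GRing.Theory Num.Theory.
Import numFieldNormedType.Exports.
Local Open Scope classical_set_scope.
Local Open Scope complex_scope.
Local Open Scope ring_scope.

(* A p-dimensional curve with values in [S]: [f j u] is the value at [u] of the
   j-th coordinate. Elements of L_2 are represented by functions, and only
   their values on [U] matter. *)
Definition curve (R : realType) (p : nat) (S : Type) : Type := 'I_p -> R -> S.

Section HilbertSpace.
Context {R : realType}.
Variable U : set R.
Local Notation leb := (@lebesgue_measure R).

Definition L2 (f : R -> R) : Prop :=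
  measurable_fun U f /\ leb.-integrable U (fun u => (f u ^+ 2)%:E).

Definition L2norm (f : R -> R) : \bar R :=
  sqrte (\int[leb]_(u in U) (f u ^+ 2)%:E)%E.

Definition Hp p (f : curve R p R) : Prop := forall j, L2 (f j).

Definition inner p (f g : curve R p R) : R :=
  \sum_(j < p) \int[leb]_(u in U) (f j u * g j u).

Definition norm0 p (f : curve R p R) : nat :=
  (\sum_(j < p) (L2norm (f j) != 0%E))%N.

(* The complexification of H^p, the inner product of a real curve with a
   complex one, and the squared norm. *)
Definition HpC p (f : curve R p R[i]) : Prop :=
  forall j, L2 (fun u => complex.Re (f j u)) /\ L2 (fun u => complex.Im (f j u)).

Definition innerC p (f : curve R p R) (g : curve R p R[i]) : R[i] :=
  inner f (fun j u => complex.Re (g j u)) +i*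
  inner f (fun j u => complex.Im (g j u)).

Definition sqnormC p (f : curve R p R[i]) : \bar R :=
  (\sum_(j < p) \int[leb]_(u in U)
     (complex.Re (f j u) ^+ 2 + complex.Im (f j u) ^+ 2)%:E)%E.

Definition hs_norm (K : R -> R -> R) : \bar R :=
  sqrte (\int[leb]_(u in U) \int[leb]_(v in U) (K u v ^+ 2)%:E)%E.

(* The initial value -oo is irrelevant for p >= 1. *)
Definition max_norm p (A : 'I_p -> 'I_p -> R -> R -> R) : \bar R :=
  \big[maxe/-oo%E]_(j < p) \big[maxe/-oo%E]_(k < p) hs_norm (A j k).

End HilbertSpace.

Section RandomCurves.
Context {R : realType} {d : measure_display} {T : measurableType d}.
Variables (P : probability T R) (U : set R) (p : nat).
Local Notation leb := (@lebesgue_measure R).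

(* [X t j u w] is the value at [u], for the outcome [w], of the j-th coordinate
   of the curve observed at time [t]. *)
Variable X : int -> 'I_p -> R -> T -> R.

Definition sample_curve (t : int) (w : T) : curve R p R := fun j u => X t j u w.

Definition random_curves : Prop :=
  (forall t j, measurable_fun ([set: T] `*` U)
     (fun z : T * measurableTypeR R => X t j z.2 z.1)) /\
  (forall t w, Hp U (sample_curve t w)).

(* [normal_prob m s] has variance [s ^+ 2], but the library gives it a junk
   value for [s = 0]; a degenerate Gaussian law is a Dirac mass. *)
Definition gaussian_rv (Y : T -> R) : Prop :=
  measurable_fun [set: T] Y /\
  exists m s : R, 0 <= s /\
    forall A : set (measurableTypeR R), measurable A ->
      P (Y @^-1` A) = if s == 0 then \d_m A else normal_prob m s A.

(* Gaussianity of the whole family in the sense of random elements of H^p: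
   every finite linear combination of the <Phi, X_t> is Gaussian (the
   coefficients are absorbed in the Phi's). *)
Definition jointly_gaussian : Prop :=
  forall (m : nat) (t : 'I_m -> int) (Phi : 'I_m -> curve R p R),
    (forall i, Hp U (Phi i)) ->
    gaussian_rv (fun w => \sum_(i < m) inner U (Phi i) (sample_curve (t i) w)).

Definition mean_zero : Prop :=
  forall t j u, U u -> ('E_P[X t j u] = 0)%E.

Definition cov_stationary : Prop :=
  (forall t j u, U u -> X t j u \in Lfun P 2%:E) /\
  (forall (t h : int) j k u v, U u -> U v ->
     covariance P (X t j u) (X (t + h) k v) =
     covariance P (X 0 j u) (X h k v)).

(* Sigma_{h,jk}(u,v); the time origin is immaterial under stationarity. *)
Definition autocov (h : int) (j k : 'I_p) (u v : R) : R :=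
  fine (covariance P (X 0 j u) (X h k v)).

Definition autocov_op (h : int) (Phi : curve R p R) : curve R p R :=
  fun j u => \sum_(k < p) \int[leb]_(v in U) (autocov h j k u v * Phi k v).

(* (2 pi)^-1 * sum over |h| <= N of Xi_h(Phi) exp(- i h theta). *)
Definition spectral_partial_sum (N : nat) (theta : R) (Phi : curve R p R) :
    curve R p R[i] :=
  fun j u => ((2 * pi)^-1)%:C * \sum_(l < N.*2.+1)
    let h : int := l%:Z - N%:Z in
    (autocov_op h Phi j u)%:C *
      (cos (h%:~R * theta) -i* sin (h%:~R * theta)).

(* [F theta] is the spectral density operator at [theta]: the series converges
   to [F theta Phi] in the norm of the complexified H^p. *)
Definition is_spectral_density
    (F : R -> curve R p R -> curve R p R[i]) : Prop :=
  forall theta, theta \in `[- pi, pi] -> forall Phi, Hp U Phi ->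
    HpC U (F theta Phi) /\
    sqnormC U (fun j u =>
      spectral_partial_sum N theta Phi j u - F theta Phi j u) @[N --> \oo]
      --> 0%E.

Definition H0p (Phi : curve R p R) : Prop :=
  Hp U Phi /\ 0 < inner U Phi (autocov_op 0 Phi).

(* The numerator is a real number because <Phi, Xi_h(Phi)> is even in [h];
   [complex.Re] only changes its type. *)
Definition spectral_quotient (F : R -> curve R p R -> curve R p R[i])
    (theta : R) (Phi : curve R p R) : R :=
  complex.Re (innerC U Phi (F theta Phi)) / inner U Phi (autocov_op 0 Phi).

Definition leb_pi : {measure set (measurableTypeR R) -> \bar R} :=
  mrestr leb (measurable_itv `[- pi, pi] : measurable (`[- pi, pi]%classic : set R)).

(* Essential supremum over [theta] (Lebesgue measure on [-pi, pi]) of the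
   supremum over the curves Phi in H_0^p satisfying [Q]. *)
Definition stability_on (Q : curve R p R -> Prop)
    (F : R -> curve R p R -> curve R p R[i]) : \bar R :=
  ((2 * pi)%:E * ess_sup leb_pi (fun theta : R =>
     ereal_sup [set (spectral_quotient F theta Phi)%:E |
                Phi in [set Phi | H0p Phi /\ Q Phi]]))%E.

Definition stability := stability_on (fun _ => True).
Definition stability1 := stability_on (fun Phi => (norm0 U Phi <= 1)%N).

Definition lambda0 : \bar R :=
  \big[maxe/-oo%E]_(j < p) (\int[leb]_(u in U) (autocov 0 j j u u)%:E)%E.

Definition sample_cov0 (n : nat) (w : T) (j k : 'I_p) (u v : R) : R :=
  n%:R^-1 * \sum_(1 <= t < n.+1) X t%:Z j u w * X t%:Z k v w.

Definition cov_error (n : nat) (w : T) (j k : 'I_p) (u v : R) : R :=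
  sample_cov0 n w j k u v - autocov 0 j k u v.

End RandomCurves.

(* Main.v *)
Require Import Defs.
From HB Require Import structures.
From mathcomp Require Import all_boot all_order all_algebra.
From mathcomp Require Import all_classical all_reals all_analysis.
From mathcomp Require Import complex.
From mathcomp Require Import ring lra zify measurable_realfun ess_sup_inf.

(* Averaging a coordinate of the curves over a small interval turns it into a
   scalar Gaussian stationary sequence. Its Toeplitz covariance form is bounded
   by the stability measure, because a nonnegative trigonometric polynomial of
   low degree, integrated against the spectral density, cannot exceed the
   essential supremum of the latter. The recursion for Gaussian moments then
   bounds the moments of the centred squared norm of the vector of n averages;
   polarization and shrinking intervals give the moments of the covariance error
   at each point (u, v), with the constant proportional to
   Sigma_jj(u,u) Sigma_kk(v,v). Integrating over (u, v) with the weight that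
   equalizes these constants and optimizing the order of the moment yields the
   exponential tail. *)

Import Order.TTheory GRing.Theory Num.Theory.
Import numFieldNormedType.Exports.
Local Open Scope classical_set_scope.
Local Open Scope ring_scope.

(** The spectral series converges only at each frequency separately, with no summability of the
    autocovariances and no integrability of the limit in the frequency, so the Fourier inversion
    behind the usual Toeplitz bound is not at hand. Fejer sums replace it: they are continuous and
    nonnegative, each point has a neighbourhood in which they are controlled by the limit at that
    point, and Cousin's lemma glues these local controls. This loses a factor [16 * pi] against the
    sharp bound, which is harmless because it ends up in [tail_constant]. Joint Gaussianity is
    assumed of inner products with curves in H^p, which is why point values enter only as
    mean-square limits of averages. Even moments are preferred to exponential moments or a
    diagonalization of the covariance: they follow from polynomial identities between moments of
    linear combinations, they pass to limits, and a bound E D^(2q) <= (B W)^q at every point can be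
    integrated against W^(1-q), so the dependence on the point is not lost. *)

Section LinearCoefficient.
Context {R : realFieldType}.

(** Plays the role of f'(0) = a. Every function differentiated in the Gaussian calculus is a
    polynomial in the perturbation parameter, so differentiation reduces to comparing
    coefficients. *)
Definition poly_coef1 (f : R -> R) (a : R) : Prop :=
  exists p : {poly R}, (forall x, f x = p.[x]) /\ p`_1 = a.

(** A nonzero polynomial has fewer roots than its size, whereas [p - q] vanishes at all naturals
    below its size, and these are distinct in an ordered field. *)
Lemma poly_coef1_uniq {f a b} : poly_coef1 f a -> poly_coef1 f b -> a = b.
Proof.
move=> [p [fp <-]] [q [fq <-]]; suff -> : p = q by [].
apply/eqP; rewrite -subr_eq0; apply/negP => /negP pq0.
have := @max_poly_roots R (p - q) [seq i%:R | i <- iota 0 (size (p - q))] pq0.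
rewrite size_map size_iota ltnn => H; suff: false by []; apply: H.
  by apply/allP => x _; rewrite /root hornerD hornerN -fp -fq subrr.
by rewrite map_inj_uniq ?iota_uniq// => i j /eqP; rewrite eqr_nat => /eqP.
Qed.

Lemma eq_poly_coef1 {f g a b} : poly_coef1 f a -> poly_coef1 g b ->
  f =1 g -> a = b.
Proof. by move=> fa gb /funext fg; apply: poly_coef1_uniq fa _; rewrite fg. Qed.

Lemma poly_coef1D {f g a b} : poly_coef1 f a -> poly_coef1 g b ->
  poly_coef1 (fun x => f x + g x) (a + b).
Proof.
move=> [p [fp <-]] [q [gq <-]]; exists (p + q); rewrite coefD; split=> // x.
by rewrite hornerD fp gq.
Qed.

Lemma poly_coef1Z (c : R) {f a} : poly_coef1 f a ->
  poly_coef1 (fun x => c * f x) (c * a).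
Proof.
by move=> [p [fp <-]]; exists (c *: p); rewrite coefZ; split=> // x; rewrite hornerZ fp.
Qed.

Lemma poly_coef1M {f g a b} : poly_coef1 f a -> poly_coef1 g b ->
  poly_coef1 (fun x => f x * g x) (f 0 * b + a * g 0).
Proof.
move=> [p [fp <-]] [q [gq <-]]; exists (p * q); split=> [x|].
  by rewrite hornerM fp gq.
by rewrite coefM big_ord_recl big_ord1 /= fp gq !horner_coef0.
Qed.

End LinearCoefficient.

(** * Expectation as an abstract functional on an algebra of random variables *)

Section MomentAlgebra.
Context {R : realFieldType} {T : Type} (S : (T -> R) -> Prop) (E : (T -> R) -> R).

(** Integrability is confined to the predicate [S], so that the Gaussian calculus becomes pure
    algebra. The instance used later is the algebra of random variables with all moments finite. *)
Record moment_algebra : Prop := MomentAlgebra {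
  mom_cst : forall c, S (fun=> c);
  mom_add : forall f g, S f -> S g -> S (fun w => f w + g w);
  mom_mul : forall f g, S f -> S g -> S (fun w => f w * g w);
  expD : forall f g, S f -> S g -> E (fun w => f w + g w) = E f + E g;
  expZ : forall c f, S f -> E (fun w => c * f w) = c * E f;
  exp_mono : forall f g, S f -> S g -> (forall w, f w <= g w) -> E f <= E g;
  exp_cst : forall c, E (fun=> c) = c }.

Hypothesis SE : moment_algebra.
Let Sc := mom_cst SE. Let SD := mom_add SE. Let SM := mom_mul SE.

Lemma mom_exp f m : S f -> S (fun w => f w ^+ m).
Proof.
move=> Sf; elim: m => [|m IH]; first exact: Sc.
rewrite [X in S X](_ : _ = fun w => f w * f w ^+ m); first exact: SM.
by apply/funext => w; rewrite exprS.
Qed.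

Lemma mom_sum I (r : seq I) (Q : pred I) (F : I -> T -> R) :
  (forall i, S (F i)) -> S (fun w => \sum_(i <- r | Q i) F i w).
Proof.
move=> SF; elim: r => [|i r IH].
  by rewrite [X in S X](_ : _ = fun=> 0); [exact: Sc|apply/funext => w; rewrite big_nil].
case Qi: (Q i); last first.
  by rewrite [X in S X](_ : _ = (fun w => \sum_(i <- r | Q i) F i w))//;
    apply/funext => w; rewrite big_cons Qi.
rewrite [X in S X](_ : _ = (fun w => F i w + \sum_(i <- r | Q i) F i w)).
  exact: SD.
by apply/funext => w; rewrite big_cons Qi.
Qed.

Lemma exp_sum I (r : seq I) (Q : pred I) (F : I -> T -> R) :
  (forall i, S (F i)) ->
  E (fun w => \sum_(i <- r | Q i) F i w) = \sum_(i <- r | Q i) E (F i).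
Proof.
move=> SF; elim: r => [|i r IH].
  by rewrite big_nil -[RHS](exp_cst SE); congr E; apply/funext => w; rewrite big_nil.
rewrite big_cons; case Qi: (Q i); last first.
  by rewrite -IH; congr E; apply/funext => w; rewrite big_cons Qi.
rewrite -IH -(expD SE)//; last exact: mom_sum.
by congr E; apply/funext => w; rewrite big_cons Qi.
Qed.

Lemma exp_sum_ord n (F : 'I_n -> T -> R) : (forall i, S (F i)) ->
  E (fun w => \sum_(i < n) F i w) = \sum_(i < n) E (F i).
Proof. exact: exp_sum. Qed.

(** Differentiation under the expectation at x = 0; the binomial expansion exhibits the polynomial
    in x. *)
Lemma poly_coef1_exp F f g m : S F -> S f -> S g ->
  poly_coef1 (fun x => E (fun w => F w * (f w + x * g w) ^+ m))
             (m%:R * E (fun w => F w * (f w ^+ m.-1 * g w))).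
Proof.
move=> SF Sf Sg.
have SFk (k : nat) : S (fun w => F w * (f w ^+ (m - k) * g w ^+ k)).
  by apply: SM => //; apply: SM; exact: mom_exp.
exists (\poly_(k < m.+1) ('C(m, k)%:R * E (fun w => F w * (f w ^+ (m - k) * g w ^+ k)))).
split=> [x|].
  rewrite horner_poly.
  rewrite [X in E X](_ : _ = fun w => \sum_(k < m.+1)
     ('C(m, k)%:R * x ^+ k) * (F w * (f w ^+ (m - k) * g w ^+ k))); last first.
    apply/funext => w; rewrite exprDn mulr_sumr; apply: eq_bigr => k _.
    by rewrite exprMn -mulr_natl; ring.
  rewrite exp_sum_ord => [|k]; last by apply: SM; [exact: Sc|exact: SFk].
  by apply: eq_bigr => k _; rewrite (expZ SE)//; ring.
rewrite coef_poly; case: m SFk => [|m] SFk /=; first by rewrite mul0r.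
by rewrite bin1 subSS subn0.
Qed.

End MomentAlgebra.

(** * Integration by parts and the squared norm of a Gaussian vector *)

Section GaussianVector.
Context {R : realFieldType} {T : Type} {S : (T -> R) -> Prop} {E : (T -> R) -> R}.
Hypothesis SE : moment_algebra S E.
Let Sc := mom_cst _ _ SE. Let SD := mom_add _ _ SE. Let SM := mom_mul _ _ SE.
Context {n : nat} (z : 'I_n -> T -> R).

Definition lincomb (c : 'I_n -> R) (w : T) : R := \sum_(i < n) c i * z i w.

Hypothesis Sz : forall i, S (z i).
Hypothesis Ez : forall i, E (z i) = 0.
(** Together with the zero means, the only trace of normality: the recursion between the moments of
    a centred normal variable, required of every linear combination. Degenerate laws satisfy it as
    well. *)
Hypothesis gaussian_moments : forall c m,
  E (fun w => lincomb c w ^+ m.+2) =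
  m.+1%:R * E (fun w => lincomb c w ^+ 2) * E (fun w => lincomb c w ^+ m).

Let Slin c : S (lincomb c).
Proof.
by apply: (@mom_sum _ _ S E SE) => i; apply: SM; [exact: Sc|exact: Sz].
Qed.

Let SlinX c m : S (fun w => lincomb c w ^+ m).
Proof. exact: (mom_exp _ _ SE). Qed.

Let lincombD c d x w : lincomb (fun i => c i + x * d i) w =
  lincomb c w + x * lincomb d w.
Proof.
rewrite /lincomb mulr_sumr -big_split/=; apply: eq_bigr => i _.
by rewrite mulrDl mulrA.
Qed.

Let E_eq f g : (forall w, f w = g w) -> E f = E g.
Proof. by move=> fg; congr E; apply/funext. Qed.

(** Stein's identity for a power of a linear form. The moment recursion holds along c + x d for
    every x; its linear coefficient in x at exponent m + 3 expresses E(d c^(m+2)) through E(d c^m),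
    hence an induction in steps of two. *)
Lemma gaussian_ibp_pow d c m :
  E (fun w => lincomb d w * lincomb c w ^+ m) =
  m%:R * E (fun w => lincomb d w * lincomb c w) *
  E (fun w => lincomb c w ^+ m.-1).
Proof.
have pc k c' := @poly_coef1_exp _ _ S E SE (fun=> 1) (lincomb c') (lincomb d) k
  (Sc 1) (Slin c') (Slin d).
have Elin c' : E (lincomb c') = 0.
  rewrite /lincomb (exp_sum_ord _ _ SE) => [|i].
    by rewrite big1// => i _; rewrite (expZ _ _ SE)// Ez mulr0.
  by apply: SM.
elim/ltn_ind: m => -[|[|m]] IH.
- rewrite !mul0r -[RHS](Elin d); by apply: E_eq => w; rewrite mulr1.
- rewrite mul1r [E (fun w => _ ^+ 0)](exp_cst _ _ SE) mulr1.
  by apply: E_eq => w; rewrite expr1.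
have := eq_poly_coef1 (pc m.+3 c)
  (poly_coef1M (poly_coef1Z m.+2%:R (pc 2%N c)) (pc m.+1 c)).
have eqx : (fun x => E (fun w => 1 * (lincomb c w + x * lincomb d w) ^+ m.+3)) =1
  (fun x => m.+2%:R * E (fun w => 1 * (lincomb c w + x * lincomb d w) ^+ 2) *
    E (fun w => 1 * (lincomb c w + x * lincomb d w) ^+ m.+1)).
  move=> x.
  have e k : E (fun w => 1 * (lincomb c w + x * lincomb d w) ^+ k) =
      E (fun w => lincomb (fun i => c i + x * d i) w ^+ k).
    by apply: E_eq => w; rewrite mul1r lincombD.
  by rewrite !e gaussian_moments.
move=> /(_ eqx) /=.
rewrite /=.
have e0 k : E (fun w => 1 * (lincomb c w + 0 * lincomb d w) ^+ k) =
    E (fun w => lincomb c w ^+ k).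
  by apply: E_eq => w; rewrite mul1r mul0r addr0.
have e1 k : E (fun w => 1 * (lincomb c w ^+ k * lincomb d w)) =
    E (fun w => lincomb d w * lincomb c w ^+ k).
  by apply: E_eq => w; rewrite mul1r mulrC.
rewrite !e0 !e1 /= (IH m)// [E (fun w => lincomb d w * lincomb c w ^+ 1)](E_eq _ (fun w => lincomb d w * lincomb c w)) => [|w]; last by rewrite expr1.
(* The recursion at exponent m + 1, times m + 1; it merges the two terms of the product rule. At m =
   0 both sides vanish because the mean is zero. *)
have gm : m.+1%:R * E (fun w => lincomb c w ^+ 2) * (m%:R * E (fun w => lincomb c w ^+ m.-1)) =
   m.+1%:R * E (fun w => lincomb c w ^+ m.+1).
  case: m {IH eqx} => [|m] /=; first by rewrite !mul0r !mulr0 [E _]Elin mulr0.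
  rewrite (gaussian_moments c m); ring.
move=> H.
apply: (@mulfI _ m.+3%:R); first by rewrite pnatr_eq0.
rewrite {}H.
set C := E (fun w => lincomb d w * _); set A2 := E (fun w => _ ^+ 2) in gm *.

set A := E (fun w => lincomb c w ^+ m.+1) in gm *.
set B := E (fun w => lincomb c w ^+ m.-1) in gm *.
transitivity (m.+2%:R * C * (m.+1%:R * A2 * (m%:R * B)) + 2 * m.+2%:R * C * A); first by ring.
by rewrite gm; ring.
Qed.

Let cov i j := E (fun w => z i w * z j w).
Let dlt (s i : 'I_n) : R := (i == s)%:R.

Let lincomb_dlt s w : lincomb (dlt s) w = z s w.
Proof.
rewrite /lincomb (bigD1 s)//= /dlt eqxx mul1r big1 ?addr0// => i /negPf ->.
by rewrite mul0r.
Qed.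

(** Integration by parts of z_t against f L^m for every linear form L, where g stands for the sum
    over s of cov(t, s) times the derivative of f in z_s. The arbitrary power of L is what makes the
    relation stable when f is multiplied by a coordinate. *)
Definition stein_pair (t : 'I_n) (f g : T -> R) : Prop :=
  [/\ S f, S g & forall c m, E (fun w => z t w * f w * lincomb c w ^+ m) =
    E (fun w => g w * lincomb c w ^+ m) +
    m%:R * E (fun w => z t w * lincomb c w) * E (fun w => f w * lincomb c w ^+ m.-1)].

Lemma stein_pair1 t : stein_pair t (fun=> 1) (fun=> 0).
Proof.
split; [exact: Sc..|] => c m.
rewrite [X in X + _](_ : _ = 0) ?add0r; last first.
  by rewrite -[RHS](exp_cst _ _ SE); apply: E_eq => w; rewrite mul0r.
under [in RHS]E_eq do rewrite -lincomb_dlt.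
rewrite [X in _ * X](E_eq _ (fun w => lincomb c w ^+ m.-1)) => [|w]; last by rewrite mul1r.
by rewrite -gaussian_ibp_pow; apply: E_eq => w; rewrite lincomb_dlt mulr1.
Qed.

(** Replace L by L + x z_s in the identity at exponent m + 1 and compare linear coefficients: one
    factor z_s comes out of the power of L, and m + 1 cancels. *)
Lemma stein_pairM t s f g : stein_pair t f g ->
  stein_pair t (fun w => f w * z s w) (fun w => g w * z s w + cov t s * f w).
Proof.
move=> [Sf Sg H]; split.
- exact: SM.
- by apply: SD; apply: SM.
move=> c m.
have pc F k : S F -> poly_coef1
    (fun x => E (fun w => F w * (lincomb c w + x * lincomb (dlt s) w) ^+ k)) _ :=
  fun SF => @poly_coef1_exp _ _ S E SE F (lincomb c) (lincomb (dlt s)) k SF (Slin c) (Slin _).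
have SztX : S (fun w => z t w * f w) by exact: SM.
have pl : poly_coef1 (fun x => E (fun w => z t w * lincomb (fun i => c i + x * dlt s i) w))
    (cov t s).
  exists ((E (fun w => z t w * lincomb c w))%:P + cov t s *: 'X); split; last first.
    by rewrite coefD coefC coefZ coefX/= mulr1 add0r.
  move=> x; rewrite hornerD hornerC hornerZ hornerX mulrC /cov -(expZ _ _ SE) -?(expD _ _ SE).
  - by apply: E_eq => w; rewrite lincombD lincomb_dlt; ring.
  - exact: SM.
  - by apply: SM => //; exact: SM.
  - exact: SM.
have := eq_poly_coef1 (pc _ m.+1 SztX) (poly_coef1D (pc _ m.+1 Sg)
   (poly_coef1M (poly_coef1Z m.+1%:R pl) (pc _ m Sf))).
have eqx : (fun x => E (fun w => z t w * f w * (lincomb c w + x * lincomb (dlt s) w) ^+ m.+1)) =1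
  (fun x => E (fun w => g w * (lincomb c w + x * lincomb (dlt s) w) ^+ m.+1) +
   m.+1%:R * E (fun w => z t w * lincomb (fun i => c i + x * dlt s i) w) *
    E (fun w => f w * (lincomb c w + x * lincomb (dlt s) w) ^+ m)).
  move=> x.
  have e F k : E (fun w => F w * (lincomb c w + x * lincomb (dlt s) w) ^+ k) =
      E (fun w => F w * lincomb (fun i => c i + x * dlt s i) w ^+ k).
    by apply: E_eq => w; rewrite lincombD.
  by rewrite !e H.
move=> /(_ eqx) /= {eqx} eqc.
apply: (@mulfI _ m.+1%:R); first by rewrite pnatr_eq0.
rewrite (E_eq _ (fun w => z t w * f w * (lincomb c w ^+ m * lincomb (dlt s) w))) => [|w]; last first.
  by rewrite lincomb_dlt; ring.
rewrite eqc.
have -> : E (fun w => (g w * z s w + cov t s * f w) * lincomb c w ^+ m) =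
  E (fun w => g w * (lincomb c w ^+ m * lincomb (dlt s) w)) +
  cov t s * E (fun w => f w * lincomb c w ^+ m).
  rewrite -(expZ _ _ SE) -?(expD _ _ SE).
  - by apply: E_eq => w; rewrite lincomb_dlt; ring.
  - by apply: SM => //; exact: SM.
  - by apply: SM; [exact: Sc|exact: SM].
  - exact: SM.
rewrite [E (fun w => f w * z s w * _)](E_eq _ (fun w => f w * (lincomb c w ^+ m.-1 * lincomb (dlt s) w))) => [|w]; last first.
  by rewrite lincomb_dlt; ring.
rewrite [E (fun w => z t w * lincomb (fun i => c i + 0 * dlt s i) w)](E_eq _ (fun w => z t w * lincomb c w)) => [|w]; last first.
  by rewrite lincombD mul0r addr0.
rewrite [E (fun w => f w * (lincomb c w + 0 * _) ^+ m)](E_eq _ (fun w => f w * lincomb c w ^+ m)) => [|w]; last first.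
  by rewrite mul0r addr0.
ring.
Qed.

Lemma stein_pair_lin t a f g f' g' : stein_pair t f g -> stein_pair t f' g' ->
  stein_pair t (fun w => f w + a * f' w) (fun w => g w + a * g' w).
Proof.
move=> [Sf Sg H] [Sf' Sg' H']; split.
- by apply: SD => //; apply: SM.
- by apply: SD => //; apply: SM.
move=> c m.
have e F F' L : S F -> S F' -> S L ->
   E (fun w => (F w + a * F' w) * L w) = E (fun w => F w * L w) + a * E (fun w => F' w * L w).
  move=> SF SF' SL; rewrite -(expZ _ _ SE) -?(expD _ _ SE).
  - by apply: E_eq => w; ring.
  - exact: SM.
  - by apply: SM; [exact: Sc|exact: SM].
  - exact: SM.
rewrite !e// [LHS](E_eq _ (fun w => (f w + a * f' w) * (z t w * lincomb c w ^+ m))) => [|w]; last by ring.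
rewrite e//; last exact: SM.
rewrite [E (fun w => f w * (z t w * _))](E_eq _ (fun w => z t w * f w * lincomb c w ^+ m)) => [|w]; last by ring.
rewrite [E (fun w => f' w * (z t w * _))](E_eq _ (fun w => z t w * f' w * lincomb c w ^+ m)) => [|w]; last by ring.
by rewrite H H'; ring.
Qed.

Lemma stein_pair_sum t (r : seq 'I_n) (f g : 'I_n -> T -> R) :
  (forall i, stein_pair t (f i) (g i)) ->
  stein_pair t (fun w => \sum_(i <- r) f i w) (fun w => \sum_(i <- r) g i w).
Proof.
move=> fg; elim: r => [|i r IH].
  have := stein_pair_lin t (-1) _ _ _ _ (stein_pair1 t) (stein_pair1 t).
  congr (stein_pair t _ _); apply/funext => w; rewrite big_nil; ring.
have := stein_pair_lin t 1 _ _ _ _ (fg i) IH.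
by congr (stein_pair t _ _); apply/funext => w; rewrite big_cons mul1r.
Qed.

Let tau := \sum_(i < n) cov i i.
Definition centered_sq_norm w := \sum_(i < n) z i w ^+ 2 - tau.
Local Notation V := centered_sq_norm.

(** The second component is the derivative of V^k z_t contracted with cov(t, .): its first term
    comes from z_t, its second from V, whose derivative in z_s is 2 z_s. *)
Lemma stein_pair_V t k : stein_pair t (fun w => V w ^+ k * z t w)
  (fun w => cov t t * V w ^+ k +
     (2 * k)%:R * (V w ^+ k.-1 * z t w * \sum_(s < n) cov t s * z s w)).
Proof.
elim: k => [|k IH].
  have := stein_pairM t t _ _ (stein_pair1 t).
  by congr (stein_pair t _ _); apply/funext => w; rewrite ?expr0 ?muln0; ring.
have H s := stein_pairM t s _ _ (stein_pairM t s _ _ IH).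
have := stein_pair_lin t (- tau) _ _ _ _ (stein_pair_sum t (index_enum 'I_n) _ _ H) IH.
congr (stein_pair t _ _); apply/funext => w.
  rewrite [X in X + _](_ : _ = (V w ^+ k * z t w) * \sum_(s < n) z s w ^+ 2); last first.
    by rewrite mulr_sumr; apply: eq_bigr => s _; ring.
  by transitivity ((\sum_(s < n) z s w ^+ 2 - tau) * V w ^+ k * z t w); [ring|rewrite exprS].
rewrite [k.+1.-1]/=.
set G := \sum_(s < n) cov t s * z s w.
set g := _ + _ * (_ * G).
rewrite [X in X + _](_ : _ = g * (\sum_(s < n) z s w ^+ 2) + 2 * (V w ^+ k * z t w) * G); last first.
  rewrite /G !mulr_sumr -big_split; apply: eq_bigr => s _ /=; ring.
have -> : \sum_(s < n) z s w ^+ 2 = V w + tau by rewrite /V subrK.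
rewrite /g exprS; case: k {IH H g} => [|k]; first by rewrite muln0 /=; ring.
by rewrite [k.+1.-1]/= exprS !mulnS !natrD; ring.
Qed.

(** One factor V is written as the sum of the z_t^2 minus tau, and one z_t of each square is
    integrated by parts. The terms cov(t, t) V^k add up to tau V^k, which the centring removes, so
    only the quadratic form of the covariance survives. *)
Lemma gaussian_quadratic_ibp k :
  E (fun w => V w ^+ k.+1) = (2 * k)%:R *
  E (fun w => V w ^+ k.-1 * \sum_(t < n) \sum_(s < n) cov t s * z t w * z s w).
Proof.
have SV : S V.
  rewrite [X in S X](_ : _ = fun w => (\sum_(i < n) z i w ^+ 2) + - tau); last by apply/funext.
  apply: SD; last exact: Sc.
  by apply: (mom_sum _ _ SE) => i; exact: (mom_exp _ _ SE).
have SG t : S (fun w => V w ^+ k.-1 * z t w * \sum_(s < n) cov t s * z s w).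
  apply: SM; first by apply: SM => //; exact: (mom_exp _ _ SE).
  by apply: (mom_sum _ _ SE) => s; apply: SM.
have SVk m : S (fun w => V w ^+ m) by exact: (mom_exp _ _ SE).
have ibp t : E (fun w => V w ^+ k * z t w ^+ 2) = cov t t * E (fun w => V w ^+ k) +
   (2 * k)%:R * E (fun w => V w ^+ k.-1 * z t w * \sum_(s < n) cov t s * z s w).
  have [_ _ /(_ (fun=> 0) 0%N)] := stein_pair_V t k.
  rewrite mul0r mul0r addr0 => H.
  rewrite -(expZ _ _ SE)// -(expZ _ _ SE)// -(expD _ _ SE); last 2 first.
    by apply: SM.
    by apply: SM.
  rewrite (E_eq _ (fun w => z t w * (V w ^+ k * z t w) * lincomb (fun=> 0) w ^+ 0)) => [|w]; last by rewrite expr0; ring.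
  by rewrite H; apply: E_eq => w; rewrite expr0; ring.
have SVz t : S (fun w => V w ^+ k * z t w ^+ 2).
  by apply: SM => //; exact: (mom_exp _ _ SE).
rewrite (E_eq _ (fun w => (\sum_(t < n) V w ^+ k * z t w ^+ 2) + (- tau) * V w ^+ k)) => [|w]; last first.
  by transitivity ((\sum_(s < n) z s w ^+ 2 - tau) * V w ^+ k); [rewrite exprS|rewrite -mulr_sumr; ring].
rewrite (expD _ _ SE); last 2 first.
  exact: (mom_sum _ _ SE).
  by apply: SM.
rewrite (exp_sum_ord _ _ SE)// (expZ _ _ SE)// (eq_bigr _ (fun t _ => ibp t)).
rewrite big_split/= -mulr_suml -/tau mulNr addrAC subrr add0r -mulr_sumr.
congr (_ * _); rewrite -(exp_sum_ord _ _ SE)//; apply: E_eq => w.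
rewrite mulr_sumr; apply: eq_bigr => t _.
by rewrite !mulr_sumr; apply: eq_bigr => s _; ring.
Qed.

Variable K : R.
Hypothesis K_ge0 : 0 <= K.
Hypothesis covK : forall c, E (fun w => lincomb c w ^+ 2) <= K * \sum_(i < n) c i ^+ 2.

(** The quadratic form is at most K (V + tau) <= K (V + n K). The odd power of V that this creates
    is absorbed by completing the square (V - a)^2: half of V^(2q+2) moves to the left, and the
    remaining factor doubles to a^2 + 2 a n K. *)
Lemma gaussian_sq_norm_moment_step q :
  E (fun w => V w ^+ (2 * q.+1)) <=
  4 * K ^+ 2 * (2 * q + 1)%:R * (2 * q + 1 + n)%:R * E (fun w => V w ^+ (2 * q)).
Proof.
have SV : S V.
  rewrite [X in S X](_ : _ = fun w => (\sum_(i < n) z i w ^+ 2) + - tau); last by apply/funext.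
  apply: SD; last exact: Sc.
  by apply: (mom_sum _ _ SE) => i; exact: (mom_exp _ _ SE).
have SVk m : S (fun w => V w ^+ m) by exact: (mom_exp _ _ SE).
have quad c : \sum_(t < n) \sum_(s < n) cov t s * c t * c s =
    E (fun w => lincomb c w ^+ 2).
  transitivity (\sum_(t < n) \sum_(s < n) E (fun w => c t * c s * (z t w * z s w))).
    apply: eq_bigr => t _; apply: eq_bigr => s _; rewrite (expZ _ _ SE); last exact: SM.
    by rewrite /cov; ring.
  rewrite (eq_bigr (fun t => E (fun w => \sum_(s < n) c t * c s * (z t w * z s w)))) => [|t _]; last first.
    by rewrite (exp_sum_ord _ _ SE)// => s; apply: SM; [exact: Sc|exact: SM].
  rewrite -(exp_sum_ord _ _ SE) => [|t]; last first.
    by apply: (mom_sum _ _ SE) => s; apply: SM; [exact: Sc|exact: SM].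
  apply: E_eq => w; rewrite expr2 /lincomb mulr_suml; apply: eq_bigr => t _.
  by rewrite mulr_sumr; apply: eq_bigr => s _; ring.
have tauK : tau <= n%:R * K.
  rewrite /tau -[n in leRHS]card_ord -sumr_const mulr_suml.
  apply: ler_sum => t _; rewrite mul1r.
  have := covK (dlt t).
  rewrite (E_eq _ (fun w => z t w * z t w)) => [|w]; last by rewrite lincomb_dlt expr2.
  rewrite (bigD1 t)//= {1}/dlt eqxx expr1n big1 ?addr0 ?mulr1// => s /negPf st.
  by rewrite /dlt st expr0n.
have V2q_ge0 w : 0 <= V w ^+ (2 * q) by rewrite exprM exprn_ge0// sqr_ge0.
have E2q_ge0 : 0 <= E (fun w => V w ^+ (2 * q)).
  by rewrite -[leLHS](exp_cst _ _ SE); apply: (exp_mono _ _ SE).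
set a := (2 * (2 * q + 1))%:R * K.
have a_ge0 : 0 <= a by rewrite mulr_ge0.
have step : E (fun w => V w ^+ (2 * q.+1)) <=
    E (fun w => 2^-1 * V w ^+ (2 * q.+1) + (2^-1 * a ^+ 2 + a * (n%:R * K)) * V w ^+ (2 * q)).
  have -> : (2 * q.+1 = (2 * q + 1).+1)%N by rewrite mulnS addnC addn1 addn2.
  rewrite gaussian_quadratic_ibp -(expZ _ _ SE); last first.
    apply: SM; first exact: SVk.
    apply: (mom_sum _ _ SE) => t; apply: (mom_sum _ _ SE) => s.
    by apply: SM => //; apply: SM.
  apply: (exp_mono _ _ SE).
  - apply: SM; first exact: Sc.
    apply: SM; first exact: SVk.
    apply: (mom_sum _ _ SE) => t; apply: (mom_sum _ _ SE) => s.
    by apply: SM => //; apply: SM.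
  - by apply: SD; apply: SM.
  (* At a fixed outcome, the values z_i(w) themselves serve as the coefficient vector in the
     covariance bound. *)
  move=> w; rewrite addn1 /= quad.
  apply: (@le_trans _ _ (a * (V w ^+ (2 * q) * (V w + n%:R * K)))).
    rewrite /a addn1 -mulrA; apply: ler_wpM2l => //.
    rewrite mulrCA; apply: ler_wpM2l => //.
    apply: (le_trans (covK _)); apply: ler_wpM2l => //.
    by rewrite /V -addrA lerDl addrC subr_ge0.
  rewrite -[(2 * q).+2]addn2 (exprD _ (2 * q) 2) -subr_ge0.
  rewrite [leRHS](_ : _ = V w ^+ (2 * q) * (2^-1 * (V w - a) ^+ 2)); last by field.
  by rewrite mulr_ge0// mulr_ge0// ?invr_ge0// sqr_ge0.
rewrite (expD _ _ SE) ?(expZ _ _ SE) in step => //; try by apply: SM.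
have {step} : E (fun w => V w ^+ (2 * q.+1)) <=
    (a ^+ 2 + 2 * a * (n%:R * K)) * E (fun w => V w ^+ (2 * q)).
  by lra.
congr (_ <= _ * _); rewrite /a natrM natrD natrM [in RHS]natrD; ring.
Qed.

(** The step is iterated q times; since 2i + 1 <= 2q for i < q, every factor is at most 8 K^2 q (2q
    + n). *)
Lemma gaussian_sq_norm_moment q :
  E (fun w => V w ^+ (2 * q)) <= (8 * K ^+ 2 * q%:R * (2 * q + n)%:R) ^+ q.
Proof.
have B_ge0 : 0 <= 8 * K ^+ 2 * q%:R * (2 * q + n)%:R.
  by rewrite !mulr_ge0// sqr_ge0.
suff : forall i, (i <= q)%N -> E (fun w => V w ^+ (2 * i)) <=
    (8 * K ^+ 2 * q%:R * (2 * q + n)%:R) ^+ i by exact.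
elim=> [_|i IH iq].
  by rewrite (E_eq _ (fun=> 1))// (exp_cst _ _ SE).
apply: (le_trans (gaussian_sq_norm_moment_step i)).
rewrite [leRHS]exprS; apply: ler_pM; last exact/IH/ltnW.
- by rewrite !mulr_ge0// sqr_ge0.
- rewrite -[leLHS](exp_cst _ _ SE); apply: (exp_mono _ _ SE) => //; last first.
    by move=> w; rewrite exprM exprn_ge0// sqr_ge0.
  have SV : S V.
    rewrite [X in S X](_ : _ = fun w => (\sum_(i < n) z i w ^+ 2) + - tau); last by apply/funext.
    apply: SD; last exact: Sc.
    by apply: (mom_sum _ _ SE) => ?; exact: (mom_exp _ _ SE).
  exact: (mom_exp _ _ SE).
rewrite (_ : 8 * K ^+ 2 * q%:R = 4 * K ^+ 2 * (2 * q)%:R); last by rewrite natrM; ring.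
have k0 : 0 <= 4 * K ^+ 2 by rewrite mulr_ge0// sqr_ge0.
rewrite -!(mulrA (4 * K ^+ 2)); apply: ler_wpM2l => //; rewrite -!natrM ler_nat.
by apply: leq_mul; rewrite ?leq_add2r; lia.
Qed.
End GaussianVector.

(** * Integrals of continuous functions and orthogonality of cosines *)

Section ContinuousIntegrals.
Context {R : realType}.
Local Notation leb := (@lebesgue_measure R).
Implicit Types (f g : R -> R) (c d : R).

Lemma continuous_itv_integrable {f c d} : continuous f ->
  leb.-integrable `]c, d] (EFin \o f).
Proof.
move=> cf; apply: (@integrableS _ _ _ leb `[c, d]%classic); [exact: measurable_itv|exact: measurable_itv| |].
  by apply: subset_itvr; rewrite bnd_simp.
apply: continuous_compact_integrable; first exact: segment_compact.
exact: continuous_subspaceT.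
Qed.

(** Half-open intervals are used throughout because adjacent ones are disjoint, so that integrals
    over them add up exactly. *)
Lemma continuous_Rintegral_cat f c d e : continuous f -> c <= d -> d <= e ->
  \int[leb]_(x in `]c, e]) f x =
  \int[leb]_(x in `]c, d]) f x + \int[leb]_(x in `]d, e]) f x.
Proof.
move=> cf cd de.
have U : `]c, e]%classic = `]c, d]%classic `|` `]d, e]%classic :> set R.
  by rewrite -itv_bndbnd_setU ?bnd_simp.
rewrite U Rintegral_setU//=; first by rewrite -U; exact: continuous_itv_integrable.
apply/disj_setPS => y [/=]; rewrite !in_itv/= => /andP[_ yd] /andP[dy _].
by move: (lt_le_trans dy yd); rewrite ltxx.
Qed.

Lemma cvg_bigsum {I : Type} {X : Type} {G : set_system X} {FG : Filter G} (r : seq I)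
    (Q : pred I) (F : I -> X -> R) (l : I -> R) :
  (forall i, F i x @[x --> G] --> l i) ->
  \sum_(i <- r | Q i) F i x @[x --> G] --> \sum_(i <- r | Q i) l i.
Proof.
move=> Fl; elim: r => [|i r IH].
  by rewrite big_nil; under eq_fun do rewrite big_nil; exact: cvg_cst.
rewrite big_cons; under eq_fun do rewrite big_cons.
by case: (Q i) => //; apply: cvgD.
Qed.

Lemma continuous_sum_fun I (r : seq I) (Q : pred I) (F : I -> R -> R) :
  (forall i, continuous (F i)) -> continuous (fun x => \sum_(i <- r | Q i) F i x).
Proof. by move=> cF x; apply: cvg_bigsum => i; exact: cF. Qed.

Lemma continuous_Rintegral_sum c d I (r : seq I) (F : I -> R -> R) :
  (forall i, continuous (F i)) ->
  \int[leb]_(x in `]c, d]) (\sum_(i <- r) F i x) =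
  \sum_(i <- r) \int[leb]_(x in `]c, d]) F i x.
Proof.
move=> cF; elim: r => [|i r IH].
  by rewrite big_nil; under eq_Rintegral do rewrite big_nil; rewrite Rintegral_cst// mul0r.
under eq_Rintegral do rewrite big_cons.
rewrite RintegralD//; first by rewrite big_cons IH.
- exact: continuous_itv_integrable.
- by apply: continuous_itv_integrable; exact: continuous_sum_fun.
Qed.

Lemma continuousM_fun f g : continuous f -> continuous g ->
  continuous (fun x => f x * g x).
Proof. by move=> cf cg x; apply: cvgM; [exact: cf|exact: cg]. Qed.

Lemma continuous_cos_affine a k : continuous (fun x : R => cos (a + k * x)).
Proof.
move=> x; apply: (continuous_comp (f := fun x => a + k * x)); last exact: continuous_cos.
by apply: cvgD; [exact: cvg_cst|apply: cvgM; [exact: cvg_cst|exact: cvg_id]].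
Qed.

Lemma integral_cos_affine (a : R) (j : int) :
  \int[leb]_(x in `]- pi, pi]) cos (a + j%:~R * x) =
  if j == 0 then 2 * pi * cos a else 0.
Proof.
have pN : - pi < pi :> R by have := @pi_gt0 R; lra.
case: eqP => [->|/eqP j0].
  under eq_Rintegral do rewrite mul0r addr0.
  rewrite Rintegral_cst//= lebesgue_measure_itv/= lte_fin pN/=.
  by ring.
have jR : j%:~R != 0 :> R by rewrite intr_eq0.
rewrite Rintegral_itv_obnd_cbnd; last first.
  by apply: continuous_itv_integrable; exact: continuous_cos_affine.
pose F (x : R) : R := j%:~R^-1 * sin (a + j%:~R * x).
have dF (x : R) : is_derive x 1 F (cos (a + j%:~R * x)).
  rewrite /F; apply: is_derive_eq.
  by rewrite /GRing.scale/=; field.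
have cF : continuous F.
  move=> x; apply: differentiable_continuous; apply/derivable1_diffP.
  by have [] := dF x.
rewrite /Rintegral (continuous_FTC2 (F := F)) => //.
- rewrite -EFinB /F /= -mulrBr.
  rewrite (_ : sin (a + j%:~R * pi) - sin (a + j%:~R * - pi) = 0) ?mulr0//.
  rewrite mulrN sinD sinB.
  suff -> : sin (j%:~R * pi) = 0 :> R by ring.
  have sn (k : nat) : sin (k%:R * pi) = 0 :> R.
    elim: k => [|k IH]; first by rewrite mul0r sin0.
    by rewrite -natr1 mulrDl mul1r sinDpi IH oppr0.
  case: j {j0 jR F dF cF} => k; first exact: sn.
  by rewrite NegzE mulrNz mulNr sinN sn oppr0.
- by apply: continuous_subspaceT; exact: continuous_cos_affine.
- split.
  + by move=> x _; have [] := dF x.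
  + exact: (cvg_at_right_filter (cF _)).
  + exact: (cvg_at_left_filter (cF _)).
- by move=> x _; rewrite derive1E; have [_ ->] := dF x.
Qed.

Lemma integral_cos_cos (h k : nat) (t : R) :
  \int[leb]_(x in `]- pi, pi]) (cos (h%:R * (t - x)) * cos (k%:R * x)) =
  if h == k then (if h == 0%N then 2 * pi else pi * cos (h%:R * t)) else 0.
Proof.
transitivity (\int[leb]_(x in `]- pi, pi])
    (2^-1 * cos (h%:R * t + (k%:Z - h%:Z)%:~R * x)
     + 2^-1 * cos (h%:R * t + (- (h%:Z + k%:Z))%:~R * x))).
  apply: eq_Rintegral => x _; rewrite -mulrDr rmorphB rmorphN rmorphD/=.
  have -> : h%:R * t + (k%:R - h%:R) * x = h%:R * (t - x) + k%:R * x by ring.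
  have -> : h%:R * t + - (h%:R + k%:R) * x = h%:R * (t - x) - k%:R * x by ring.
  by rewrite cosD cosB; field.
have ci j : leb.-integrable `]- pi, pi] (EFin \o (fun x : R => cos (h%:R * t + j * x))).
  by apply: continuous_itv_integrable; exact: continuous_cos_affine.
rewrite RintegralD//; last 2 first.
- by apply: continuous_itv_integrable => x; apply: cvgM; [exact: cvg_cst|exact: continuous_cos_affine].
- by apply: continuous_itv_integrable => x; apply: cvgM; [exact: cvg_cst|exact: continuous_cos_affine].
rewrite !RintegralZl// !integral_cos_affine subr_eq0 eqz_nat eq_sym.
case: eqP => [->|hk].
  rewrite oppr_eq0 -PoszD eqz_nat addn_eq0 andbb; case: eqP => [->|_].
    by rewrite mul0r cos0; field.
  by field.
rewrite oppr_eq0 -PoszD eqz_nat addn_eq0; case: andP => [[/eqP h0 /eqP k0]|_].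
  by case: hk; rewrite h0 k0.
by rewrite !mulr0 addr0.
Qed.

End ContinuousIntegrals.

(** * Fejer sums of a positive semidefinite sequence *)

Section FejerMeans.
Context {R : realType}.
Local Notation leb := (@lebesgue_measure R).
Implicit Types (c : nat -> R) (n : nat) (x t : R).

Definition natdist (s t : nat) : nat := (s - t + (t - s))%N.

Lemma cos_natdist (s t : nat) x : cos ((s%:R - t%:R) * x) = cos ((natdist s t)%:R * x).
Proof.
rewrite /natdist; have [st|ts] := leqP s t.
  by rewrite (eqP (_ : s - t == 0)%N) ?subn_eq0// add0n natrB// -cosN; congr cos; ring.
by rewrite (eqP (_ : t - s == 0)%N) ?subn_eq0 1?ltnW// addn0 natrB 1?ltnW.
Qed.

(** The squared modulus of the trigonometric polynomial with terms c_s exp(i s x), written as a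
    double sum so that only the lags occur. *)
Definition trig_weight c n x : R :=
  \sum_(s < n) \sum_(t < n) c s * c t * cos ((natdist s t)%:R * x).

Lemma trig_weightE c n x : trig_weight c n x =
  (\sum_(s < n) c s * cos (s%:R * x)) ^+ 2 + (\sum_(s < n) c s * sin (s%:R * x)) ^+ 2.
Proof.
rewrite !expr2 !mulr_suml -big_split; apply: eq_bigr => s _ /=.
rewrite !mulr_sumr -big_split; apply: eq_bigr => t _ /=.
by rewrite -cos_natdist mulrBl cosB; ring.
Qed.

Lemma trig_weight_ge0 c n x : 0 <= trig_weight c n x.
Proof. by rewrite trig_weightE addr_ge0// sqr_ge0. Qed.

Lemma continuous_trig_weight c n t : continuous (fun x => trig_weight c n (t - x)).
Proof.
apply: continuous_sum_fun => i; apply: continuous_sum_fun => j x.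
apply: cvgM; first exact: cvg_cst.
rewrite [X in X x @[x --> _] --> _](_ : _ = fun x => cos ((natdist i j)%:R * t + - (natdist i j)%:R * x)).
  rewrite (_ : _ * (t - x) = (natdist i j)%:R * t + - (natdist i j)%:R * x); last by ring.
  exact: continuous_cos_affine.
by apply/funext => y; congr cos; ring.
Qed.

(** All arguments s x stay within 1/2, and there cos^2 >= 1/2, because the double angle is at most 1
    <= pi/2 and has a nonnegative cosine. The square of the sine sum is dropped. *)
Lemma dirichlet_weight_ge n x : n%:R * `|x| <= 2^-1 ->
  2^-1 * n%:R ^+ 2 <= trig_weight (fun=> 1) n x.
Proof.
move=> nx; rewrite trig_weightE.
have r0 : 0 <= Num.sqrt 2^-1 :> R by rewrite sqrtr_ge0.
have cosge (s : 'I_n) : Num.sqrt 2^-1 <= cos (s%:R * x).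
  have sx : `|s%:R * x| <= 2^-1.
    rewrite normrM ger0_norm//; apply: le_trans nx.
    by rewrite ler_wpM2r// ler_nat ltnW.
  have p1 := @pihalf_ge1 R.
  move: sx; set y := s%:R * x => /[!ler_norml] /andP[y1 y2].
  have c0 : 0 <= cos y by apply: cos_ge0_pihalf; apply/andP; split; lra.
  rewrite -ler_sqr ?nnegrE// sqr_sqrtr ?invr_ge0//.
  have : 0 <= cos (y *+ 2) by apply: cos_ge0_pihalf; apply/andP; split; lra.
  by rewrite cos_mulr2n; lra.
apply: (@le_trans _ _ ((\sum_(s < n) 1 * cos (s%:R * x)) ^+ 2)); last first.
  by rewrite lerDl sqr_ge0.
have -> : 2^-1 * n%:R ^+ 2 = (\sum_(s < n) Num.sqrt 2^-1) ^+ 2 :> R.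
  by rewrite sumr_const card_ord -[Num.sqrt _ *+ n]mulr_natl exprMn sqr_sqrtr ?invr_ge0//; ring.
rewrite ler_sqr ?nnegrE//.
- by apply: ler_sum => s _; rewrite mul1r.
- by apply: sumr_ge0.
- by apply: sumr_ge0 => s _; rewrite mul1r (le_trans r0).
Qed.

Variable gam : nat -> R.

Definition fourier_sum (m : nat) x : R :=
  gam 0%N + 2 * \sum_(k < m) gam k.+1 * cos (k.+1%:R * x).

(** n times the n-th Fejer mean of the cosine series of [gam]; in the form of a double sum its sign
    can be read off from positive semidefiniteness. *)
Definition fejer_sum n x : R :=
  \sum_(s < n) \sum_(t < n) gam (natdist s t) * cos ((natdist s t)%:R * x).

Lemma fejer_sumE n x : fejer_sum n x = \sum_(m < n) fourier_sum m x.
Proof.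
elim: n => [|n IH]; first by rewrite /fejer_sum !big_ord0.
rewrite [RHS]big_ord_recr/= -IH /fejer_sum big_ord_recr/= big_ord_recr/=.
under eq_bigr do rewrite big_ord_recr/=.
rewrite big_split/= /natdist subnn addn0 mul0r cos0 mulr1 /fourier_sum.
have -> : \sum_(i < n) gam (n - i + (i - n))%N * cos ((n - i + (i - n))%:R * x) =
    \sum_(k < n) gam k.+1 * cos (k.+1%:R * x).
  rewrite (reindex_inj rev_ord_inj)/=; apply: eq_bigr => i _.
  have -> : (n - (n - i.+1) + (n - i.+1 - n))%N = i.+1 by have := ltn_ord i; lia.
  by [].
have -> : \sum_(i < n) gam (i - n + (n - i))%N * cos ((i - n + (n - i))%:R * x) =
    \sum_(k < n) gam k.+1 * cos (k.+1%:R * x).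
  rewrite (reindex_inj rev_ord_inj)/=; apply: eq_bigr => i _.
  have -> : (n - i.+1 - n + (n - (n - i.+1)))%N = i.+1 by have := ltn_ord i; lia.
  by [].
by ring.
Qed.

Let contcos0 (h : nat) : continuous (fun x : R => cos (h%:R * x)).
Proof.
rewrite (_ : (fun x => _) = fun x => cos (0 + h%:R * x)).
  exact: continuous_cos_affine.
by apply/funext => x; rewrite add0r.
Qed.

Lemma continuous_fourier_sum m : continuous (fourier_sum m).
Proof.
move=> x; apply: cvgD; first exact: cvg_cst.
apply: cvgM; first exact: cvg_cst.
apply: cvg_bigsum => i; apply: cvgM; first exact: cvg_cst.
exact: contcos0.
Qed.

Lemma continuous_fejer_sum n : continuous (fejer_sum n).
Proof.
rewrite (_ : fejer_sum n = fun x => \sum_(m < n) fourier_sum m x).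
  by apply: continuous_sum_fun => m; exact: continuous_fourier_sum.
by apply/funext => x; exact: fejer_sumE.
Qed.

Let contcos (h : nat) t : continuous (fun x => cos (h%:R * (t - x))).
Proof.
rewrite (_ : (fun x => _) = fun x => cos (h%:R * t + - h%:R * x)).
  exact: continuous_cos_affine.
by apply/funext => x; congr cos; ring.
Qed.

Let Icos (h : nat) t f : continuous f ->
  leb.-integrable `]- pi, pi] (EFin \o (fun x => cos (h%:R * (t - x)) * f x)).
Proof. by move=> cf; apply: continuous_itv_integrable; apply: continuousM_fun. Qed.

Lemma integral_cos_fourier_sum (h m : nat) t :
  \int[leb]_(x in `]- pi, pi]) (cos (h%:R * (t - x)) * fourier_sum m x) =
  if (h <= m)%N then 2 * pi * gam h * cos (h%:R * t) else 0.
Proof.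
transitivity (\int[leb]_(x in `]- pi, pi]) (gam 0%N * (cos (h%:R * (t - x)) * cos (0%N%:R * x))
   + \sum_(k < m) 2 * gam k.+1 * (cos (h%:R * (t - x)) * cos (k.+1%:R * x)))).
  apply: eq_Rintegral => x _; rewrite /fourier_sum mul0r cos0 mulrDr mulr1.
  congr (_ + _); first by rewrite mulrC.
  by rewrite !mulr_sumr; apply: eq_bigr => k _; ring.
have cc a (k : nat) : continuous (fun x => a * (cos (h%:R * (t - x)) * cos (k%:R * x))).
  by apply: continuousM_fun; [move=> x; exact: cvg_cst|apply: continuousM_fun].
rewrite RintegralD//; last 2 first.
- exact: continuous_itv_integrable.
- by apply: continuous_itv_integrable; apply: continuous_sum_fun => k.
rewrite continuous_Rintegral_sum => [|k]; last exact: cc.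
rewrite RintegralZl//; last exact: Icos.
rewrite integral_cos_cos.
under eq_bigr => k _.
  rewrite RintegralZl//; last exact: Icos.
  rewrite integral_cos_cos; over.
case: h {cc} => [|h].
  rewrite eqxx /= mul0r cos0 big1 => [|k _]; first by ring.
  by rewrite mulr0.
rewrite mulr0 add0r /=; case: ifPn => [hm|]; last first.
  rewrite -leqNgt => mh; rewrite big1// => k _; case: eqP => [hk|]; last by rewrite mulr0.
  by have := ltn_ord k; lia.
rewrite (bigD1 (Ordinal hm))//= eqxx big1 ?addr0 => [|k]; first by ring.
rewrite eq_sym -val_eqE/= => /negPf hk; by rewrite eqSS hk mulr0.
Qed.

Lemma integral_cos_fejer_sum (h n : nat) t :
  \int[leb]_(x in `]- pi, pi]) (cos (h%:R * (t - x)) * fejer_sum n x) =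
  2 * pi * (gam h * cos (h%:R * t)) * (n - h)%:R.
Proof.
transitivity (\int[leb]_(x in `]- pi, pi])
   (\sum_(m < n) (cos (h%:R * (t - x)) * fourier_sum m x))).
  by apply: eq_Rintegral => x _; rewrite fejer_sumE mulr_sumr.
rewrite continuous_Rintegral_sum => [|m]; last first.
  by apply: continuousM_fun => //; exact: continuous_fourier_sum.
under eq_bigr do rewrite integral_cos_fourier_sum.
elim: n => [|n IH]; first by rewrite big_ord0 mulr0.
rewrite big_ord_recr/= IH; have [hn|nh] := leqP h n.
  by rewrite subSn// -natr1; ring.
have -> : (n.+1 - h = n - h)%N by lia.
by rewrite addr0.
Qed.

Lemma integral_trig_weight_fejer_sum c (n N : nat) t :
  \int[leb]_(x in `]- pi, pi]) (trig_weight c n (t - x) * fejer_sum N x) =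
  2 * pi * \sum_(i < n) \sum_(j < n) c i * c j * (gam (natdist i j) *
    cos ((natdist i j)%:R * t)) * (N - natdist i j)%:R.
Proof.
have cA := continuous_fejer_sum N.
have ci (i j : nat) : continuous (fun x => c i * c j * (cos ((natdist i j)%:R * (t - x)) * fejer_sum N x)).
  by apply: continuousM_fun; [move=> x; exact: cvg_cst|apply: continuousM_fun].
transitivity (\int[leb]_(x in `]- pi, pi]) \sum_(i < n) \sum_(j < n)
   c i * c j * (cos ((natdist i j)%:R * (t - x)) * fejer_sum N x)).
  apply: eq_Rintegral => x _; rewrite /trig_weight mulr_suml; apply: eq_bigr => i _.
  by rewrite mulr_suml; apply: eq_bigr => j _; rewrite mulrA.
rewrite continuous_Rintegral_sum => [|i]; last exact: continuous_sum_fun.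
rewrite mulr_sumr; apply: eq_bigr => i _.
rewrite continuous_Rintegral_sum//.
rewrite mulr_sumr; apply: eq_bigr => j _.
rewrite RintegralZl//; last exact: Icos.
rewrite integral_cos_fejer_sum; ring.
Qed.

(** The substitute for Fourier inversion. Orthogonality multiplies the lag h by N + 1 - h; only the
    lags below n occur in the weight, and (N + 1 - h) / (N + 1) tends to 1 for each of them. *)
Lemma cvg_integral_trig_weight_fejer c (n : nat) t :
  N.+1%:R^-1 * \int[leb]_(x in `]- pi, pi]) (trig_weight c n (t - x) * fejer_sum N.+1 x)
  @[N --> \oo] -->
  2 * pi * \sum_(i < n) \sum_(j < n) c i * c j * (gam (natdist i j) *
    cos ((natdist i j)%:R * t)).
Proof.
under eq_fun do rewrite integral_trig_weight_fejer_sum mulrCA.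
apply: cvgM; first exact: cvg_cst.
under eq_fun do rewrite mulr_sumr.
apply: cvg_bigsum => i; under eq_fun do rewrite mulr_sumr.
apply: cvg_bigsum => j; under eq_fun do rewrite mulrCA.
set h := natdist i j; set a := c i * c j * _.
suff H : (N.+1%:R^-1 * (N.+1 - h)%:R : R) @[N --> \oo] --> (1 : R).
  by by rewrite -[Y in nbhs Y]mulr1; apply: cvgM H; exact: cvg_cst.
suff H : (N.+1%:R^-1 * (N.+1 - h)%:R : R) @[N --> \oo] --> (1 - h%:R * 0 : R).
  by move: H; rewrite mulr0 subr0.
apply: (@cvg_trans _ ((1 - h%:R * N.+1%:R^-1 : R) @[N --> \oo])); last first.
  apply: cvgB; first exact: cvg_cst.
  by apply: cvgM; [exact: cvg_cst|exact: cvg_harmonic].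
apply: near_eq_cvg; near=> N.
have hN : (h <= N.+1)%N by near: N; exists h => // k /= /leqW.
by rewrite /= natrB// mulrBr mulVf ?pnatr_eq0//; ring.
Unshelve. all: by end_near. Qed.

Hypothesis gam_psd : forall n c,
  0 <= \sum_(s < n) \sum_(t < n) c s * c t * gam (natdist s t).

(** cos(s x - t x) splits into two Gram terms, so the form is tested on the vectors cos(s x) and
    sin(s x). *)
Lemma fejer_sum_ge0 n x : 0 <= fejer_sum n x.
Proof.
have := addr_ge0 (gam_psd n (fun s => cos (s%:R * x))) (gam_psd n (fun s => sin (s%:R * x))).
rewrite -big_split/=; under eq_bigr do rewrite -big_split/=.
congr (0 <= _); apply: eq_bigr => s _; apply: eq_bigr => t _.
by rewrite -cos_natdist mulrBl cosB; ring.
Qed.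

Variable g : R -> R.
Hypothesis fourier_cvg : forall x, - pi <= x <= pi ->
  fourier_sum m x @[m --> \oo] --> g x.

Lemma fejer_mean_cvg x : - pi <= x <= pi ->
  N.+1%:R^-1 * fejer_sum N.+1 x @[N --> \oo] --> g x.
Proof.
move=> /fourier_cvg/cesaro; apply: cvg_trans; apply: near_eq_cvg; near=> N.
by rewrite /arithmetic_mean /series/= big_mkord fejer_sumE.
Unshelve. all: by end_near. Qed.

Lemma fourier_limit_ge0 x : - pi <= x <= pi -> 0 <= g x.
Proof.
move=> /fejer_mean_cvg gx; rewrite -(cvg_lim _ gx)//; apply: limr_ge.
  by apply/cvg_ex; exists (g x).
by near=> N; rewrite mulr_ge0// fejer_sum_ge0.
Unshelve. all: by end_near. Qed.

(** A weight with M coefficients equal to 1, centred at x, is at least M^2 / 2 on the interval as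
    soon as M (d - c) <= 1/2. Its full integral against the Fejer means tends to 2 pi times the
    Fejer sum of order M at x, which is below M (g x + eps) for large M. Only convergence at the
    single point x is used: [delta] depends on x, and the threshold for N depends on the
    interval. *)
Lemma fejer_mean_local x (eps : R) : - pi <= x <= pi -> 0 < eps ->
  exists2 delta : R, 0 < delta & forall c d : R, - pi <= c -> c <= x -> x <= d -> d <= pi ->
    c < d -> d - c < delta ->
    \forall N \near \oo, N.+1%:R^-1 * \int[leb]_(y in `]c, d]) fejer_sum N.+1 y <=
      16 * pi * (g x + eps) * (d - c).
Proof.
move=> xpi eps0; have gx0 := fourier_limit_ge0 x xpi.
have /cvgr_lt/(_ (g x + eps / 2)) := fejer_mean_cvg x xpi.
have -> : g x < g x + eps / 2 by rewrite ltrDl divr_gt0.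
move=> /(_ isT) [M0 _ M0P].
exists (2 * M0.+1%:R)^-1; first by rewrite invr_gt0 mulr_gt0.
move=> c d pic cx xd dpi cd dcd.
have dc0 : 0 < d - c by rewrite subr_gt0.
have inv0 : 0 <= (2 * (d - c))^-1 by rewrite invr_ge0 mulr_ge0// ltW.
(* The largest order with M (d - c) <= 1/2, whence 1/M <= 4 (d - c). The constant 16 pi is the
   product of this 4, of 2 pi, and of the 2 from the lower bound M^2 / 2. *)
pose M := Num.truncn (2 * (d - c))^-1.
have /andP[Mle Mgt] : M%:R <= (2 * (d - c))^-1 < M.+1%:R by exact: truncn_itv.
have M0M : (M0 < M)%N.
  rewrite -ltnS -(ltr_nat R) (le_lt_trans _ Mgt)// -[leLHS]invrK lef_pV2 ?posrE ?mulr_gt0//.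
  move: dcd; rewrite invfM => dcd.
  by rewrite -ler_pdivlMl// ltW.
have Mpos : 0 < M%:R :> R by rewrite ltr0n (leq_trans _ M0M).
have Mdc : M%:R * (d - c) <= 2^-1.
  have := ler_wpM2r (ltW dc0) Mle; rewrite invfM -mulrA mulVf ?mulr1// gt_eqF//.
have Minv : M%:R^-1 <= 4 * (d - c).
  rewrite -[leRHS]invrK lef_pV2 ?posrE// ?invr_gt0 ?mulr_gt0//.
  rewrite -[4]/(2 + 2)%:R natrD.
  have -> : (2%:R + 2%:R) * (d - c) = 2 * (2 * (d - c)) by ring.
  rewrite invfM; have : M.+1%:R <= 2 * M%:R :> R.
    by rewrite -natrM ler_nat mul2n -addnn -addn1 leq_add2l (leq_trans _ M0M).
  by move=> ?; lra.
have := M0P M.-1; rewrite prednK ?(leq_trans _ M0M)//= => /(_ _) MF.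
have {}MF : M%:R^-1 * fejer_sum M x < g x + eps / 2.
  by apply: MF; rewrite -ltnS prednK// (leq_trans _ M0M).
have lim := cvg_integral_trig_weight_fejer (fun=> 1) M x.
have /cvgr_lt/(_ (2 * pi * (M%:R * (g x + eps)))) := lim.
have -> : 2 * pi * (\sum_(i < M) \sum_(j < M) 1 * 1 *
    (gam (natdist i j) * cos ((natdist i j)%:R * x))) < 2 * pi * (M%:R * (g x + eps)).
  rewrite ltr_pM2l ?mulr_gt0 ?pi_gt0//.
  rewrite (_ : \sum_(i < M) _ = fejer_sum M x); last first.
    by apply: eq_bigr => i _; apply: eq_bigr => j _; rewrite !mul1r.
  by move: MF; rewrite ltr_pdivrMl// => /lt_trans; apply; rewrite ltr_pM2l// ltrD2l; lra.
move=> /(_ isT); apply: filterS => N bN.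
set a := _ * \int[_]_(_ in _) _.
suff : 2^-1 * M%:R ^+ 2 * a <= 2 * pi * (M%:R * (g x + eps)).
  move=> H; have {}H : a <= 4 * pi * (g x + eps) * M%:R^-1.
    rewrite -ler_pdivlMl ?mulr_gt0 ?exprn_gt0// in H.
    by rewrite (le_trans H)// le_eqVlt; apply/orP; left; apply/eqP; field; rewrite gt_eqF.
  apply: (le_trans H); rewrite (_ : 16 * pi * (g x + eps) * (d - c) = 4 * pi * (g x + eps) * (4 * (d - c))); last by ring.
  by rewrite ler_wpM2l// !mulr_ge0// ?pi_ge0// addr_ge0// ltW.
apply: le_trans (ltW bN); rewrite /a mulrCA ler_wpM2l ?invr_ge0//.
have cF := @continuous_fejer_sum N.+1.
have cWF : continuous (fun y => trig_weight (fun=> 1) M (x - y) * fejer_sum N.+1 y).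
  by apply: continuousM_fun => //; exact: continuous_trig_weight.
have F0 := fejer_sum_ge0 N.+1.
have WF0 y : 0 <= trig_weight (fun=> 1) M (x - y) * fejer_sum N.+1 y.
  by rewrite mulr_ge0// trig_weight_ge0.
rewrite (continuous_Rintegral_cat _ (- pi) c pi cWF)//; last by lra.
rewrite (continuous_Rintegral_cat _ c d pi cWF)//; last by exact: ltW.
apply: ler_wpDl; first by apply: Rintegral_ge0.
apply: ler_wpDr; first by apply: Rintegral_ge0.
rewrite -RintegralZl//; last exact: continuous_itv_integrable.
apply: le_Rintegral => //.
- apply: continuous_itv_integrable; apply: continuousM_fun => //.
  by move=> y; exact: cvg_cst.
- exact: continuous_itv_integrable.
move=> y /=; rewrite in_itv/= => /andP[cy yd]; rewrite ler_wpM2r//.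
apply: dirichlet_weight_ge; apply: le_trans Mdc; rewrite ler_wpM2l//.
by rewrite ler_norml; apply/andP; split; lra.
Qed.

End FejerMeans.

(* Cousin's lemma, in the form: an additive property of intervals which holds
   for all small intervals around each point holds globally. *)
Lemma interval_additive_local_global {R : realType} (Q : R -> R -> Prop) (a b : R) :
  a < b ->
  (forall c d e, a <= c -> c < d -> d < e -> e <= b -> Q c d -> Q d e -> Q c e) ->
  (forall x, a <= x <= b -> exists2 delta : R, 0 < delta &
     forall c d, a <= c -> c <= x -> x <= d -> d <= b -> c < d -> d - c < delta -> Q c d) ->
  Q a b.
Proof.
move=> ab Qadd Qloc.
(* The right ends that can be reached from a. The local property at [sup S] shows that the supremum
   is reached, and that it would be passed if it were below b. *)
pose S : set R := [set x | a < x <= b /\ Q a x].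
have [da da0 daP] := Qloc a (introT andP (conj (lexx a) (ltW ab))).
pose x0 := Num.min b (a + da / 2).
have ax0 : a < x0 by rewrite /x0 lt_min ab/= ltrDl divr_gt0.
have x0b : x0 <= b by rewrite /x0 ge_min lexx.
have Sx0 : S x0.
  split; first by rewrite ax0.
  apply: daP => //; first exact: ltW.
  have : x0 <= a + da / 2 by rewrite /x0 ge_min lexx orbT.
  by lra.
have supS : has_sup S.
  by split; [exists x0|exists b => x [/andP[]]].
have sb : sup S <= b by apply: sup_le_ub; [exists x0|move=> x [/andP[]]].
have as_ : a < sup S by apply: (lt_le_trans ax0); apply: sup_upper_bound.
have [ds ds0 dsP] := Qloc (sup S) (introT andP (conj (ltW as_) sb)).
have [y Sy ys] := sup_adherent (divr_gt0 ds0 (ltr0n R 2)) supS.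
have ysup : y <= sup S by apply: sup_upper_bound.
have [/andP[ay yb] Qay] := Sy.
have Qas : Q a (sup S).
  have [<-//|yns] := eqVneq y (sup S).
  have ylt : y < sup S by rewrite lt_neqAle yns.
  apply: (Qadd _ _ _ _ ay ylt) => //; apply: dsP => //; first exact: ltW.
  by move: ys; lra.
have [<-//|snb] := eqVneq (sup S) b.
have slt : sup S < b by rewrite lt_neqAle snb.
pose z := Num.min b (sup S + ds / 2).
have sz : sup S < z by rewrite /z lt_min slt/= ltrDl divr_gt0.
have zb : z <= b by rewrite /z ge_min lexx.
have Sz : S z.
  split; first by rewrite zb andbT; exact: lt_trans sz.
  apply: (Qadd _ _ _ _ as_ sz) => //.
  apply: dsP => //; [exact: ltW|exact: ltW|].
  have : z <= sup S + ds / 2 by rewrite /z ge_min lexx orbT.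
  by lra.
have := sup_upper_bound supS Sz; by rewrite leNgt sz.
Qed.

(** * Toeplitz forms bounded by the essential supremum of the spectral density *)

Section ToeplitzBound.
Context {R : realType}.
Local Notation leb := (@lebesgue_measure R).

(* Vitali-Caratheodory: a null set carries a function of small integral which
   is arbitrarily large near each of its points. *)
Lemma null_set_blowup {E : set R} {eps : R} : measurable E -> leb E = 0%E -> 0 < eps ->
  exists psi : R -> \bar R, [/\ measurable_fun setT psi, (forall x, 0 <= psi x)%E,
    (\int[leb]_x psi x <= eps%:E)%E &
    forall x (A : R), E x -> exists2 delta : R, 0 < delta &
      forall y, `|y - x| < delta -> (A%:E <= psi y)%E].
Proof.
move=> mE E0 eps0.
have ek0 k : 0 < eps / (2 ^ k.+1)%:R / k.+1%:R :> R.
  by rewrite !divr_gt0// ltr0n expn_gt0.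
have Ok k : exists G : set R, [/\ open G, E `<=` G &
    (leb G <= (eps / (2 ^ k.+1)%:R / k.+1%:R)%:E)%E].
  have Efin : (leb E < +oo)%E by rewrite E0 ltry.
  have [G [oG EG lG]] := lebesgue_regularity_outer mE Efin (ek0 k).
  exists G; split=> //.
  rewrite -(setDUK EG).
  apply: (@le_trans _ _ (leb E + leb (G `\` E))%E).
    by apply: measureU2 => //; apply: measurableD => //; exact: open_measurable.
  by rewrite E0 add0e ltW.
have [Og OP] := choice Ok.
have mO k : measurable (Og k) by apply: open_measurable; case: (OP k).
(* The k-th neighbourhood of E has measure at most eps / (2^(k+1) (k+1)), so that with the weight k
   + 1 it contributes at most eps / 2^(k+1). On E all terms are present, and one of them with k + 1
   > A is already large enough. *)
pose f k (x : R) : \bar R := (k.+1%:R * \1_(Og k) x)%:E.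
have f0 k x : (0 <= f k x)%E by rewrite lee_fin mulr_ge0// indicE.
have mi k : measurable_fun [set: R] (fun x : R => (\1_(Og k) x : R)%:E).
  by apply/measurable_EFinP; exact: measurable_indic.
have mf k : measurable_fun setT (f k).
  by apply/measurable_EFinP; apply: measurable_funM => //; exact: measurable_indic.
exists (fun x => \sum_(0 <= k <oo) f k x)%E; split.
- by apply: ge0_emeasurable_sum => // k x _ _.
- by move=> x; apply: nneseries_ge0.
- rewrite integral_nneseries//.
  apply: (@le_trans _ _ (\sum_(0 <= k <oo) (eps / (2 ^ k.+1)%:R)%:E)%E).
    apply: lee_nneseries => [k _ _|k _]; first exact: integral_ge0.
    rewrite /f; under eq_integral do rewrite EFinM.
    rewrite ge0_integralZl//; last exact: mi.
    have -> : (\int[leb]_x (\1_(Og k) x)%:E = leb (Og k))%E.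
      rewrite integral_indic ?setIT//; exact: mO.
    have [_ _ lG] := OP k.
    apply: (@le_trans _ _ ((k.+1%:R : R)%:E * (eps / (2 ^ k.+1)%:R / k.+1%:R)%:E)%E).
      by apply: lee_wpmul2l.
    by rewrite -EFinM mulrC divfK ?pnatr_eq0.
  exact: (@epsilon_trick0 R eps xpredT (ltW eps0)).
- move=> x A Ex; pose k := Num.truncn A.
  have [oG EG _] := OP k.
  have /nbhs_ballP[delta /= delta0 dP] : nbhs x (Og k) by apply: open_nbhs_nbhs; split=> //; exact: EG.
  exists delta => // y yx; have Oy : Og k y by apply: dP; rewrite /ball/= distrC.
  apply: (@le_trans _ _ (f k y)).
    rewrite /f indicE mem_set// mulr1 lee_fin ltW// truncnS_gt//.
  rewrite (@nneseriesD1 _ _ k)//.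
  by rewrite leeDl// nneseries_ge0.
Qed.

(** Parseval's identity for the trigonometric polynomial behind the weight. *)
Lemma integral_trig_weight (c : nat -> R) (n : nat) :
  \int[leb]_(x in `]- pi, pi]) trig_weight c n (0 - x) = 2 * pi * \sum_(s < n) c s ^+ 2.
Proof.
have ci (i j : nat) : continuous (fun x : R =>
    c i * c j * (cos ((natdist i j)%:R * (0 - x)) * cos (0%N%:R * x))).
  apply: continuousM_fun; first by move=> x; exact: cvg_cst.
  apply: continuousM_fun => x.
    rewrite (_ : (fun x => _) = (fun x => cos (0 + - (natdist i j)%:R * x))).
      exact: continuous_cos_affine.
    by apply/funext => y; congr cos; ring.
  rewrite (_ : (fun x => _) = (fun=> 1)); first exact: cvg_cst.
  by apply/funext => y; rewrite mul0r cos0.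
transitivity (\int[leb]_(x in `]- pi, pi]) \sum_(i < n) \sum_(j < n)
   c i * c j * (cos ((natdist i j)%:R * (0 - x)) * cos (0%N%:R * x))).
  apply: eq_Rintegral => x _; apply: eq_bigr => i _; apply: eq_bigr => j _.
  by rewrite mul0r cos0 mulr1.
rewrite continuous_Rintegral_sum => [|i]; last exact: continuous_sum_fun.
rewrite mulr_sumr; apply: eq_bigr => i _.
rewrite continuous_Rintegral_sum//.
have Iij (j : 'I_n) : \int[leb]_(x in `]- pi, pi]) (c i * c j *
    (cos ((natdist i j)%:R * (0 - x)) * cos (0%N%:R * x))) =
    if j == i then 2 * pi * c i ^+ 2 else 0.
  have cc : continuous (fun x : R => cos ((natdist i j)%:R * (0 - x)) * cos (0%N%:R * x)).
    apply: continuousM_fun => x.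
      rewrite (_ : (fun x => _) = (fun x => cos (0 + - (natdist i j)%:R * x))).
        exact: continuous_cos_affine.
      by apply/funext => y; congr cos; ring.
    rewrite (_ : (fun x => _) = (fun=> 1)); first exact: cvg_cst.
    by apply/funext => y; rewrite mul0r cos0.
  rewrite RintegralZl//; last exact: continuous_itv_integrable.
  rewrite integral_cos_cos; have [->|ji] := eqVneq j i.
    by rewrite /natdist subnn /=; ring.
  have /negPf -> : natdist i j != 0%N.
    by move: ji; rewrite -val_eqE/= /natdist; lia.
  by rewrite mulr0.
by rewrite (eq_bigr _ (fun j _ => Iij j)) -big_mkcond/= big_pred1_eq.
Qed.

Variables (gam : nat -> R) (g : R -> R) (B : R).
Hypothesis gam_psd : forall n (c : nat -> R),
  0 <= \sum_(s < n) \sum_(t < n) c s * c t * gam (natdist s t).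
Hypothesis fourier_cvg : forall x, - pi <= x <= pi ->
  fourier_sum gam m x @[m --> \oo] --> g x.
Hypothesis B_ge0 : 0 <= B.
Variable E : set R.
Hypothesis mE : measurable E.
Hypothesis E0 : leb E = 0%E.
Hypothesis g_le : forall x, - pi <= x <= pi -> ~ E x -> g x <= B.

(** Where g <= B, the local estimate and the continuity of the weight give the first term. On the
    exceptional set g has no uniform bound; there [psi], which is at least g x + eps near x, pays
    for it, through a term whose total is at most 16 pi w1 eps. *)
Let toeplitz_bound_eps (c : nat -> R) n eps w1 : 0 < eps ->
  (forall x, trig_weight c n (0 - x) <= w1) -> 0 <= w1 ->
  2 * pi * \sum_(s < n) \sum_(t < n) c s * c t * gam (natdist s t) <=
  16 * pi * (B + eps) * (2 * pi * \sum_(s < n) c s ^+ 2 + 2 * pi * eps) +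
  16 * pi * w1 * eps.
Proof.
move=> eps0 ww1 w10.
have [psi [mpsi psi0 Ipsi psiE]] := null_set_blowup mE E0 eps0.
pose w x := trig_weight c n (0 - x).
have cw : continuous w by exact: continuous_trig_weight.
have w_ge0 x : 0 <= w x by exact: trig_weight_ge0.
have cweps : continuous (fun x => w x + eps).
  by move=> x; apply: cvgD; [exact: cw|exact: cvg_cst].
have cF N := @continuous_fejer_sum R gam N.+1.
have cwF N : continuous (fun x => w x * fejer_sum gam N.+1 x) by exact: continuousM_fun.
have F0 N y : 0 <= fejer_sum gam N.+1 y by exact: fejer_sum_ge0.
have pi0 := @pi_gt0 R.
have pi16 : 0 <= 16 * pi :> R by rewrite mulr_ge0// ltW.
have Beps : 0 <= B + eps by rewrite addr_ge0// ltW.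
have K1ge0 : 0 <= 16 * pi * (B + eps) by rewrite mulr_ge0.
have K2ge0 : 0 <= 16 * pi * w1 by rewrite mulr_ge0.
have psiI (c0 d0 : R) : (0 <= \int[leb]_(x in `]c0, d0]) psi x)%E by exact: integral_ge0.
have mpsiI (D : set R) : measurable_fun D psi by exact: measurable_funTS.
(* Both sides are additive in the interval and two eventual statements in N combine, so Q fits
   Cousin's lemma. The slack eps added to [w] absorbs the oscillation of the weight on a small
   interval. *)
pose Q c0 d0 := \forall N \near \oo,
  ((N.+1%:R^-1 * \int[leb]_(x in `]c0, d0]) (w x * fejer_sum gam N.+1 x))%:E <=
   (16 * pi * (B + eps) * \int[leb]_(x in `]c0, d0]) (w x + eps))%:E +
   (16 * pi * w1)%:E * \int[leb]_(x in `]c0, d0]) psi x)%E.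
have : Q (- pi) pi.
  apply: interval_additive_local_global.
  - by lra.
  - move=> c0 d0 e0 _ /ltW cd /ltW de _ Q1 Q2; near=> N.
    rewrite (continuous_Rintegral_cat _ c0 d0 e0)// (continuous_Rintegral_cat _ c0 d0 e0 cweps)//.
    have U : `]c0, e0]%classic = `]c0, d0]%classic `|` `]d0, e0]%classic :> set R.
      by rewrite -itv_bndbnd_setU ?bnd_simp.
    rewrite [X in (_ * X)%E](_ : _ = \int[leb]_(x in `]c0, d0]) psi x +
        \int[leb]_(x in `]d0, e0]) psi x)%E; last first.
      rewrite U ge0_integral_setU//; first exact: mpsiI.
      apply/disj_setPS => y [/=]; rewrite !in_itv/= => /andP[_ yd] /andP[dy _].
      by move: (lt_le_trans dy yd); rewrite ltxx.
    rewrite ge0_muleDr//.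
    set K1 := 16 * pi * (B + eps).
    rewrite (mulrDr (N.+1%:R^-1)) (mulrDr K1) !EFinD addeACA; apply: leeD.
    + by near: N; exact: Q1.
    + by near: N; exact: Q2.
  move=> x xpi.
  have [d1 d10 d1P] := fejer_mean_local gam gam_psd g fourier_cvg x eps xpi eps0.
  have gx0 := fourier_limit_ge0 gam gam_psd g fourier_cvg x xpi.
  have loc c0 d0 : - pi <= c0 -> c0 <= x -> x <= d0 -> d0 <= pi -> c0 < d0 -> d0 - c0 < d1 ->
      forall wmax, 0 <= wmax -> (forall y, c0 < y <= d0 -> w y <= wmax) ->
      \forall N \near \oo,
       N.+1%:R^-1 * \int[leb]_(x in `]c0, d0]) (w x * fejer_sum gam N.+1 x) <=
       wmax * (16 * pi * (g x + eps) * (d0 - c0)).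
    move=> p1 p2 p3 p4 p5 p6 wmax wmax0 wm.
    have := d1P c0 d0 p1 p2 p3 p4 p5 p6; apply: filterS => N HN.
    apply: le_trans (ler_wpM2l wmax0 HN).
    rewrite mulrCA ler_wpM2l ?invr_ge0// -RintegralZl//; last exact: continuous_itv_integrable.
    apply: le_Rintegral => //.
    + exact: continuous_itv_integrable.
    + by apply: continuous_itv_integrable; apply: continuousM_fun => // y; exact: cvg_cst.
    + by move=> y /=; rewrite in_itv/= => /wm ?; rewrite ler_wpM2r.
  have [Ex|nEx] := pselect (E x).
    have [d2 d20 d2P] := psiE x (g x + eps) Ex.
    exists (Num.min d1 d2); first by rewrite lt_min d10.
    move=> c0 d0 p1 p2 p3 p4 p5; rewrite lt_min => /andP[p6 p7].
    have := loc c0 d0 p1 p2 p3 p4 p5 p6 w1 w10 (fun y _ => ww1 y).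
    apply: filterS => N HN; apply: lee_paddl.
      rewrite lee_fin; apply: mulr_ge0; first exact: K1ge0.
      by apply: Rintegral_ge0 => y _; rewrite addr_ge0// ltW.
    apply: (@le_trans _ _ (w1 * (16 * pi * (g x + eps) * (d0 - c0)))%:E); first by rewrite lee_fin.
    rewrite (_ : w1 * _ = 16 * pi * w1 * ((g x + eps) * (d0 - c0))); last by ring.
    rewrite EFinM; apply: lee_wpmul2l; first by rewrite lee_fin; exact: K2ge0.
    apply: (@le_trans _ _ (\int[leb]_(y in `]c0, d0]) (g x + eps)%:E)%E).
      rewrite integral_cst//= lebesgue_measure_itv/= lte_fin p5 -EFinB -EFinM//.
    apply: ge0_le_integral => //.
    + by move=> y _; rewrite lee_fin addr_ge0// ltW.
    + exact: mpsiI.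
    + move=> y /=; rewrite in_itv/= => /andP[cy yd]; apply: d2P.
      by rewrite ltr_norml; apply/andP; split; lra.
  have gB := g_le x xpi nEx.
  have /cvgrPdist_lt/(_ (eps / 2)) := cw x.
  have -> : 0 < eps / 2 by rewrite divr_gt0.
  move=> /(_ isT) /nbhs_ballP[d2 /= d20 d2P].
  exists (Num.min d1 d2); first by rewrite lt_min d10.
  move=> c0 d0 p1 p2 p3 p4 p5; rewrite lt_min => /andP[p6 p7].
  have wx y : c0 < y <= d0 -> `|w x - w y| < eps / 2.
    move=> /andP[cy yd]; apply: d2P; rewrite /ball/= ltr_norml.
    by apply/andP; split; lra.
  have wm y : c0 < y <= d0 -> w y <= w x + eps / 2.
    by move=> /wx; rewrite ltr_norml => /andP[? ?]; lra.
  have wm0 : 0 <= w x + eps / 2 by rewrite addr_ge0// divr_ge0// ltW.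
  have := loc c0 d0 p1 p2 p3 p4 p5 p6 _ wm0 wm.
  apply: filterS => N HN; apply: lee_paddr.
    by apply: mule_ge0 => //; rewrite lee_fin; exact: K2ge0.
  rewrite lee_fin; apply: (le_trans HN).
  apply: (@le_trans _ _ (16 * pi * (B + eps) * ((w x + eps / 2) * (d0 - c0)))).
    rewrite (_ : _ * (16 * pi * (g x + eps) * (d0 - c0)) =
      16 * pi * (g x + eps) * ((w x + eps / 2) * (d0 - c0))); last by ring.
    rewrite ler_wpM2r//; first by rewrite mulr_ge0// subr_ge0 ltW.
    by rewrite ler_wpM2l ?lerD2r// mulr_ge0// ltW.
  apply: ler_wpM2l; first exact: K1ge0.
  have -> : (w x + eps / 2) * (d0 - c0) = \int[leb]_(y in `]c0, d0]) (w x + eps / 2).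
    by rewrite Rintegral_cst//= lebesgue_measure_itv/= lte_fin p5.
  apply: le_Rintegral => //.
  + by apply: continuous_itv_integrable => y; exact: cvg_cst.
  + exact: continuous_itv_integrable.
  + move=> y /=; rewrite in_itv/= => /wx; rewrite ltr_norml => /andP[? ?]; lra.
rewrite /Q {Q}; set RHS := (_ + _)%E => HQ.
have RHSle : (RHS <= (16 * pi * (B + eps) * (2 * pi * \sum_(s < n) c s ^+ 2 + 2 * pi * eps) +
  16 * pi * w1 * eps)%:E)%E.
  rewrite /RHS EFinD; apply: leeD.
    rewrite RintegralD//; last 2 first.
    - exact: continuous_itv_integrable.
    - by apply: continuous_itv_integrable => y; exact: cvg_cst.
    rewrite integral_trig_weight Rintegral_cst//= lebesgue_measure_itv/= lte_fin.
    rewrite (_ : - pi < pi); last by lra.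
    by rewrite lee_fin/= le_eqVlt; apply/orP; left; apply/eqP; ring.
  rewrite [X in (_ <= X)%E]EFinM; apply: lee_wpmul2l; first by rewrite lee_fin; exact: K2ge0.
  apply: le_trans Ipsi; apply: ge0_subset_integral => //.
have := cvg_integral_trig_weight_fejer gam c n 0.
set L := (X in 2 * pi * X); set L' := (X in _ -> 2 * pi * X <= _).
have -> : L = L'.
  by apply: eq_bigr => i _; apply: eq_bigr => j _; rewrite mulr0 cos0 mulr1.
move=> lim; rewrite -(cvg_lim _ lim)//; apply: limr_le.
  by apply/cvg_ex; exists (2 * pi * L').
by apply: filterS HQ => N /le_trans/(_ RHSle); rewrite lee_fin.
Unshelve. all: by end_near. Qed.

Lemma toeplitz_bound (c : nat -> R) n :
  \sum_(s < n) \sum_(t < n) c s * c t * gam (natdist s t) <=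
  16 * pi * B * \sum_(s < n) c s ^+ 2.
Proof.
have pi0 := @pi_gt0 R.
pose w1 := \sum_(s < n) \sum_(t < n) `|c s * c t|.
have w10 : 0 <= w1 by apply: sumr_ge0 => s _; apply: sumr_ge0.
have ww1 x : trig_weight c n (0 - x) <= w1.
  apply: ler_sum => s _; apply: ler_sum => t _.
  apply: (le_trans (ler_norm _)); rewrite normrM ler_piMr// cos_max//.
set C2 := \sum_(s < n) c s ^+ 2.
have C20 : 0 <= C2 by apply: sumr_ge0 => s _; rewrite sqr_ge0.
set L := \sum_(s < n) _.
rewrite -(@ler_pM2l _ (2 * pi)) ?mulr_gt0//; apply/ler_addgt0Pr => e e0.
(* For eps <= 1 the error terms add up to at most eps D, with a gap of 32 pi^2 eps (1 - eps). *)
pose D := 16 * pi * (2 * pi * C2) + 16 * pi * (B + 1) * (2 * pi) + 16 * pi * w1.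
have p2 : 0 <= 2 * pi :> R by rewrite mulr_ge0// ltW.
have p16 : 0 <= 16 * pi :> R by rewrite mulr_ge0// ltW.
have D0 : 0 <= D.
  apply: addr_ge0; last exact: mulr_ge0.
  apply: addr_ge0; first by apply: mulr_ge0 => //; exact: mulr_ge0.
  by apply: mulr_ge0 => //; apply: mulr_ge0 => //; exact: addr_ge0.
pose eps := Num.min 1 (e / (D + 1)).
have eps0 : 0 < eps by rewrite lt_min ltr01/= divr_gt0// ltr_wpDl.
have eps1 : eps <= 1 by rewrite ge_min lexx.
have epsD : eps * D <= e.
  apply: (@le_trans _ _ (e / (D + 1) * D)).
    by rewrite ler_wpM2r// ge_min lexx orbT.
  rewrite -mulrA; apply: ler_piMr; first exact: ltW.
  by rewrite mulrC ler_pdivrMr ?ltr_wpDl// mul1r lerDl.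
apply: (le_trans (toeplitz_bound_eps c n eps w1 eps0 ww1 w10)); rewrite -/C2.
apply: le_trans (_ : _ <= 2 * pi * (16 * pi * B * C2) + eps * D) _; last by rewrite lerD2l.
rewrite /D -subr_ge0 [leRHS](_ : _ = 32 * pi ^+ 2 * eps * (1 - eps)); last by ring.
by apply: mulr_ge0; [apply: mulr_ge0; [apply: mulr_ge0 => //; exact: exprn_ge0 (ltW pi0)|exact: ltW]|rewrite subr_ge0].
Qed.

End ToeplitzBound.

(** * Central moments of the normal law *)

Section NormalMoments.
Context {R : realType}.
Local Notation leb := (@lebesgue_measure R).
Variables (m s : R).
Hypothesis s0 : s != 0.
Local Notation phi := (normal_pdf m s).
Local Notation nu := (normal_prob m s).

Let s2_gt0 : 0 < s ^+ 2.
Proof.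
by rewrite exprn_even_gt0.
Qed.

Let cphi : continuous phi.
Proof. exact: continuous_normal_pdf. Qed.

Let cq (k : nat) : continuous (fun x : R => (x - m) ^+ k).
Proof.
move=> x; apply: (continuous_comp (f := fun x => x - m) (g := fun y => y ^+ k)).
  by apply: cvgB; [exact: cvg_id|exact: cvg_cst].
exact: exprn_continuous.
Qed.

Let cqphi (k : nat) : continuous (fun x : R => (x - m) ^+ k * phi x).
Proof.
move=> x; apply: cvgM; [exact: cq|exact: cphi].
Qed.

Let Iqphi (k : nat) (c d : R) : leb.-integrable `[c, d] (EFin \o (fun x => (x - m) ^+ k * phi x)).
Proof.
apply: continuous_compact_integrable; first exact: segment_compact.
apply: continuous_subspaceT; exact: cqphi.
Qed.

Let is_derive_phi (x : R) : is_derive x 1 phi (- ((x - m) / s ^+ 2) * phi x).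
Proof.
rewrite normal_pdfE// /normal_fun; apply: is_derive_eq.
rewrite /GRing.scale/=.
by field; rewrite ?s0 /=.
Qed.

Let is_derive_q (k : nat) (x : R) :
  is_derive x 1 (fun y => (y - m) ^+ k.+1) (k.+1%:R * (x - m) ^+ k).
Proof.
elim: k => [|k IH].
  rewrite (_ : (fun y => _) = fun y => y - m); last first.
    by apply/funext => y; rewrite expr1.
  apply: is_derive_eq.
  by rewrite expr0; ring.
rewrite (_ : (fun y => _) = fun y => (y - m) * (y - m) ^+ k.+1); last first.
  by apply/funext => y; rewrite exprS.
apply: is_derive_eq.
rewrite /GRing.scale/= exprS -(natr1 k.+1).
by ring.
Qed.

Let is_derive_qphi (k : nat) (x : R) :
  is_derive x 1 (fun y => (y - m) ^+ k.+1 * phi y)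
    (k.+1%:R * ((x - m) ^+ k * phi x) - (s ^+ 2)^-1 * ((x - m) ^+ k.+2 * phi x)).
Proof.
have dphi := is_derive_phi x.
have dq := is_derive_q k x.
apply: is_derive_eq.
rewrite /GRing.scale/= !exprS !expr0.
by field.
Qed.

Local Notation I n := (`[m - n%:R, m + n%:R]%classic : set R).

(** Moments truncated to a symmetric interval around the mean: integration by parts is exact there,
    and the limit in n is taken only at the end. *)
Let J (k n : nat) := \int[leb]_(x in I n) ((x - m) ^+ k * phi x).

Let phi_sym (n : nat) : phi (m - n%:R) = phi (m + n%:R).
Proof.
rewrite normal_pdfE// /normal_fun.
have -> : m + n%:R - m = n%:R by ring.
have -> : m - n%:R - m = - n%:R by ring.
by rewrite sqrrN.
Qed.

Let FTC (F f : R -> R) (c d : R) : c <= d -> continuous f ->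
  (forall x : R, is_derive x 1 F (f x)) -> \int[leb]_(x in `[c, d]) f x = F d - F c.
Proof.
move=> cd cf dF; move: cd; rewrite le_eqVlt => /predU1P[->|cd].
  rewrite subrr set_itv1 Rintegral_set1.
  by [].
have cF : continuous F.
  move=> x; apply: differentiable_continuous; apply/derivable1_diffP.
  by have [] := dF x.
rewrite /Rintegral (continuous_FTC2 (F := F))//.
- exact: continuous_subspaceT.
- split.
  + by move=> x _; have [] := dF x.
  + exact: (cvg_at_right_filter (cF _)).
  + exact: (cvg_at_left_filter (cF _)).
- by move=> x _; rewrite derive1E; have [_ ->] := dF x.
Qed.

Let mnm (n : nat) : m - n%:R <= m + n%:R.
Proof.
by have := ler0n R n; lra.
Qed.

Let J_rec k n : J k.+2 n = s ^+ 2 * (k.+1%:R * J k n -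
  (n%:R ^+ k.+1 - (- n%:R) ^+ k.+1) * phi (m + n%:R)).
Proof.
have cf : continuous (fun x : R => k.+1%:R * ((x - m) ^+ k * phi x) - (s ^+ 2)^-1 * ((x - m) ^+ k.+2 * phi x)).
  move=> x; apply: cvgB.
    by apply: cvgM; [exact: cvg_cst|exact: cqphi].
  by apply: cvgM; [exact: cvg_cst|exact: cqphi].
have := FTC _ _ _ _ (mnm n) cf (is_derive_qphi k).
have I1 : leb.-integrable (I n) (EFin \o (fun x => k.+1%:R * ((x - m) ^+ k * phi x))).
  apply: continuous_compact_integrable; first exact: segment_compact.
  apply: continuous_subspaceT => x.
  by apply: cvgM; [exact: cvg_cst|exact: cqphi].
have I2 : leb.-integrable (I n) (EFin \o (fun x => (s ^+ 2)^-1 * ((x - m) ^+ k.+2 * phi x))).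
  apply: continuous_compact_integrable; first exact: segment_compact.
  apply: continuous_subspaceT => x.
  by apply: cvgM; [exact: cvg_cst|exact: cqphi].
rewrite RintegralB// !RintegralZl// -/(J k n) -/(J k.+2 n) phi_sym.
have -> : m + n%:R - m = n%:R by ring.
have -> : m - n%:R - m = - n%:R by ring.
rewrite -mulrBl => <-.
by field.
Qed.

Let J1 n : J 1%N n = 0.
Proof.
have cf : continuous (fun x : R => - ((x - m) / s ^+ 2) * phi x).
  move=> x; apply: cvgM; last exact: cphi.
  apply: cvgN; apply: cvgM; last exact: cvg_cst.
  by apply: cvgB; [exact: cvg_id|exact: cvg_cst].
have := FTC _ _ _ _ (mnm n) cf is_derive_phi.
rewrite phi_sym subrr => H.
have -> : J 1%N n = - s ^+ 2 * \int[leb]_(x in I n) (- ((x - m) / s ^+ 2) * phi x).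
  rewrite -RintegralZl//; last first.
    apply: continuous_compact_integrable; first exact: segment_compact.
    exact: continuous_subspaceT.
  apply: eq_Rintegral => x _.
  by field.
by rewrite H mulr0.
Qed.

(** On a bounded interval the integrand is bounded, hence integrable under the law before any moment
    is known to exist; the Radon-Nikodym derivative is then identified with the density. *)
Let normal_prob_pow_itv (k n : nat) :
  (\int[nu]_(x in I n) ((x - m) ^+ k)%:E)%E = (J k n)%:E.
Proof.
have mq : measurable_fun (I n) (EFin \o (fun x : R => (x - m) ^+ k)).
  apply/measurable_EFinP; apply: measurable_funTS.
  by apply: measurable_funX; apply: measurable_funB.
have Iq : nu.-integrable (I n) (EFin \o (fun x : R => (x - m) ^+ k)).
  apply: measurable_bounded_integrable => //.
  - apply: (@le_lt_trans _ _ 1%E); last exact: ltry.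
    by apply: probability_le1.
  - by apply/measurable_EFinP.
  - exists (n%:R ^+ k); split; first exact: num_real.
    move=> y yn x /= xi; apply: le_trans (ltW yn).
    rewrite normrX; apply: lerXn2r; rewrite ?nnegrE//.
    move: xi; rewrite in_itv/= ler_norml => /andP[? ?].
    by apply/andP; split; lra.
rewrite -(Radon_Nikodym_change_of_variables (normal_prob_dominates m s))//=.
rewrite /J fineK; last first.
  exact: (integrable_fin_num _ (Iqphi k _ _)).
under [RHS]eq_integral => x _ do rewrite EFinM.
apply: ae_eq_integral => //.
- apply: emeasurable_funM => //; apply: (measurable_int leb).
  apply: (integrableS _ _ (@subsetT _ _)) => //=.
  by apply: Radon_Nikodym_integrable; exact: normal_prob_dominates.
- apply: emeasurable_funM => //=; apply/measurableT_comp => //=.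
  by apply/measurable_funTS; exact: measurable_normal_pdf.
- idtac.
  apply: ae_eqe_mul2l => /=.
  rewrite Radon_NikodymE//=; first exact: normal_prob_dominates.
  move=> abmu.
  case: cid => /= h [h1 h2 h3].
  apply: integral_ae_eq => //=.
  + exact: integrableS h2.
  + by apply/measurable_funTS/measurableT_comp => //; exact: measurable_normal_pdf.
  + by move=> E E01 mE; rewrite -h3.
Qed.

Let mq (k : nat) : measurable_fun [set: R] (fun x : R => ((x - m) ^+ k)%:E).
Proof.
apply/measurable_EFinP; apply: measurable_funX.
by apply: measurable_funB.
Qed.

Let mI n : measurable (I n).
Proof.
exact: measurable_itv.
Qed.

Let phi_ge0 x : 0 <= phi x.
Proof.
exact: normal_pdf_ge0.
Qed.

Let J_even_ge0 k n : 0 <= J (2 * k) n.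
Proof.
apply: Rintegral_ge0 => x _; apply: mulr_ge0; last exact: phi_ge0.
by rewrite exprM exprn_ge0// sqr_ge0.
Qed.

(** For even exponents the two boundary terms have the same sign. Both summands on the left are
    therefore nonnegative, and the right side bounds the next moment and the boundary term at
    once. *)
Let J_even_rec k n : J (2 * k.+1) n + 2 * s ^+ 2 * (n%:R ^+ (2 * k).+1 * phi (m + n%:R)) =
  s ^+ 2 * ((2 * k).+1%:R * J (2 * k) n).
Proof.
rewrite (_ : 2 * k.+1 = (2 * k).+2)%N; last by lia.
rewrite J_rec; have -> : (- n%:R) ^+ (2 * k).+1 = - n%:R ^+ (2 * k).+1 :> R.
  by rewrite exprNn -signr_odd /= mul2n odd_double /= expr1 mulN1r.
by ring.
Qed.

Let J0_le n : J 0 n <= 1.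
Proof.
rewrite -lee_fin -normal_prob_pow_itv.
rewrite (eq_integral (cst 1%E)); last by move=> x _; rewrite expr0.
rewrite integral_cst//= mul1e.
exact: probability_le1.
Qed.

Let bnd_ge0 j n : 0 <= n%:R ^+ j * phi (m + n%:R).
Proof.
by rewrite mulr_ge0.
Qed.

Let J_even_bound k : exists2 C, 0 <= C & forall n, J (2 * k) n <= C.
Proof.
elim: k => [|k [C C0 CP]].
  by exists 1 => // n; rewrite muln0; exact: J0_le.
exists (s ^+ 2 * ((2 * k).+1%:R * C)); first by apply: mulr_ge0; [exact: sqr_ge0|apply: mulr_ge0].
move=> n; apply: (@le_trans _ _ (s ^+ 2 * ((2 * k).+1%:R * J (2 * k) n))).
  rewrite -J_even_rec lerDl; apply: mulr_ge0; last exact: bnd_ge0.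
  by rewrite mulr_ge0// sqr_ge0.
rewrite ler_wpM2l ?sqr_ge0//.
by rewrite ler_wpM2l.
Qed.

(** The decay comes from the recursion and not from an estimate of the exponential: n^(2j+1) phi(m +
    n) is bounded in n, and n^j is smaller than n^(2j+1) by at least a factor n. *)
Let bnd_cvg0 j : n%:R ^+ j * phi (m + n%:R) @[n --> \oo] --> (0 : R).
Proof.
have [C C0 CP] := J_even_bound j.
pose D := (s ^+ 2 * ((2 * j).+1%:R * C)) / (2 * s ^+ 2).
have H n : n.+1%:R ^+ j * phi (m + n.+1%:R) <= D * n.+1%:R^-1.
  rewrite ler_pdivlMr// /D ler_pdivlMr; last first.
    by rewrite mulr_gt0.
  apply: (@le_trans _ _ (2 * s ^+ 2 * (n.+1%:R ^+ (2 * j).+1 * phi (m + n.+1%:R)))).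
    rewrite mulrC ler_wpM2l//; first by rewrite mulr_ge0// sqr_ge0.
    rewrite mulrAC ler_wpM2r// -exprSr.
    apply: ler_weXn2l; first by rewrite ler1n.
    by lia.
  apply: (@le_trans _ _ (s ^+ 2 * ((2 * j).+1%:R * J (2 * j) n.+1))).
    rewrite -J_even_rec lerDr.
    exact: J_even_ge0.
  rewrite ler_wpM2l ?sqr_ge0//.
  by rewrite ler_wpM2l.
rewrite -(cvg_shiftS (fun n => n%:R ^+ j * phi (m + n%:R))).
apply: (@squeeze_cvgr _ _ _ _ (fun=> 0) (fun n => D * n.+1%:R^-1)).
- by apply: nearW => n; rewrite bnd_ge0 H.
- exact: cvg_cst.
- rewrite -[X in _ --> X](mulr0 D).
  by apply: cvgM; [exact: cvg_cst|exact: cvg_harmonic].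
Qed.

Let I_nd : {homo (fun n : nat => I n) : n k / (n <= k)%N >-> (n <= k)%O}.
Proof.
move=> n k nk; apply/subsetPset => x; rewrite /= !in_itv/= => /andP[x1 x2].
have nkR : n%:R <= k%:R :> R by rewrite ler_nat.
by apply/andP; split; lra.
Qed.

Let I_cover x : \forall n \near \oo, I n x.
Proof.
exists (Num.truncn `|x - m|).+1 => // n /= xn.
have h : `|x - m| <= n%:R.
  apply: (le_trans (ltW (truncnS_gt _))).
  by rewrite ler_nat.
rewrite /= in_itv/=.
by move: h; rewrite ler_norml => /andP[? ?]; apply/andP; split; lra.
Qed.

Let integrable_even k : nu.-integrable setT (fun x : R => ((x - m) ^+ (2 * k))%:E).
Proof.
apply/integrableP; split; first exact: mq.
have [C C0 CP] := J_even_bound k.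
apply: (@le_lt_trans _ _ C%:E); last exact: ltry.
have q0 (x : R) : (0 <= ((x - m) ^+ (2 * k))%:E)%E.
  by rewrite lee_fin exprM exprn_ge0// sqr_ge0.
under eq_integral => x _ do rewrite (gee0_abs (q0 x)).
have UI : \bigcup_n I n = setT.
  rewrite -subTset => x _; have [n _ nP] := I_cover x.
  by exists n => //; apply: nP => /=.
rewrite -UI.
have lim : (\int[nu]_(x in I n) ((x - m) ^+ (2 * k))%:E @[n --> \oo] -->
   \int[nu]_(x in \bigcup_n I n) ((x - m) ^+ (2 * k))%:E)%E.
  by apply: ge0_nondecreasing_set_cvg_integral => //; first [exact: I_nd | move=> n; apply: measurable_funTS; exact: mq | move=> *; exact: q0].
rewrite -(cvg_lim _ lim)//; apply: lime_le; first by apply/cvg_ex; eexists; exact: lim.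
by apply: nearW => n; rewrite normal_prob_pow_itv lee_fin.
Qed.

Lemma integrable_normal_central k : nu.-integrable setT (fun x : R => ((x - m) ^+ k)%:E).
Proof.
apply: (@le_integrable _ (measurableTypeR R) R nu setT measurableT _ (fun x : R => (1 + (x - m) ^+ (2 * k))%:E)).
- exact: mq.
- move=> x _; rewrite /= lee_fin normrX.
  set y := `|x - m|; have y0 : 0 <= y by exact: normr_ge0.
  have -> : (x - m) ^+ (2 * k) = y ^+ k ^+ 2.
    by rewrite exprM -[(x - m) ^+ 2]real_normK ?num_real// -!exprM mulnC.
  set z := y ^+ k; have z0 : 0 <= z by exact: exprn_ge0.
  rewrite ger0_norm; last first.
    by rewrite addr_ge0// sqr_ge0.
  by nra.
- apply: (@eq_integrable _ (measurableTypeR R) R nu setT measurableT (cst 1%:E \+ (fun x : R => ((x - m) ^+ (2 * k))%:E))%E).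
    by move=> x _; rewrite /= EFinD.
  apply: (@integrableD _ _ _ nu setT measurableT (cst 1%:E) (fun x : measurableTypeR R => ((x - m) ^+ (2 * k))%:E)).
    exact: finite_measure_integrable_cst.
  exact: (integrable_even k).
Qed.

Let J_cvg k : J k n @[n --> \oo] --> \int[nu]_x ((x - m) ^+ k).
Proof.
have Iq := integrable_normal_central k.
pose f n (x : R) : \bar R := (((x - m) ^+ k)%:E * (\1_(I n) x)%:E)%E.
have mf n : measurable_fun setT (f n).
  apply: emeasurable_funM; first exact: mq.
  by apply/measurable_EFinP; exact: measurable_indic.
have fcvg x : f ^~ x @ \oo --> ((x - m) ^+ k)%:E.
  apply: cvg_near_cst; have := I_cover x; apply: filterS => n Inx.
  by rewrite /f indicE mem_set// mule1.
have fle n x : (`|f n x| <= `|((x - m) ^+ k)%:E|)%E.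
  rewrite /f indicE; case: (x \in I n) => /=.
    by rewrite mulr1.
  by rewrite mulr0 normr0 lee_fin.
have a1 : \forall x \ae nu, [set: measurableTypeR R] x -> f ^~ x @ \oo --> ((x - m) ^+ k)%:E.
  by apply: aeW => x _; exact: fcvg.
have a2 : \forall x \ae nu, forall n, [set: measurableTypeR R] x -> (`|f n x| <= `|((x - m) ^+ k)%:E|)%E.
  by apply: aeW => x n _; exact: fle.
have [_ _ H] := @dominated_convergence _ (measurableTypeR R) R nu setT measurableT f _ _ mf (mq k) a1 (integrable_abse Iq) a2.
have eJ n : (\int[nu]_x f n x)%E = (J k n)%:E.
  rewrite -normal_prob_pow_itv [RHS]integral_mkcond; apply: eq_integral => x _.
  rewrite /f patchE indicE; case: (x \in I n) => /=; first by rewrite mule1.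
  by rewrite mule0.
suff : (J k n)%:E @[n --> \oo] --> (\int[nu]_x ((x - m) ^+ k))%:E by move/fine_cvg.
rewrite /Rintegral fineK; last exact: integrable_fin_num.
apply: cvg_trans H; apply: near_eq_cvg; apply: nearW => n /=.
by rewrite eJ.
Qed.

Lemma normal_central_moment_rec k :
  \int[nu]_x ((x - m) ^+ k.+2) = s ^+ 2 * (k.+1%:R * \int[nu]_x ((x - m) ^+ k)).
Proof.
apply: (cvg_unique _ (J_cvg k.+2)) => //.
rewrite (funext (J_rec k)).
apply: cvgM; first exact: cvg_cst.
rewrite -[X in _ --> X]subr0.
apply: cvgB; first by apply: cvgM; [exact: cvg_cst|exact: J_cvg].
under eq_fun => n do rewrite exprNn -{1}[n%:R ^+ k.+1]mul1r -mulrBl -mulrA.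
rewrite -[X in nbhs X](mulr0 (1 - (-1) ^+ k.+1)).
by apply: cvgM; [exact: cvg_cst|exact: bnd_cvg0].
Qed.

Lemma normal_central_moment1 : \int[nu]_x ((x - m) ^+ 1) = 0.
Proof.
apply: (cvg_unique _ (J_cvg 1)) => //.
rewrite (funext J1).
exact: cvg_cst.
Qed.

End NormalMoments.

(** * Moment recursion of a centred Gaussian variable *)

Section GaussianRV.
Context {R : realType} {d : measure_display} {T : measurableType d} (P : probability T R).

(** Stated for any law with the normal recursion, so that the normal law and the Dirac mass are
    treated alike. The zero mean of Y forces m = 0, and the recursion at k = 0 identifies s^2 as its
    second moment. *)
Let law_moments (nu : {measure set (measurableTypeR R) -> \bar R}) (Y : T -> R) (m s : R) :
  measurable_fun [set: T] Y ->
  (forall A : set (measurableTypeR R), measurable A -> P (Y @^-1` A) = nu A) ->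
  \int[P]_w Y w = 0 ->
  (forall k, nu.-integrable setT (fun x : R => ((x - m) ^+ k)%:E)) ->
  \int[nu]_x ((x - m) ^+ 1) = 0 ->
  (forall k, \int[nu]_x ((x - m) ^+ k.+2) = s ^+ 2 * (k.+1%:R * \int[nu]_x ((x - m) ^+ k))) ->
  (forall k, P.-integrable setT (fun w => (Y w ^+ k)%:E)) /\
  (forall k, \int[P]_w (Y w ^+ k.+2) =
     k.+1%:R * \int[P]_w (Y w ^+ 2) * \int[P]_w (Y w ^+ k)).
Proof.
move=> mY law EY0 Inu nu1 nurec.
have mY' : @measurable_fun _ _ T (measurableTypeR R) setT Y by exact: mY.
pose Y' : {RV P >-> measurableTypeR R} := @mfun_Sub _ _ T (measurableTypeR R) Y (mem_set mY').
have mq k : measurable_fun [set: R] (fun x : R => ((x - m) ^+ k)%:E).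
  apply/measurable_EFinP; apply: measurable_funX.
  by apply: measurable_funB.
have mYk k (x : R) : measurable_fun [set: T] (fun w => ((Y w - x) ^+ k)%:E).
  apply/measurable_EFinP; apply: measurable_funX.
  by apply: measurable_funB.
have IYc k : P.-integrable setT (fun w => ((Y w - m) ^+ k)%:E).
  apply/integrableP; split; first exact: mYk.
  have /integrableP[_] := Inu k.
  rewrite -(@eq_measure_integral _ (measurableTypeR R) R setT nu (distribution P Y')); last first.
    by move=> A mA _; exact: law.
  rewrite ge0_integral_distribution//.
  by apply: measurableT_comp => //; exact: mq.
have EYc k : \int[P]_w ((Y w - m) ^+ k) = \int[nu]_x ((x - m) ^+ k).
  rewrite /Rintegral; congr fine.
  rewrite -(@eq_measure_integral _ (measurableTypeR R) R setT nu (distribution P Y')); last first.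
    by move=> A mA _; exact: law.
  rewrite integral_distribution//.
  - exact: mq.
  - exact (IYc k).
have nu0 : \int[nu]_x ((x - m) ^+ 0) = 1.
  rewrite -EYc; under eq_Rintegral do rewrite expr0.
  by rewrite Rintegral_cst//= probability_setT mul1r.
have IY1 : P.-integrable setT (fun w => (Y w)%:E).
  have := IYc 1%N; move=> H.
  apply: (@eq_integrable _ _ _ _ _ measurableT ((fun w => ((Y w - m) ^+ 1)%:E) \+ cst m%:E)%E).
    by move=> w _; rewrite /= expr1 -EFinD subrK.
  apply: integrableD => //.
  exact: finite_measure_integrable_cst.
have m0 : m = 0.
  have := nu1; rewrite -EYc; under eq_Rintegral do rewrite expr1.
  rewrite RintegralB//; last exact: finite_measure_integrable_cst.
  rewrite EY0 Rintegral_cst//= probability_setT mulr1 sub0r.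
  by move/eqP; rewrite oppr_eq0 => /eqP.
have EY k : \int[P]_w (Y w ^+ k) = \int[nu]_x ((x - m) ^+ k).
  rewrite -EYc.
  by apply: eq_Rintegral => w _; rewrite m0 subr0.
split=> k.
  apply: eq_integrable (IYc k) => // w _.
  by rewrite m0 subr0.
rewrite !EY (nurec 0%N) nu0 nurec.
by ring.
Qed.

Lemma gaussian_rv_moments (Y : T -> R) : gaussian_rv P Y -> \int[P]_w Y w = 0 ->
  (forall k, P.-integrable setT (fun w => (Y w ^+ k)%:E)) /\
  (forall k, \int[P]_w (Y w ^+ k.+2) =
     k.+1%:R * \int[P]_w (Y w ^+ 2) * \int[P]_w (Y w ^+ k)).
Proof.
move=> [mY [m [s [s_ge0 law]]]] EY0.
have mq k : measurable_fun [set: R] (fun x : R => ((x - m) ^+ k)%:E).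
  apply/measurable_EFinP; apply: measurable_funX.
  by apply: measurable_funB.
have [s0|s0] := eqVneq s 0; last first.
  apply: (law_moments (normal_prob m s) Y m s) => //.
  - move=> A mA; rewrite law//.
    by rewrite (negPf s0).
  - by move=> k; exact: integrable_normal_central.
  - exact: normal_central_moment1.
  - by move=> k; exact: normal_central_moment_rec.
(* The degenerate case: under the Dirac mass central moments of positive order vanish, and s = 0
   turns the recursion into 0 = 0. *)
have dint (f : R -> R) : measurable_fun [set: R] (fun x : R => (f x)%:E) ->
    (\int[\d_(m : measurableTypeR R)]_x (f x)%:E)%E = (f m)%:E.
  move=> mf; rewrite integral_dirac//.
  by rewrite diracE in_setT mul1e.
apply: (law_moments \d_(m : measurableTypeR R) Y m s) => //.
- move=> A mA; rewrite law//.
  by rewrite s0 eqxx.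
- move=> k; apply/integrableP; split; first exact: mq.
  rewrite integral_dirac//; last first.
    by apply: measurableT_comp => //; exact: mq.
  by rewrite diracE in_setT mul1e /= ltry.
- rewrite /Rintegral dint; last exact: mq.
  by rewrite /= subrr expr1.
- move=> k; rewrite /Rintegral dint; last exact: mq.
  by rewrite /= subrr expr0n/= s0 expr0n/= mul0r.
Qed.

End GaussianRV.

(** * Averaging a coordinate over an interval *)

Section IntervalAverages.
Context {R : realType}.
Local Notation leb := (@lebesgue_measure R).

Lemma integrable_scalel {d0} {T0 : measurableType d0} (mu : {measure set T0 -> \bar R})
    (D : set T0) (k : R) (h : T0 -> R) : measurable D ->
  mu.-integrable D (EFin \o h) -> mu.-integrable D (EFin \o (fun u => k * h u)).
Proof.
move=> mD H; have := integrableZl mD k H.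
by apply: eq_integrable.
Qed.

Lemma measurable_sqrE {d0} {T0 : measurableType d0} (D : set T0) (f : T0 -> R) :
  measurable_fun D f -> measurable_fun D (fun x => (f x ^+ 2)%:E).
Proof.
by move=> mf; apply/measurable_EFinP; exact: measurable_funX.
Qed.

Lemma integrable_addl {d0} {T0 : measurableType d0} (mu : {measure set T0 -> \bar R})
    (D : set T0) (h k : T0 -> R) : measurable D ->
  mu.-integrable D (EFin \o h) -> mu.-integrable D (EFin \o k) ->
  mu.-integrable D (EFin \o (fun u => h u + k u)).
Proof.
move=> mD Ih Ik; have := integrableD mD Ih Ik.
by apply: eq_integrable.
Qed.

Lemma L2_integrable (a b : R) (f : R -> R) : L2 `[a, b] f ->
  leb.-integrable `[a, b] (EFin \o f).
Proof.
move=> [mf If].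
have I1 : leb.-integrable `[a, b] (cst 1%:E \+ (fun u => (f u ^+ 2)%:E))%E.
  apply: integrableD => //.
  apply: measurable_bounded_integrable => //.
  - by apply: compact_finite_measure; exact: segment_compact.
  - by exists 1; split => // y y1 x _; rewrite /= normr1 ltW.
apply: (le_integrable _ _ _ I1) => //.
- by apply/measurable_EFinP.
move=> x _; rewrite /= lee_fin.
rewrite [leRHS]ger0_norm; last by rewrite addr_ge0// sqr_ge0.
by rewrite -[f x ^+ 2]real_normK ?num_real//; have := normr_ge0 (f x); nra.
Qed.

Lemma integrable_indicM (a b c d : R) (f : R -> R) :
  leb.-integrable `[a, b] (EFin \o f) ->
  leb.-integrable `[a, b] (EFin \o (fun u => \1_(`[c, d]%classic : set R) u * f u)).
Proof.
move=> If; apply: (le_integrable _ _ _ If) => //.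
  apply/measurable_EFinP; apply: measurable_funM.
    by apply: measurable_funTS; apply: measurable_indic.
  by apply/measurable_EFinP; exact: (measurable_int leb If).
move=> u _; rewrite /= lee_fin indicE; case: (_ \in _) => /=.
  by rewrite mul1r.
by rewrite mul0r normr0.
Qed.

Lemma Rintegral_indicM (a b c d : R) (f : R -> R) : a <= c -> d <= b ->
  \int[leb]_(u in `[a, b]) (\1_(`[c, d]%classic : set R) u * f u) = \int[leb]_(u in `[c, d]) f u.
Proof.
move=> ac db.
have -> : `[c, d]%classic = `[a, b]%classic `&` `[c, d]%classic :> set R.
  apply/seteqP; split=> u /=; rewrite !in_itv/=; last by case.
  by move=> /andP[cu ud]; split; apply/andP; split => //; lra.
rewrite Rintegral_mkcondr; apply: eq_Rintegral => u uab.
rewrite patchE indicE.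
have -> : (u \in `[a, b]%classic `&` `[c, d]%classic) = (u \in `[c, d]%classic).
  by rewrite in_setI uab.
case: (u \in _) => /=.
  by rewrite mul1r.
by rewrite mul0r.
Qed.

(** The element of H^p whose inner product with a curve is the mean of its j-th coordinate over
    [c, d]. At most one coordinate is nonzero, so it competes in the supremum defining M_1 whenever
    its variance is positive. *)
Definition avg_curve {p : nat} (j : 'I_p) (c d : R) : curve R p R :=
  fun l u => (l == j)%:R * ((d - c)^-1 * \1_(`[c, d]%classic : set R) u).

(** Two averages at once, because polarization mixes different coordinates and intervals. *)
Lemma avg_curve_Hp {p : nat} (a b : R) (j k : 'I_p) (c d c' d' x y : R) :
  Hp `[a, b] (fun l u => x * avg_curve j c d l u + y * avg_curve k c' d' l u).
Proof.
move=> l.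
have mf : measurable_fun [set: R] (fun u => x * avg_curve j c d l u + y * avg_curve k c' d' l u).
  apply: measurable_funD.
    apply: measurable_funM => //; apply: measurable_funM => //.
    by apply: measurable_funM => //; exact: measurable_indic.
  apply: measurable_funM => //; apply: measurable_funM => //.
  by apply: measurable_funM => //; exact: measurable_indic.
split; first exact: measurable_funTS.
apply: measurable_bounded_integrable => //.
- by apply: compact_finite_measure; exact: segment_compact.
- by apply: measurable_funTS; exact: measurable_funX.
pose M := (`|x * (d - c)^-1| + `|y * (d' - c')^-1|) ^+ 2.
exists M; split; first exact: num_real.
move=> r Mr u _; apply: le_trans (ltW Mr).
rewrite /= normrX /M; apply: lerXn2r; rewrite ?nnegrE ?addr_ge0//.
apply: (le_trans (ler_normD _ _)); apply: lerD; rewrite /avg_curve !indicE !normrM.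
  rewrite !mulrA; case: (l == j); case: (_ \in _) => /=; rewrite ?normr1 ?normr0 ?mulr1 ?mulr0 ?mul0r//; exact: mulr_ge0.
rewrite !mulrA; case: (l == k); case: (_ \in _) => /=; rewrite ?normr1 ?normr0 ?mulr1 ?mulr0 ?mul0r//; exact: mulr_ge0.
Qed.

Lemma inner_avg_curve {p : nat} (a b : R) (j k : 'I_p) (c d c' d' x y : R) (f : curve R p R) :
  (forall l, leb.-integrable `[a, b] (EFin \o f l)) ->
  a <= c -> d <= b -> a <= c' -> d' <= b ->
  inner `[a, b] (fun l u => x * avg_curve j c d l u + y * avg_curve k c' d' l u) f =
  x * ((d - c)^-1 * \int[leb]_(u in `[c, d]) f j u) +
  y * ((d' - c')^-1 * \int[leb]_(u in `[c', d']) f k u).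
Proof.
move=> If ac db ac' db'; rewrite /inner.
have H l : \int[leb]_(u in `[a, b]) ((x * avg_curve j c d l u + y * avg_curve k c' d' l u) * f l u) =
   (l == j)%:R * (x * ((d - c)^-1 * \int[leb]_(u in `[c, d]) f l u)) +
   (l == k)%:R * (y * ((d' - c')^-1 * \int[leb]_(u in `[c', d']) f l u)).
  transitivity (\int[leb]_(u in `[a, b]) (((l == j)%:R * (x * (d - c)^-1)) * (\1_(`[c, d]%classic : set R) u * f l u)
     + ((l == k)%:R * (y * (d' - c')^-1)) * (\1_(`[c', d']%classic : set R) u * f l u))).
    apply: eq_Rintegral => u _; rewrite /avg_curve.
    by ring.
  have I1 := integrable_indicM a b c d _ (If l).
  have I2 := integrable_indicM a b c' d' _ (If l).
  rewrite RintegralD//; last 2 first.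
  - by apply: integrable_scalel.
  - by apply: integrable_scalel.
  rewrite !RintegralZl// !Rintegral_indicM//.
  by ring.
rewrite (eq_bigr _ (fun l _ => H l)) big_split/=; congr (_ + _).
  rewrite (bigD1 j)//= eqxx mul1r big1 ?addr0// => l /negPf ->.
  by rewrite mul0r.
rewrite (bigD1 k)//= eqxx mul1r big1 ?addr0// => l /negPf ->.
by rewrite mul0r.
Qed.

End IntervalAverages.

(** * Random variables with all moments finite *)

Section ProbabilityMoments.
Context {R : realType} {d : measure_display} {T : measurableType d} (P : probability T R).

Definition all_moments (f : T -> R) : Prop := measurable_fun setT f /\
  forall k, P.-integrable setT (EFin \o (fun w => f w ^+ k)).

Let mX f k : all_moments f -> measurable_fun setT (EFin \o (fun w => f w ^+ k)).
Proof.
by move=> [mf _]; apply/measurable_EFinP; exact: measurable_funX.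
Qed.

(** Sums are controlled by |f + g|^k <= 2^k (|f|^k + |g|^k), products by |f g|^k <= f^(2k) +
    g^(2k). *)
Lemma moment_algebra_probability :
  moment_algebra all_moments (fun f => \int[P]_w f w).
Proof.
have I1 f : all_moments f -> P.-integrable setT (EFin \o f).
  by move=> [_ /(_ 1%N)]; apply: eq_integrable.
split.
- move=> c; split; first exact: measurable_cst.
  by move=> k; exact: finite_measure_integrable_cst.
- move=> f g Sf Sg; have mfg : measurable_fun setT (fun w => f w + g w).
    by apply: measurable_funD; [exact: Sf.1|exact: Sg.1].
  split=> // k.
  have If := integrable_scalel P setT (2 ^+ k) (fun w => `|f w ^+ k|) measurableT (integrable_abse (Sf.2 k)).
  have Ig := integrable_scalel P setT (2 ^+ k) (fun w => `|g w ^+ k|) measurableT (integrable_abse (Sg.2 k)).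
  apply: (le_integrable _ _ _ (integrableD measurableT If Ig)) => //.
    by apply/measurable_EFinP; exact: measurable_funX.
  move=> w _; rewrite /= lee_fin.
  rewrite [leRHS]ger0_norm; last by rewrite addr_ge0// mulr_ge0// exprn_ge0.
  rewrite normrX -mulrDr !normrX.
  wlog fg : f g Sf Sg mfg If Ig / `|f w| <= `|g w|.
    move=> H; have [fg|gf] := leP `|f w| `|g w|; first exact: H.
    rewrite addrC [X in _ * X]addrC; apply: H => //; last exact: ltW.
    by apply: measurable_funD; [exact: Sg.1|exact: Sf.1].
  apply: (@le_trans _ _ ((2 * `|g w|) ^+ k)).
    apply: lerXn2r; rewrite ?nnegrE ?mulr_ge0//.
    by apply: (le_trans (ler_normD _ _)); rewrite mulr2n mulrDl mul1r lerD2r.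
  rewrite exprMn ler_wpM2l ?exprn_ge0// lerDr.
  by rewrite exprn_ge0.
- move=> f g Sf Sg; have mfg : measurable_fun setT (fun w => f w * g w).
    by apply: measurable_funM; [exact: Sf.1|exact: Sg.1].
  split=> // k.
  apply: (le_integrable _ _ _ (integrableD measurableT (Sf.2 (k * 2)%N) (Sg.2 (k * 2)%N))) => //.
    by apply/measurable_EFinP; exact: measurable_funX.
  move=> w _; rewrite /= lee_fin exprMn !exprM normrM.
  set y := f w ^+ k; set z := g w ^+ k.
  rewrite [leRHS]ger0_norm; last by rewrite addr_ge0// sqr_ge0.
  rewrite -[y ^+ 2]real_normK ?num_real// -[z ^+ 2]real_normK ?num_real//.
  by have := normr_ge0 y; have := normr_ge0 z; have := sqr_ge0 (`|y| - `|z|); nra.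
- by move=> f g Sf Sg; rewrite RintegralD//; exact: I1.
- by move=> c f Sf; rewrite RintegralZl//; exact: I1.
- by move=> f g Sf Sg fg; apply: le_Rintegral => //; exact: I1.
- move=> c; rewrite Rintegral_cst//=.
  by rewrite probability_setT mulr1.
Qed.

End ProbabilityMoments.

(** * Passing moment bounds to limits *)

Section Tails.
Context {R : realType} {d : measure_display} {T : measurableType d} (P : probability T R).

(** The Lipschitz property of x^m on [0, A], with y allowed to be unbounded: for y >= x the claim is
    monotonicity, and otherwise y <= A as well. *)
Lemma truncated_power_bound m (A : R) : 0 <= A -> exists M, 0 <= M /\
  forall x y g, 0 <= x <= A -> 0 <= y -> 0 <= g -> x <= y + g -> x ^+ m <= y ^+ m + M * g.
Proof.
move=> A0; elim: m => [|m [M [M0 IH]]].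
  by exists 0; split=> // x y g _ _ _ _; rewrite !expr0 mul0r addr0.
exists (A * M + A ^+ m); split; first by rewrite addr_ge0 ?mulr_ge0// exprn_ge0.
move=> x y g /andP[x0 xA] y0 g0 xyg.
have Mg : 0 <= (A * M + A ^+ m) * g by rewrite mulr_ge0// addr_ge0 ?mulr_ge0// exprn_ge0.
have [xy|yx] := leP x y.
  by apply: (@le_trans _ _ (y ^+ m.+1)); [apply: lerXn2r|rewrite lerDl].
have xxA : 0 <= x <= A by rewrite x0.
have h1 := IH x y g xxA y0 g0 xyg.
have h2 : y ^+ m <= A ^+ m by apply: lerXn2r; rewrite ?nnegrE//; lra.
have ym : 0 <= y ^+ m by exact: exprn_ge0.
rewrite !exprS.
have h3 : x * x ^+ m <= x * (y ^+ m + M * g) by exact: ler_wpM2l.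
have h4 : x * (M * g) <= A * (M * g) by apply: ler_wpM2r => //; exact: mulr_ge0.
have h5 : (x - y) * y ^+ m <= g * A ^+ m.
  by apply: ler_pM => //; [rewrite subr_ge0 ltW|lra].
by lra.
Qed.

(** A variant of Fatou's lemma for approximation in L^1. The power 2q of |D| truncated at A exceeds
    that of De by at most M G, where M depends on A and q only; tau tends to 0 first, and then A to
    infinity by monotone convergence. *)
Lemma moment_limit (D : T -> R) q (C : R) : measurable_fun setT D ->
  (forall tau, 0 < tau -> exists De G, [/\ all_moments P De, P.-integrable setT (EFin \o G),
    (forall w, `|D w - De w| <= G w), \int[P]_w G w <= tau &
    \int[P]_w (De w ^+ (2 * q)) <= C]) ->
  (\int[P]_w (D w ^+ (2 * q))%:E <= C%:E)%E.
Proof.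
move=> mD H.
pose f (A : nat) w : \bar R := ((Num.min `|D w| A%:R) ^+ (2 * q))%:E.
have mf A : measurable_fun setT (f A).
  apply/measurable_EFinP; apply: measurable_funX; apply: measurable_minr; last exact: measurable_cst.
  exact: measurableT_comp.
have f0 A w : setT w -> (0 <= f A w)%E.
  by move=> _; rewrite lee_fin exprn_ge0// le_min normr_ge0 ler0n.
have fnd w : setT w -> {homo f^~ w : n m / (n <= m)%N >-> (n <= m)%E}.
  move=> _ n m nm; rewrite lee_fin; apply: lerXn2r; rewrite ?nnegrE ?le_min ?normr_ge0 ?ler0n//.
  by rewrite ge_min lexx/= ge_min ler_nat nm orbT.
have fl w : limn (f^~ w) = ((D w ^+ (2 * q))%:E).
  apply: cvg_lim => //; apply: cvg_near_cst.
  exists (Num.trunc `|D w|).+1 => // n /= Dn.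
  rewrite /f; congr EFin; rewrite min_l.
    by rewrite !exprM real_normK ?num_real.
  by apply: ltW; apply: (lt_le_trans (truncnS_gt _)); rewrite ler_nat.
have fC A : (\int[P]_w f A w <= C%:E)%E.
  have [M [M0 HM]] := truncated_power_bound (2 * q) A%:R (ler0n _ _).
  apply/lee_addgt0Pr => eps eps0.
  have M1 : 0 < M + 1 by lra.
  have [De [G [SDe IG DG Gt EC]]] := H (eps / (M + 1)) (divr_gt0 eps0 M1).
  have IDe : P.-integrable setT (EFin \o (fun w => De w ^+ (2 * q))) by exact: (SDe.2 _).
  have G0 w : 0 <= G w by apply: le_trans (DG w); exact: normr_ge0.
  have IMG := integrable_scalel P setT M _ measurableT IG.
  have IS := integrable_addl P setT _ _ measurableT IDe IMG.
  apply: (@le_trans _ _ (\int[P]_w (De w ^+ (2 * q) + M * G w)%:E)%E).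
    apply: ge0_le_integral => //.
    - by move=> w _; exact: f0.
    - exact: (measurable_int P IS).
    - move=> w _; rewrite lee_fin.
      have -> : De w ^+ (2 * q) = `|De w| ^+ (2 * q) by rewrite !exprM real_normK ?num_real.
      apply: HM => //; first by rewrite le_min normr_ge0 ler0n/= ge_min lexx orbT.
      rewrite ge_min; apply/orP; left.
      have := DG w; have := ler_normD (De w) (D w - De w); rewrite subrKC.
      by lra.
  have -> : (\int[P]_w (De w ^+ (2 * q) + M * G w)%:E)%E = (\int[P]_w (De w ^+ (2 * q) + M * G w))%:E.
    by rewrite /Rintegral fineK//; exact: (integrable_fin_num measurableT IS).
  rewrite -EFinD lee_fin (RintegralD measurableT IDe IMG) (RintegralZl _ measurableT IG).
  apply: lerD => //; apply: (@le_trans _ _ (M * (eps / (M + 1)))); first exact: ler_wpM2l.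
  rewrite mulrCA; apply: ler_piMr; first exact: ltW.
  by rewrite ler_pdivrMr// mul1r; lra.
have cv := cvg_monotone_convergence measurableT mf f0 fnd.
rewrite [X in (X <= _)%E](_ : _ = limn (fun n => \int[P]_w f n w))%E.
  by apply: lime_le; [apply/cvg_ex; eexists; exact: cv|apply: nearW].
rewrite -(monotone_convergence P measurableT mf f0 fnd).
by apply: eq_integral => w _; rewrite fl.
Qed.

End Tails.

(** * Averaged curves as stationary Gaussian sequences *)

Section RandomCurveMoments.
Context {R : realType} {d : measure_display} {T : measurableType d}.
Variables (P : probability T R) (a b : R) (p : nat) (X : int -> 'I_p -> R -> T -> R).
Local Notation leb := (@lebesgue_measure R).
Local Notation U := (`[a, b]%classic : set R).
Hypothesis rc : random_curves U X.
Hypothesis mz : mean_zero P U X.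
Hypothesis cs : cov_stationary P U X.

Lemma curve_value_Lfun1 t j u : U u -> X t j u \in Lfun P 1.
Proof.
move=> Uu; apply: Lfun_subset12; last exact: cs.1.
exact: fin_num_measure.
Qed.

Lemma curve_value_measurable t j u : U u -> measurable_fun setT (X t j u).
Proof.
move=> Uu; have /Lfun1_integrable H := curve_value_Lfun1 t j u Uu.
by apply/measurable_EFinP; exact: (measurable_int P H).
Qed.

Lemma curve_value_sqr_integrable t j u : U u ->
  P.-integrable setT (EFin \o (fun w => X t j u w ^+ 2)).
Proof.
move=> Uu; apply: Lfun2_integrable_sqr; exact: cs.1.
Qed.

Lemma curve_valueM_integrable t j u t' k v : U u -> U v ->
  P.-integrable setT (EFin \o (fun w => X t j u w * X t' k v w)).
Proof.
move=> Uu Uv; apply/Lfun1_integrable.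
by apply: Lfun2_mul_Lfun1; exact: cs.1.
Qed.

Lemma covariance_curve_value t j u t' k v : U u -> U v ->
  covariance P (X t j u) (X t' k v) = (\int[P]_w (X t j u w * X t' k v w))%:E.
Proof.
move=> Uu Uv; rewrite covarianceE; last 3 first.
- exact: curve_value_Lfun1.
- exact: curve_value_Lfun1.
- by apply/Lfun1_integrable; exact: curve_valueM_integrable.
rewrite !mz// mule0 sube0 unlock /Rintegral fineK//.
by apply: integrable_fin_num => //; exact: curve_valueM_integrable.
Qed.

Lemma autocovE t h j k u v : U u -> U v ->
  \int[P]_w (X t j u w * X (t + h) k v w) = autocov P X h j k u v.
Proof.
move=> Uu Uv; rewrite /autocov.
rewrite -(cs.2 t h j k u v Uu Uv).
by rewrite covariance_curve_value.
Qed.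

Hypothesis ab : a < b.
Variable C0 : R.
Hypothesis C0P : forall (j : 'I_p) u v, U u -> U v -> `|autocov P X 0 j j u v| <= C0.

Lemma curve_value_var_le t j u : U u -> \int[P]_w (X t j u w ^+ 2) <= C0.
Proof.
move=> Uu; have := C0P j u u Uu Uu; rewrite -(autocovE t)// addr0.
by move=> /(le_trans (ler_norm _)); under eq_Rintegral do rewrite -expr2.
Qed.

Lemma curve_path_integrable t j w c e : a <= c -> e <= b ->
  leb.-integrable `[c, e] (EFin \o (fun u => X t j u w)).
Proof.
move=> ac eb; apply: (@integrableS _ _ _ leb `[a, b]%classic); [exact: measurable_itv|exact: measurable_itv| |].
  by move=> u /=; rewrite !in_itv/= => /andP[? ?]; apply/andP; split; lra.
by apply: L2_integrable; exact: rc.2.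
Qed.

Section Fubini.
Variables (t : int) (j : 'I_p) (c e : R) (Z : T -> R).
Hypothesis ac : a <= c.
Hypothesis eb : e <= b.
Hypothesis mZ : measurable_fun setT Z.
Hypothesis IZ : P.-integrable setT (EFin \o (fun w => Z w ^+ 2)).

Let D : set (T * measurableTypeR R) := setT `*` `[c, e]%classic.
Let g (z : T * measurableTypeR R) : R := X t j z.2 z.1.
Let f (z : T * measurableTypeR R) : \bar R := ((g \_ D) z * Z z.1)%:E.

Let subU u : `[c, e]%classic u -> U u.
Proof.
move=> uI; have {}uI : u \in `[c, e] by exact: uI.
suff : u \in `[a, b] by exact.
move: uI; rewrite !in_itv/= => /andP[cu ue].
by apply/andP; split; [exact: le_trans cu|exact: le_trans eb].
Qed.

Let mf : measurable_fun setT f.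
Proof.
apply/measurable_EFinP; apply: measurable_funM; last exact: measurableT_comp.
apply/(measurable_restrictT _ _).1.
  by apply: measurableX.
apply: measurable_funS (rc.1 t j).
  by apply: measurableX.
by move=> z [_ /= /subU zU]; split.
Qed.

Let fE w u : f (w, u) = ((\1_(`[c, e]%classic : set R) u) * (X t j u w * Z w))%:E.
Proof.
rewrite /f /g patchE indicE /D.
have -> : ((w, u) \in [set: T] `*` `[c, e]%classic) = (u \in (`[c, e]%classic : set R)).
  by rewrite in_setX in_setT.
case: (u \in _) => /=.
  by rewrite mul1r.
by rewrite !mul0r.
Qed.

Let XZ_integrable u : U u -> P.-integrable setT (EFin \o (fun w => X t j u w * Z w)).
Proof.
move=> Uu; have I1 := integrableD measurableT (curve_value_sqr_integrable t j u Uu) IZ.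
apply: (le_integrable _ _ _ I1) => //.
  apply/measurable_EFinP; apply: measurable_funM => //.
  exact: curve_value_measurable.
move=> w _; rewrite /= lee_fin [leRHS]ger0_norm; last by rewrite addr_ge0// sqr_ge0.
rewrite normrM -[X t j u w ^+ 2]real_normK ?num_real// -[Z w ^+ 2]real_normK ?num_real//.
have := sqr_ge0 (`|X t j u w| - `|Z w|).
by have := normr_ge0 (X t j u w); have := normr_ge0 (Z w); nra.
Qed.

Let M := C0 + \int[P]_w (Z w ^+ 2).

Let XZ_abs_le u : U u -> (\int[P]_w `|X t j u w * Z w|%:E <= M%:E)%E.
Proof.
move=> Uu; have IXZ := XZ_integrable u Uu.
apply: (@le_trans _ _ (\int[P]_w ((X t j u w ^+ 2)%:E + (Z w ^+ 2)%:E))%E).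
  apply: ge0_le_integral => //.
  - apply/measurable_EFinP; apply: measurableT_comp => //.
    by apply/measurable_EFinP; exact: (measurable_int P IXZ).
  - apply: (@emeasurable_funD _ _ _ _ (fun w => (X t j u w ^+ 2)%:E) (fun w => (Z w ^+ 2)%:E)).
      exact: (measurable_int P (curve_value_sqr_integrable t j u Uu)).
    exact: (measurable_int P IZ).
  - move=> w _; rewrite -EFinD lee_fin normrM -[X t j u w ^+ 2]real_normK ?num_real// -[Z w ^+ 2]real_normK ?num_real//.
    by have := sqr_ge0 (`|X t j u w| - `|Z w|); have := normr_ge0 (X t j u w); have := normr_ge0 (Z w); nra.
rewrite integralD//; last exact: curve_value_sqr_integrable.
rewrite /M EFinD; apply: leeD.
  have := curve_value_var_le t j u Uu; rewrite -lee_fin /Rintegral fineK//.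
  by apply: integrable_fin_num => //; exact: curve_value_sqr_integrable.
rewrite /Rintegral fineK//.
exact: integrable_fin_num.
Qed.

(** The variance of X_t(u) is at most C0 for every u, so E |X_t(u) Z| <= C0 + E Z^2 uniformly on the
    bounded interval. *)
Let f_integrable : (P \x leb)%E.-integrable setT f.
Proof.
apply/integrable21ltyP; first exact: mf.
apply: (@le_lt_trans _ _ (\int[leb]_(u in `[c, e]) M%:E)%E); last first.
  rewrite integral_cst//= lebesgue_measure_itv/=; case: ifP => _; last by rewrite mule0 ltry.
  by rewrite -EFinB -EFinM ltry.
rewrite [leRHS]integral_mkcond; apply: ge0_le_integral => //.
- by move=> u _; exact: integral_ge0.
- apply: (measurable_fun_fubini_tonelli_G (abse \o f)); last by move=> z; exact: abse_ge0.
  by apply: measurableT_comp => //; exact: mf.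
- by apply/(measurable_restrictT _ _).1.
move=> u _; rewrite patchE; case: ifPn => [uI|unI]; last first.
  rewrite integral0_eq// => w _; rewrite fE indicE (negPf unI).
  by rewrite mul0r abse0.
have Uu : U u by apply: subU; exact: set_mem.
under eq_integral => w _ do rewrite fE indicE uI mul1r.
exact: XZ_abs_le.
Qed.

Lemma fubini_average_integrable :
  leb.-integrable `[c, e] (EFin \o (fun u => \int[P]_w (X t j u w * Z w))).
Proof.
have mG := measurable_fubini_G f_integrable.
have eG u : U u -> \int[P]_w (X t j u w * Z w) = fine (\int[P]_w (X t j u w * Z w)%:E).
  by [].
apply: measurable_bounded_integrable => //.
- by apply: compact_finite_measure; exact: segment_compact.
- apply: (@eq_measurable_fun _ _ _ _ _ (fine \o fubini_G P f)).
    move=> u uI; rewrite /= /fubini_G /Rintegral; congr fine; apply: eq_integral => w _.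
    by rewrite fE indicE uI mul1r.
  apply: measurable_funTS; apply: measurableT_comp => //.
- exists M; split; first exact: num_real.
  move=> y yM u /= uI; apply: le_trans (ltW yM).
  have Uu := subU u uI; have IXZ := XZ_integrable u Uu.
  rewrite -lee_fin; apply: le_trans (XZ_abs_le u Uu).
  rewrite EFin_normr_Rintegral//; apply: le_abse_integral => //.
  exact: (measurable_int P IXZ).
Qed.

Lemma fubini_average :
  P.-integrable setT (EFin \o (fun w => (\int[leb]_(u in `[c, e]) X t j u w) * Z w)) /\
  \int[P]_w ((\int[leb]_(u in `[c, e]) X t j u w) * Z w) =
  \int[leb]_(u in `[c, e]) (\int[P]_w (X t j u w * Z w)).
Proof.
have eF w : (\int[leb]_u f (w, u))%E = ((\int[leb]_(u in `[c, e]) X t j u w) * Z w)%:E.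
  rewrite -RintegralZr//; last exact: curve_path_integrable.
  rewrite /Rintegral fineK; last first.
    apply: integrable_fin_num => //.
    apply: (@eq_integrable _ _ _ leb `[c, e]%classic _ (EFin \o (fun u => Z w * X t j u w))) => //.
      by move=> u _; rewrite /= mulrC.
    by apply: integrable_scalel => //; exact: curve_path_integrable.
  rewrite [RHS]integral_mkcond; apply: eq_integral => u _.
  rewrite fE patchE indicE; case: (u \in _) => /=.
    by rewrite mul1r.
  by rewrite mul0r.
have eG u : `[c, e]%classic u -> (\int[P]_w f (w, u))%E = (\int[P]_w (X t j u w * Z w))%:E.
  move=> uI; rewrite (eq_integral (fun w => (X t j u w * Z w)%:E)); last first.
    by move=> w _; rewrite fE indicE mem_set// mul1r.
  rewrite /Rintegral fineK//; apply: integrable_fin_num => //; apply: XZ_integrable.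
  exact: subU.
split.
  apply: (@eq_integrable _ _ _ P setT _ (fubini_F leb f)) => //.
    by move=> w _; rewrite /fubini_F eF.
  exact: (integrable_fubini_F f_integrable).
have FF := Fubini f_integrable.
rewrite /Rintegral; congr fine.
transitivity (\int[P]_w \int[leb]_u f (w, u))%E.
  by apply: eq_integral => w _; rewrite eF.
rewrite FF [RHS]integral_mkcond; apply: eq_integral => u _.
rewrite patchE; case: ifPn => [uI|unI].
  by rewrite eG//; exact: set_mem.
rewrite integral0_eq// => w _; rewrite fE indicE (negPf unI).
by rewrite mul0r.
Qed.

End Fubini.

Definition path_avg (t : int) (j : 'I_p) (c e : R) (w : T) : R :=
  (e - c)^-1 * \int[leb]_(u in `[c, e]) X t j u w.

Lemma path_avg_mean t j c e : a <= c -> e <= b -> \int[P]_w path_avg t j c e w = 0.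
Proof.
move=> ac eb.
have I1 : P.-integrable setT (EFin \o (fun w : T => (1 : R) ^+ 2)).
  exact: finite_measure_integrable_cst.
have [I2 E2] := fubini_average t j c e (fun=> 1) ac eb (measurable_cst _) I1.
have e1 w : path_avg t j c e w = (e - c)^-1 * ((\int[leb]_(u in `[c, e]) X t j u w) * 1).
  by rewrite mulr1.
under eq_Rintegral do rewrite e1.
rewrite RintegralZl// E2.
transitivity ((e - c)^-1 * \int[leb]_(u in `[c, e]) (0 : R)); last first.
  by rewrite Rintegral_cst// mul0r mulr0.
congr (_ * _); apply: eq_Rintegral => u.
rewrite inE /= in_itv/= => /andP[cu ue].
have Uu : U u by rewrite /= in_itv/=; apply/andP; split; lra.
under eq_Rintegral do rewrite mulr1.
have := mz t j u Uu; rewrite unlock /Rintegral => ->.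
by [].
Qed.

Lemma path_avg_integrable t j c e : a <= c -> e <= b ->
  P.-integrable setT (EFin \o path_avg t j c e).
Proof.
move=> ac eb.
have I1 : P.-integrable setT (EFin \o (fun w : T => (1 : R) ^+ 2)).
  exact: finite_measure_integrable_cst.
have [I2 _] := fubini_average t j c e (fun=> 1) ac eb (measurable_cst _) I1.
apply: (@eq_integrable _ _ _ P setT _ (EFin \o (fun w => (e - c)^-1 * ((\int[leb]_(u in `[c, e]) X t j u w) * 1)))) => //.
  by move=> w _; rewrite /= mulr1.
exact: integrable_scalel.
Qed.

Lemma path_avgM t j c e (Z : T -> R) : a <= c -> e <= b -> measurable_fun setT Z ->
  P.-integrable setT (EFin \o (fun w => Z w ^+ 2)) ->
  \int[P]_w (path_avg t j c e w * Z w) =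
  (e - c)^-1 * \int[leb]_(u in `[c, e]) (\int[P]_w (X t j u w * Z w)).
Proof.
move=> ac eb mZ IZ; have [I2 E2] := fubini_average t j c e Z ac eb mZ IZ.
rewrite -E2 -RintegralZl//.
by apply: eq_Rintegral => w _; rewrite /path_avg mulrA.
Qed.

Hypothesis jg : jointly_gaussian P U X.

Definition avg_comb (j k : 'I_p) (c e c' e' x y : R) (t : int) (w : T) : R :=
  x * path_avg t j c e w + y * path_avg t k c' e' w.

Section Combinations.
Variables (j k : 'I_p) (c e c' e' x y : R).
Hypotheses (ac : a <= c) (eb : e <= b) (ac' : a <= c') (eb' : e' <= b).
Local Notation Y := (avg_comb j k c e c' e' x y).

Let Y_integrable t : P.-integrable setT (EFin \o Y t).
Proof.
have I1 := integrable_scalel P setT x _ measurableT (path_avg_integrable t j c e ac eb).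
have I2 := integrable_scalel P setT y _ measurableT (path_avg_integrable t k c' e' ac' eb').
by have := integrableD measurableT I1 I2; apply: eq_integrable.
Qed.

Let Y_mean t : \int[P]_w Y t w = 0.
Proof.
have I1 := integrable_scalel P setT x _ measurableT (path_avg_integrable t j c e ac eb).
have I2 := integrable_scalel P setT y _ measurableT (path_avg_integrable t k c' e' ac' eb').
have e1 := RintegralZl x measurableT (path_avg_integrable t j c e ac eb).
have e2 := RintegralZl y measurableT (path_avg_integrable t k c' e' ac' eb').
rewrite /avg_comb RintegralD// e1 e2 !path_avg_mean//.
by rewrite !mulr0 addr0.
Qed.

(** Each such combination is a sum of inner products of the X_t with fixed curves in H^p, so it is
    Gaussian by hypothesis, and its zero mean gives the moment recursion. *)
Lemma avg_comb_moments n (tt : 'I_n -> int) (cc : 'I_n -> R) :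
  let L := fun w => \sum_(i < n) cc i * Y (tt i) w in
  [/\ measurable_fun setT L, \int[P]_w L w = 0,
    (forall m, P.-integrable setT (fun w => (L w ^+ m)%:E)) &
    (forall m, \int[P]_w (L w ^+ m.+2) =
      m.+1%:R * \int[P]_w (L w ^+ 2) * \int[P]_w (L w ^+ m))].
Proof.
move=> L.
have LE w : L w = \sum_(i < n) inner U (fun l u => (cc i * x) * avg_curve j c e l u + (cc i * y) * avg_curve k c' e' l u)
   (sample_curve X (tt i) w).
  apply: eq_bigr => i _; rewrite inner_avg_curve//; last first.
    by move=> l; apply: curve_path_integrable.
  rewrite /avg_comb /path_avg /sample_curve.
  by ring.
have gL : gaussian_rv P L.
  rewrite (_ : L = fun w => \sum_(i < n) inner U (fun l u => (cc i * x) * avg_curve j c e l u + (cc i * y) * avg_curve k c' e' l u)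
   (sample_curve X (tt i) w)); last by apply/funext => w; rewrite LE.
  apply: (jg n tt (fun i l u => (cc i * x) * avg_curve j c e l u + (cc i * y) * avg_curve k c' e' l u)) => i.
  exact: avg_curve_Hp.
have EL : \int[P]_w L w = 0.
  have H : forall (r : seq 'I_n), P.-integrable setT (EFin \o (fun w => \sum_(i <- r) cc i * Y (tt i) w)) /\
     \int[P]_w (\sum_(i <- r) cc i * Y (tt i) w) = 0.
    elim=> [|i r [IH1 IH2]].
      split.
        apply: (@eq_integrable _ _ _ P setT _ (cst 0%:E)) => //.
          by move=> w _; rewrite /= big_nil.
        exact: finite_measure_integrable_cst.
      under eq_Rintegral do rewrite big_nil.
      by rewrite Rintegral_cst// mul0r.
    have I1 := integrable_scalel P setT (cc i) _ measurableT (Y_integrable (tt i)).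
    split.
      have := integrableD measurableT I1 IH1; apply: eq_integrable => // w _.
      by rewrite /= big_cons EFinD.
    under eq_Rintegral do rewrite big_cons.
    rewrite RintegralD// IH2 RintegralZl// Y_mean.
    by rewrite mulr0 addr0.
  by have [_ ] := H (index_enum 'I_n).
have [H1 H2] := gaussian_rv_moments P L gL EL.
by split=> //; case: gL.
Qed.

End Combinations.

Lemma path_avg_comb t j c e w : avg_comb j j c e c e 1 0 t w = path_avg t j c e w.
Proof.
by rewrite /avg_comb mul1r mul0r addr0.
Qed.

Section Covariances.
Variables (j : 'I_p) (c e : R).
Hypotheses (ac : a <= c) (eb : e <= b).

Lemma path_avg_measurable t : measurable_fun setT (path_avg t j c e).
Proof.
by apply/measurable_EFinP; exact: (measurable_int P (path_avg_integrable t j c e ac eb)).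
Qed.

Lemma path_avg_sqr_integrable t : P.-integrable setT (EFin \o (fun w => path_avg t j c e w ^+ 2)).
Proof.
have [_ _ /(_ 2%N) H _] := avg_comb_moments j j c e c e 1 0 ac eb ac eb 1 (fun=> t) (fun=> 1).
apply: eq_integrable H => // w _.
by rewrite /= big_ord1 mul1r path_avg_comb.
Qed.

(** Read in two ways: as the lag-h autocovariance of the sequence of averages ([path_avg_cov]), and
    as <Phi, Xi_h(Phi)> for the averaging curve Phi ([inner_autocov_op_avg]). This is the bridge
    between the sample and the spectral density. *)
Definition avg_autocov (h : int) : R :=
  (e - c)^-1 * \int[leb]_(u in `[c, e]) ((e - c)^-1 * \int[leb]_(v in `[c, e]) autocov P X h j j u v).

Let itvU u : u \in (`[c, e]%classic : set R) -> U u.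
Proof.
rewrite inE /= in_itv/= => /andP[cu ue].
by rewrite /= in_itv/= (le_trans ac cu) (le_trans ue eb).
Qed.

Lemma path_avg_value_cov t h u : U u ->
  \int[P]_w (X t j u w * path_avg (t + h) j c e w) =
  (e - c)^-1 * \int[leb]_(v in `[c, e]) autocov P X h j j u v.
Proof.
move=> Uu; under eq_Rintegral do rewrite mulrC.
rewrite path_avgM//; last 2 first.
- exact: curve_value_measurable.
- exact: curve_value_sqr_integrable.
congr (_ * _); apply: eq_Rintegral => v.
rewrite inE /= in_itv/= => /andP[cv ve].
have Uv : U v by rewrite /= in_itv/= (le_trans ac cv) (le_trans ve eb).
under eq_Rintegral do rewrite mulrC.
exact: autocovE.
Qed.

Lemma path_avg_cov t h :
  \int[P]_w (path_avg t j c e w * path_avg (t + h) j c e w) = avg_autocov h.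
Proof.
rewrite path_avgM//; last 2 first.
- exact: path_avg_measurable.
- exact: path_avg_sqr_integrable.
congr (_ * _); apply: eq_Rintegral => u uI.
by rewrite path_avg_value_cov//; exact: itvU.
Qed.

Lemma inner_autocov_op_avg h :
  inner U (avg_curve j c e) (autocov_op P U X h (avg_curve j c e)) = avg_autocov h.
Proof.
have opE u : U u -> autocov_op P U X h (avg_curve j c e) j u =
    (e - c)^-1 * \int[leb]_(v in `[c, e]) autocov P X h j j u v.
  move=> Uu; rewrite /autocov_op (bigD1 j)//= [X in _ + X]big1 ?addr0; last first.
    move=> k /negPf kj; transitivity (\int[leb]_(v in U) (0 : R)).
      by apply: eq_Rintegral => v _; rewrite /avg_curve kj mul0r mulr0.
    by rewrite Rintegral_cst// mul0r.
  have Iv : leb.-integrable `[c, e] (EFin \o (fun v => autocov P X h j j u v)).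
    have H := fubini_average_integrable (0 + h) j c e (X 0 j u) ac eb (curve_value_measurable 0 j u Uu)
      (curve_value_sqr_integrable 0 j u Uu).
    apply: eq_integrable H => // v vI; rewrite /=.
    under eq_Rintegral do rewrite mulrC.
    rewrite autocovE//.
    move: vI; rewrite inE /= in_itv/= => /andP[cv ve].
    by rewrite /= in_itv/= (le_trans ac cv) (le_trans ve eb).
  rewrite -RintegralZl// -(Rintegral_indicM a b c e)//.
  apply: eq_Rintegral => v _; rewrite /avg_curve eqxx mul1r.
  by ring.
rewrite /inner (bigD1 j)//= [X in _ + X]big1 ?addr0; last first.
  move=> k /negPf kj; transitivity (\int[leb]_(v in U) (0 : R)).
    by apply: eq_Rintegral => v _; rewrite /avg_curve kj !mul0r.
  by rewrite Rintegral_cst// mul0r.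
have Iu : leb.-integrable `[c, e] (EFin \o (fun u => (e - c)^-1 * \int[leb]_(v in `[c, e]) autocov P X h j j u v)).
  have H := fubini_average_integrable 0 j c e (path_avg (0 + h) j c e) ac eb (path_avg_measurable _) (path_avg_sqr_integrable _).
  apply: eq_integrable H => // u uI; rewrite /= path_avg_value_cov//.
  exact: itvU.
rewrite /avg_autocov -RintegralZl// -(Rintegral_indicM a b c e)//.
apply: eq_Rintegral => u uI; rewrite opE; last exact: set_mem.
rewrite /avg_curve eqxx mul1r.
by ring.
Qed.

Lemma avg_autocovN h : avg_autocov (- h) = avg_autocov h.
Proof.
rewrite -(path_avg_cov h (- h)) subrr -(path_avg_cov 0 h) add0r.
by apply: eq_Rintegral => w _; rewrite mulrC.
Qed.

Lemma path_avg_covn (s t : nat) :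
  \int[P]_w (path_avg s%:Z j c e w * path_avg t%:Z j c e w) = avg_autocov (natdist s t)%:Z.
Proof.
have := path_avg_cov s%:Z (t%:Z - s%:Z); rewrite subrKC => ->.
rewrite /natdist; case: (leqP s t) => st.
  have -> : (s - t = 0)%N by lia.
  by rewrite add0n -subzn.
have -> : (t - s = 0)%N by lia.
rewrite addn0 -[RHS]avg_autocovN; congr avg_autocov.
by rewrite -subzn ?opprB// ltnW.
Qed.

End Covariances.

Let SE := moment_algebra_probability P.
Let SM := mom_mul _ _ SE.
Let Sc := mom_cst _ _ SE.

Lemma avg_comb_all_moments j k c e c' e' x y t : a <= c -> e <= b -> a <= c' -> e' <= b ->
  all_moments P (avg_comb j k c e c' e' x y t).
Proof.
move=> ac eb ac' eb'.
have [mL _ IL _] := avg_comb_moments j k c e c' e' x y ac eb ac' eb' 1 (fun=> t) (fun=> 1).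
have LE : (fun w => \sum_(i < 1) 1 * avg_comb j k c e c' e' x y t w) = avg_comb j k c e c' e' x y t.
  by apply/funext => w; rewrite big_ord1 mul1r.
split; first by move: mL; rewrite LE.
move=> m; have := IL m; apply: eq_integrable => // w _.
by rewrite /= big_ord1 mul1r.
Qed.

Lemma path_avg_all_moments j c e t : a <= c -> e <= b -> all_moments P (path_avg t j c e).
Proof.
move=> ac eb; have := avg_comb_all_moments j j c e c e 1 0 t ac eb ac eb.
congr all_moments; apply/funext => w.
exact: path_avg_comb.
Qed.

Lemma path_avg_gram j c e n (cc : nat -> R) : a <= c -> e <= b ->
  \int[P]_w ((\sum_(s < n) cc s * path_avg (s.+1)%:Z j c e w) ^+ 2) =
  \sum_(s < n) \sum_(t < n) cc s * cc t * avg_autocov j c e (natdist s t)%:Z.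
Proof.
move=> ac eb; have SY t := path_avg_all_moments j c e t ac eb.
transitivity (\int[P]_w \sum_(s < n) \sum_(t < n)
   cc s * cc t * (path_avg (s.+1)%:Z j c e w * path_avg (t.+1)%:Z j c e w)).
  apply: eq_Rintegral => w _; rewrite expr2 mulr_suml; apply: eq_bigr => s _.
  rewrite mulr_sumr; apply: eq_bigr => t _.
  by ring.
have Sst (s t : nat) : all_moments P (fun w => cc s * cc t * (path_avg (s.+1)%:Z j c e w * path_avg (t.+1)%:Z j c e w)).
  apply: SM; first exact: Sc.
  by apply: SM; exact: SY.
rewrite (exp_sum_ord _ _ SE) => [|s]; last by apply: (mom_sum _ _ SE) => t; exact: Sst.
apply: eq_bigr => s _; rewrite (exp_sum_ord _ _ SE) => [|t]; last exact: Sst.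
apply: eq_bigr => t _; rewrite (expZ _ _ SE); last by apply: SM; exact: SY.
rewrite path_avg_covn//.
Qed.

(** By stationarity both factors have the same variance, so 2 |y z| <= y^2 + z^2 is enough. *)
Lemma avg_autocov_norm_le j c e (h : nat) : a <= c -> e <= b ->
  `|avg_autocov j c e h%:Z| <= avg_autocov j c e 0.
Proof.
move=> ac eb.
have SY t := path_avg_all_moments j c e t ac eb.
have S1 : all_moments P (fun w => path_avg 0 j c e w * path_avg h%:Z j c e w) by apply: SM.
have S2 : all_moments P (fun w => 2^-1 * (path_avg 0 j c e w * path_avg 0 j c e w + path_avg h%:Z j c e w * path_avg h%:Z j c e w)).
  by apply: SM; [exact: Sc|apply: (mom_add _ _ SE); exact: SM].
have E2 : \int[P]_w (2^-1 * (path_avg 0 j c e w * path_avg 0 j c e w + path_avg h%:Z j c e w * path_avg h%:Z j c e w)) = avg_autocov j c e 0.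
  rewrite (expZ _ _ SE); last by apply: (mom_add _ _ SE); exact: SM.
  rewrite (expD _ _ SE); [|exact: SM|exact: SM].
  have := path_avg_cov j c e ac eb 0 0; rewrite addr0 => ->.
  have := path_avg_cov j c e ac eb h%:Z 0; rewrite addr0 => ->.
  by field.
have -> : avg_autocov j c e h%:Z = \int[P]_w (path_avg 0 j c e w * path_avg h%:Z j c e w).
  by rewrite -(path_avg_cov j c e ac eb 0 h%:Z) add0r.
rewrite ler_norml -E2; apply/andP; split; last first.
  apply: (exp_mono _ _ SE) => // w.
  set y := path_avg 0 j c e w; set z := path_avg h%:Z j c e w.
  by have := sqr_ge0 (y - z); lra.
rewrite lerNl -mulN1r -(expZ _ _ SE)//.
apply: (exp_mono _ _ SE) => //; first by apply: SM; [exact: Sc|].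
move=> w; set y := path_avg 0 j c e w; set z := path_avg h%:Z j c e w.
by have := sqr_ge0 (y + z); lra.
Qed.

Lemma inner_avg_curve1 j c e (f : curve R p R) : a <= c -> e <= b ->
  leb.-integrable `[c, e] (EFin \o f j) ->
  inner U (avg_curve j c e) f = (e - c)^-1 * \int[leb]_(u in `[c, e]) f j u.
Proof.
move=> ac eb If; rewrite /inner (bigD1 j)//= [X in _ + X]big1 ?addr0; last first.
  move=> k /negPf kj; transitivity (\int[leb]_(v in U) (0 : R)).
    by apply: eq_Rintegral => v _; rewrite /avg_curve kj !mul0r.
  by rewrite Rintegral_cst// mul0r.
rewrite -RintegralZl// -(Rintegral_indicM a b c e)//.
apply: eq_Rintegral => u uI; rewrite /avg_curve eqxx mul1r.
by ring.
Qed.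

Variable F : R -> curve R p R -> curve R p R[i].
Hypothesis sd : is_spectral_density P U X F.
Hypothesis stab_fin : (stability P U X F < +oo)%E.

(** * The spectral density tested on an interval average *)

Section SpectralBound.
Variables (j : 'I_p) (c e : R).
Hypotheses (ac : a <= c) (eb : e <= b).
Local Notation Phi := (avg_curve j c e).
Local Notation gam := (fun h : nat => avg_autocov j c e h%:Z).
Let opj (h : int) (u : R) : R := autocov_op P U X h Phi j u.

Let Phi_Hp : Hp U Phi.
Proof.
have := avg_curve_Hp a b j j c e c e 1 0; congr Hp.
apply/funext => l; apply/funext => u.
by rewrite mul1r mul0r addr0.
Qed.

Let opj_integrableU h : leb.-integrable `[a, b] (EFin \o opj h).
Proof.
have H := fubini_average_integrable 0 j a b (path_avg (0 + h) j c e) (lexx a) (lexx b) (path_avg_measurable j c e ac eb _) (path_avg_sqr_integrable j c e ac eb _).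
apply: eq_integrable H => // u uI; have Uu : U u by exact: set_mem.
rewrite /= path_avg_value_cov//.
have Iv : leb.-integrable `[c, e] (EFin \o (fun v => autocov P X h j j u v)).
  have H := fubini_average_integrable (0 + h) j c e (X 0 j u) ac eb (curve_value_measurable 0 j u Uu)
      (curve_value_sqr_integrable 0 j u Uu).
  apply: eq_integrable H => // v vI; rewrite /=.
  under eq_Rintegral do rewrite mulrC.
  rewrite autocovE//.
  move: vI; rewrite inE /= in_itv/= => /andP[cv ve].
  by rewrite /= in_itv/= (le_trans ac cv) (le_trans ve eb).
congr EFin; rewrite /opj /autocov_op (bigD1 j)//= big1 ?addr0; last first.
  move=> k /negPf kj; transitivity (\int[leb]_(v in U) (0 : R)).
    by apply: eq_Rintegral => v _; rewrite /avg_curve kj mul0r mulr0.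
  by rewrite Rintegral_cst// mul0r.
rewrite -RintegralZl// -(Rintegral_indicM a b c e)//.
apply: eq_Rintegral => v _; rewrite /avg_curve eqxx mul1r.
by ring.
Qed.

Let subI (f : R -> R) : leb.-integrable `[a, b] (EFin \o f) -> leb.-integrable `[c, e] (EFin \o f).
Proof.
apply: integrableS; [exact: measurable_itv|exact: measurable_itv|].
by move=> u /=; rewrite !in_itv/= => /andP[? ?]; apply/andP; split; [exact: le_trans ac _|exact: le_trans eb].
Qed.

Let opj_integrable h : leb.-integrable `[c, e] (EFin \o opj h).
Proof.
by apply: subI; exact: opj_integrableU.
Qed.

Let trig_sum_integrableU (w : int -> R) N : leb.-integrable `[a, b]
  (EFin \o (fun u => (2 * pi)^-1 * \sum_(l < N.*2.+1) (opj (l%:Z - N%:Z) u * w (l%:Z - N%:Z)))).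
Proof.
apply: integrable_scalel => //.
have H (r : seq 'I_(N.*2.+1)) : leb.-integrable `[a, b] (EFin \o (fun u => \sum_(l <- r) (opj (l%:Z - N%:Z) u * w (l%:Z - N%:Z)))).
  elim: r => [|l r IH].
    apply: (@eq_integrable _ _ _ leb `[a, b]%classic _ (cst 0%E)) => //; last exact: integrable0.
    by move=> u _; rewrite /= big_nil.
  have I1 := integrable_scalel leb `[a, b]%classic (w (l%:Z - N%:Z)) (opj (l%:Z - N%:Z)) (measurable_itv _) (opj_integrableU _).
  have := integrable_addl leb `[a, b]%classic _ _ (measurable_itv _) I1 IH; apply: eq_integrable => // u _.
  by rewrite /= big_cons mulrC.
exact: H.
Qed.

Let Rint_opj h : (e - c)^-1 * \int[leb]_(u in `[c, e]) opj h u = avg_autocov j c e h.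
Proof.
rewrite -inner_autocov_op_avg// inner_avg_curve1//.
exact: opj_integrable.
Qed.

Let ReS N theta u := (2 * pi)^-1 * \sum_(l < N.*2.+1) (opj (l%:Z - N%:Z) u * cos ((l%:Z - N%:Z)%:~R * theta)).

Let ReSE N theta u : complex.Re (spectral_partial_sum P U X N theta Phi j u) = ReS N theta u.
Proof.
rewrite /spectral_partial_sum /ReS.
have Re_sum (r : seq 'I_(N.*2.+1)) (G : 'I_(N.*2.+1) -> R[i]) : complex.Re (\sum_(l <- r) G l) = \sum_(l <- r) complex.Re (G l).
  elim: r => [|l r IH]; first by rewrite !big_nil.
  rewrite !big_cons -IH.
  by case: (G l) => ? ?; case: (\sum_(_ <- r) _).
have ReC (k : R) (z : R[i]) : complex.Re (k%:C%C * z) = k * complex.Re z.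
  case: z => x y /=.
  by rewrite mul0r subr0.
rewrite ReC Re_sum; congr (_ * _); apply: eq_bigr => l _.
rewrite ReC.
by [].
Qed.

Let ReS_integrableU N theta : leb.-integrable `[a, b] (EFin \o ReS N theta).
Proof.
exact: (trig_sum_integrableU (fun h => cos (h%:~R * theta)) N).
Qed.

Let ReS_integrable N theta : leb.-integrable `[c, e] (EFin \o ReS N theta).
Proof.
by apply: subI; exact: ReS_integrableU.
Qed.

Let ImS_measurable N theta : measurable_fun `[a, b] (fun u => complex.Im (spectral_partial_sum P U X N theta Phi j u)).
Proof.
apply/measurable_EFinP.
have := measurable_int leb (trig_sum_integrableU (fun h => - sin (h%:~R * theta)) N).
apply: eq_measurable_fun => u _ /=; congr EFin.
rewrite /spectral_partial_sum.
have Im_sum (r : seq 'I_(N.*2.+1)) (G : 'I_(N.*2.+1) -> R[i]) : complex.Im (\sum_(l <- r) G l) = \sum_(l <- r) complex.Im (G l).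
  elim: r => [|l r IH]; first by rewrite !big_nil.
  rewrite !big_cons -IH.
  by case: (G l) => ? ?; case: (\sum_(_ <- r) _).
have ImC (k : R) (z : R[i]) : complex.Im (k%:C%C * z) = k * complex.Im z.
  case: z => x y /=.
  by rewrite mul0r addr0.
rewrite ImC Im_sum; congr (_ * _); apply: eq_bigr => l _.
rewrite ImC.
by [].
Qed.

(** The two-sided sum over |h| <= N folds into a one-sided cosine sum because the autocovariance of
    the averages is even in h. *)
Let mean_ReS N theta : (e - c)^-1 * \int[leb]_(u in `[c, e]) ReS N theta u =
  (2 * pi)^-1 * fourier_sum gam N theta.
Proof.
rewrite RintegralZl//; last first.
  have := integrable_scalel leb `[c, e]%classic (2 * pi) _ (measurable_itv _) (ReS_integrable N theta).
  apply: eq_integrable => // u _; rewrite /= /ReS mulrA divff ?mul1r//.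
  by rewrite mulf_neq0// gt_eqF// pi_gt0.
rewrite mulrCA; congr (_ * _).
have H (r : seq 'I_(N.*2.+1)) : leb.-integrable `[c, e] (EFin \o (fun u => \sum_(l <- r) (opj (l%:Z - N%:Z) u * cos ((l%:Z - N%:Z)%:~R * theta)))) /\
   (e - c)^-1 * \int[leb]_(u in `[c, e]) (\sum_(l <- r) (opj (l%:Z - N%:Z) u * cos ((l%:Z - N%:Z)%:~R * theta))) =
   \sum_(l <- r) avg_autocov j c e (l%:Z - N%:Z) * cos ((l%:Z - N%:Z)%:~R * theta).
  elim: r => [|l r [IH1 IH2]].
    split.
      apply: (@eq_integrable _ _ _ leb `[c, e]%classic _ (cst 0%E)) => //; last exact: integrable0.
      by move=> u _; rewrite /= big_nil.
    under eq_Rintegral do rewrite big_nil.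
    by rewrite big_nil Rintegral_cst// mul0r mulr0.
  have I1 : leb.-integrable `[c, e] (EFin \o (fun u => opj (l%:Z - N%:Z) u * cos ((l%:Z - N%:Z)%:~R * theta))).
    have := integrable_scalel leb `[c, e]%classic (cos ((l%:Z - N%:Z)%:~R * theta)) (opj (l%:Z - N%:Z)) (measurable_itv _) (opj_integrable _).
    apply: eq_integrable => // u _.
    by rewrite /= mulrC.
  split.
    have := integrable_addl leb `[c, e]%classic _ _ (measurable_itv _) I1 IH1; apply: eq_integrable => // u _.
    by rewrite /= big_cons.
  under eq_Rintegral do rewrite big_cons.
  rewrite RintegralD// mulrDr IH2 big_cons; congr (_ + _).
  have eZ : \int[leb]_(u in `[c, e]) (opj (l%:Z - N%:Z) u * cos ((l%:Z - N%:Z)%:~R * theta)) =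
      (\int[leb]_(u in `[c, e]) opj (l%:Z - N%:Z) u) * cos ((l%:Z - N%:Z)%:~R * theta).
    by apply: RintegralZr => //; exact: opj_integrable.
  by rewrite eZ mulrA Rint_opj.
have [_ ->] := H (index_enum 'I_(N.*2.+1)).
rewrite /fourier_sum.
have -> : \sum_(l <- index_enum 'I_(N.*2.+1)) avg_autocov j c e (l%:Z - N%:Z) * cos ((l%:Z - N%:Z)%:~R * theta) =
   \sum_(l < N + N.+1) avg_autocov j c e (l%:Z - N%:Z) * cos ((l%:Z - N%:Z)%:~R * theta).
  by rewrite -addnn -addnS.
rewrite big_split_ord/= big_ord_recl/= addn0 subrr mul0r cos0 mulr1.
have -> : \sum_(i < N) avg_autocov j c e (i%:Z - N%:Z) * cos ((i%:Z - N%:Z)%:~R * theta) =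
    \sum_(k < N) avg_autocov j c e k.+1%:Z * cos (k.+1%:R * theta).
  rewrite (reindex_inj rev_ord_inj)/=; apply: eq_bigr => i _.
  have -> : ((N - i.+1)%N%:Z - N%:Z) = - (i.+1%:Z) by have := ltn_ord i; lia.
  by rewrite avg_autocovN// mulrNz mulNr cosN.
have -> : \sum_(i < N) avg_autocov j c e ((N + bump 0 i)%N%:Z - N%:Z) * cos (((N + bump 0 i)%N%:Z - N%:Z)%:~R * theta) =
    \sum_(k < N) avg_autocov j c e k.+1%:Z * cos (k.+1%:R * theta).
  apply: eq_bigr => i _; rewrite /bump /= add1n.
  have -> : ((N + i.+1)%N%:Z - N%:Z) = i.+1%:Z by lia.
  by [].
by ring.
Qed.

(** Pairing with Phi turns the norm convergence of the spectral series into the scalar convergence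
    that the Fejer argument requires. *)
Lemma fourier_sum_cvg_spectral theta : - pi <= theta <= pi ->
  fourier_sum gam N theta @[N --> \oo] --> 2 * pi * complex.Re (innerC U Phi (F theta Phi)).
Proof.
move=> th; have thI : theta \in `[- pi, pi] by rewrite in_itv.
have [FH Fcvg] := sd theta thI Phi Phi_Hp.
pose ReF u := complex.Re (F theta Phi j u).
have IFU : leb.-integrable `[a, b] (EFin \o ReF) by apply: L2_integrable; exact: (FH j).1.
have IF := subI _ IFU.
have mIF : measurable_fun `[a, b] (fun u => complex.Im (F theta Phi j u)) by exact: (FH j).2.1.
have ReFE : complex.Re (innerC U Phi (F theta Phi)) = (e - c)^-1 * \int[leb]_(u in `[c, e]) ReF u.
  by rewrite -(inner_avg_curve1 j c e (fun j u => complex.Re (F theta Phi j u))).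
pose D N u := ReS N theta u - ReF u.
have IDU N : leb.-integrable `[a, b] (EFin \o D N).
  have := integrable_addl leb `[a, b]%classic _ _ (measurable_itv _) (ReS_integrableU N theta)
    (integrable_scalel leb `[a, b]%classic (-1) _ (measurable_itv _) IFU).
  apply: eq_integrable => // u _.
  by rewrite /= mulN1r.
have ID N := subI _ (IDU N).
have mDU N : measurable_fun `[a, b] (D N).
  by apply/measurable_EFinP; exact: (measurable_int leb (IDU N)).
have mD N : measurable_fun `[c, e] (D N).
  by apply/measurable_EFinP; exact: (measurable_int leb (ID N)).
pose sq N := sqnormC U (fun j u => spectral_partial_sum P U X N theta Phi j u - F theta Phi j u).
have sub_cU : `[c, e]%classic `<=` U.
  by move=> u /=; rewrite !in_itv/= => /andP[? ?]; apply/andP; split; [exact: le_trans ac _|exact: le_trans eb].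
have sqD N : (\int[leb]_(u in `[c, e]) (D N u ^+ 2)%:E <= sq N)%E.
  have mE2 : measurable_fun `[a, b] (fun u => (complex.Re (spectral_partial_sum P U X N theta Phi j u - F theta Phi j u) ^+ 2 +
     complex.Im (spectral_partial_sum P U X N theta Phi j u - F theta Phi j u) ^+ 2)%:E).
    apply/measurable_EFinP.
    apply: (@eq_measurable_fun _ _ _ _ _ (fun u => D N u ^+ 2 + (complex.Im (spectral_partial_sum P U X N theta Phi j u) - complex.Im (F theta Phi j u)) ^+ 2)).
      move=> u _; rewrite /D /ReF -ReSE.
      case: (spectral_partial_sum P U X N theta Phi j u) => x1 y1.
      by case: (F theta Phi j u) => x2 y2.
    apply: measurable_funD; apply: measurable_funX; first exact: mDU.
    by apply: measurable_funB => //; exact: ImS_measurable.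
  rewrite /sq /sqnormC (bigD1 j)//=; apply: lee_paddr.
    by apply: sume_ge0 => k _; apply: integral_ge0 => u _; rewrite lee_fin addr_ge0// sqr_ge0.
  apply: (@le_trans _ _ (\int[leb]_(u in `[c, e]) (complex.Re (spectral_partial_sum P U X N theta Phi j u - F theta Phi j u) ^+ 2 +
     complex.Im (spectral_partial_sum P U X N theta Phi j u - F theta Phi j u) ^+ 2)%:E)%E); last first.
    apply: ge0_subset_integral => // u _.
    by rewrite lee_fin addr_ge0// sqr_ge0.
  apply: ge0_le_integral => //.
  - by move=> u _; rewrite lee_fin sqr_ge0.
  - exact: (measurable_sqrE _ _ (mD N)).
  - exact: measurable_funS mE2.
  - move=> u _; rewrite lee_fin /D /ReF -ReSE.
    case: (spectral_partial_sum P U X N theta Phi j u) => x1 y1; case: (F theta Phi j u) => x2 y2 /=.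
    by rewrite lerDl sqr_ge0.
have /fine_cvgP[sq_fin sq0] : sq N @[N --> \oo] --> (0 : R)%:E by exact: Fcvg.
pose m0 := fine (leb `[c, e]%classic).
have m0_ge0 : 0 <= m0 by apply: fine_ge0.
(* |D| <= k + D^2 / k: with k of the order of the tolerance, this plays the part of the
   Cauchy-Schwarz inequality. *)
have absD N k : 0 < k -> sq N \is a fin_num ->
    `|\int[leb]_(u in `[c, e]) D N u| <= k * m0 + k^-1 * fine (sq N).
  move=> k0 sqf.
  have sqN0 : (0 <= sq N)%E by apply: le_trans (sqD N); apply: integral_ge0 => u _; rewrite lee_fin sqr_ge0.
  have ID2 : leb.-integrable `[c, e] (EFin \o (fun u => D N u ^+ 2)).
    apply/integrableP; split.
      exact: (measurable_sqrE _ _ (mD N)).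
    under eq_integral => u _ do rewrite /= ger0_norm ?sqr_ge0//.
    by apply: (le_lt_trans (sqD N)); rewrite -ge0_fin_numE.
  have Ik : leb.-integrable `[c, e] (EFin \o (fun=> k)).
    apply: continuous_compact_integrable; first exact: segment_compact.
    by apply: continuous_subspaceT => u; exact: cvg_cst.
  have Ik2 := integrable_scalel leb `[c, e]%classic k^-1 _ (measurable_itv _) ID2.
  have nD : `|\int[leb]_(u in `[c, e]) D N u| <= \int[leb]_(u in `[c, e]) `|D N u|.
    by apply: le_normr_Rintegral => //; exact: ID.
  apply: (le_trans nD).
  apply: (@le_trans _ _ (\int[leb]_(u in `[c, e]) (k + k^-1 * D N u ^+ 2))).
    apply: le_Rintegral => //.
    - by have := integrable_norm (ID N); apply: eq_integrable.
    - exact: integrable_addl.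
    - move=> u _; set y := D N u.
      rewrite -(@ler_pM2l _ k)// mulrDr mulrA mulfV ?gt_eqF// mul1r.
      rewrite -[y ^+ 2]real_normK ?num_real//.
      by have := normr_ge0 y; have := sqr_ge0 (k - `|y|); nra.
  rewrite RintegralD// RintegralZl// Rintegral_cst//; apply: lerD => //.
  apply: ler_wpM2l; first by rewrite invr_ge0 ltW.
  rewrite -lee_fin (fineK sqf) /Rintegral fineK; first exact: sqD.
  rewrite ge0_fin_numE; last by apply: integral_ge0 => u _; rewrite lee_fin sqr_ge0.
  by apply: (le_lt_trans (sqD N)); rewrite -ge0_fin_numE.
have lim0 : \int[leb]_(u in `[c, e]) D N u @[N --> \oo] --> (0 : R).
  apply/cvgr0Pnorm_lt => eps eps0.
  pose k := eps / (2 * (m0 + 1)).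
  have m1 : 0 < m0 + 1 by rewrite ltr_wpDl.
  have k0 : 0 < k by rewrite divr_gt0// mulr_gt0.
  have km : k * m0 <= eps / 2.
    have <- : k * (m0 + 1) = eps / 2 by rewrite /k; field; rewrite gt_eqF.
    by apply: ler_wpM2l; [exact: ltW|rewrite lerDl].
  have ke : 0 < k * (eps / 2) by rewrite mulr_gt0// divr_gt0.
  have /cvgr_lt/(_ _ ke) sqlt := sq0.
  near=> N.
  have sqf : sq N \is a fin_num by near: N.
  have sqN : fine (sq N) < k * (eps / 2) by near: N; exact: sqlt.
  apply: (le_lt_trans (absD N k k0 sqf)).
  have : k^-1 * fine (sq N) < eps / 2 by rewrite ltr_pdivrMl.
  by lra.
have -> : 2 * pi * complex.Re (innerC U Phi (F theta Phi)) = 2 * pi * ((e - c)^-1 * (0 + \int[leb]_(u in `[c, e]) ReF u)).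
  by rewrite ReFE add0r.
have fsE N : fourier_sum gam N theta = 2 * pi * ((e - c)^-1 * (\int[leb]_(u in `[c, e]) D N u + \int[leb]_(u in `[c, e]) ReF u)).
  rewrite -RintegralD//.
  transitivity (2 * pi * ((e - c)^-1 * \int[leb]_(u in `[c, e]) ReS N theta u)).
    rewrite mean_ReS mulrA divff ?mul1r//.
    by rewrite mulf_neq0// gt_eqF// pi_gt0.
  congr (_ * (_ * _)); apply: eq_Rintegral => u _.
  by rewrite /D subrK.
under eq_fun do rewrite fsE.
apply: cvgM; first exact: cvg_cst.
apply: cvgM; first exact: cvg_cst.
by apply: cvgD; [exact: lim0|exact: cvg_cst].
Unshelve. all: by end_near.
Qed.

End SpectralBound.

(** K is 16 pi M_1. The alternative K = 0 covers the case where no interval average has positive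
    variance, in which the supremum defining M_1 may be over an empty set and so not be a
    nonnegative real. *)
Lemma stability_variance_bound : exists K : R, [/\ 0 <= K,
  (forall j c e n (cc : nat -> R), a <= c -> e <= b ->
     \int[P]_w ((\sum_(s < n) cc s * path_avg (s.+1)%:Z j c e w) ^+ 2) <=
     K * avg_autocov j c e 0 * \sum_(s < n) cc s ^+ 2) &
  (K = 0 \/ (0 < K /\ stability1 P U X F = (K / (16 * pi))%:E))].
Proof.
have pi0 := @pi_gt0 R.
have zero_case K j c e n (cc : nat -> R) : 0 <= K -> a <= c -> e <= b -> avg_autocov j c e 0 <= 0 ->
     \int[P]_w ((\sum_(s < n) cc s * path_avg (s.+1)%:Z j c e w) ^+ 2) <=
     K * avg_autocov j c e 0 * \sum_(s < n) cc s ^+ 2.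
  move=> K0 ac eb g0.
  have gz h : avg_autocov j c e h%:Z = 0.
    have := avg_autocov_norm_le j c e h ac eb => /le_trans/(_ g0).
    by rewrite normr_le0 => /eqP.
  rewrite path_avg_gram// gz mulr0 mul0r big1// => s _; rewrite big1// => t _.
  by rewrite gz mulr0.
have psd j c e : a <= c -> e <= b -> forall n (cc : nat -> R),
    0 <= \sum_(s < n) \sum_(t < n) cc s * cc t * avg_autocov j c e (natdist s t)%:Z.
  move=> ac eb n cc; rewrite -path_avg_gram//; apply: Rintegral_ge0 => w _.
  exact: sqr_ge0.
have [[j0 [c0 [e0 [ac0 eb0 g0]]]]|none] := pselect (exists j c e, [/\ a <= c, e <= b & 0 < avg_autocov j c e 0]); last first.
  exists 0; split=> //; last by left.
  move=> j c e n cc ac eb; apply: zero_case => //.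
  rewrite leNgt; apply/negP => g0; apply: none.
  by exists j, c, e.
have PhiH0 j c e : a <= c -> e <= b -> 0 < avg_autocov j c e 0 ->
    H0p P U X (avg_curve j c e) /\ (norm0 U (avg_curve j c e) <= 1)%N.
  move=> ac eb gp; split.
    split; last by rewrite inner_autocov_op_avg.
    have := avg_curve_Hp a b j j c e c e 1 0; congr Hp.
    apply/funext => l; apply/funext => u.
    by rewrite mul1r mul0r addr0.
  rewrite /norm0 (bigD1 j)//= big1 ?addn0; first by case: (_ != _).
  move=> l /negPf lj; apply/eqP; rewrite eqb0 negbK; apply/eqP.
  rewrite /L2norm (eq_integral (fun=> 0%E)) ?integral0 ?sqrte0// => u _.
  by rewrite /avg_curve lj mul0r expr0n.
pose q1 theta := ereal_sup [set (spectral_quotient P U X F theta Phi)%:E |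
                Phi in [set Phi | H0p P U X Phi /\ (norm0 U Phi <= 1)%N]].
pose qs := ess_sup (@leb_pi R) q1.
have M1E : stability1 P U X F = ((2 * pi)%:E * qs)%E by [].
have quotE theta j c e : a <= c -> e <= b -> spectral_quotient P U X F theta (avg_curve j c e) =
    complex.Re (innerC U (avg_curve j c e) (F theta (avg_curve j c e))) / avg_autocov j c e 0.
  by move=> ac eb; rewrite /spectral_quotient inner_autocov_op_avg.
have Re_ge0 theta j c e : a <= c -> e <= b -> - pi <= theta <= pi ->
    0 <= 2 * pi * complex.Re (innerC U (avg_curve j c e) (F theta (avg_curve j c e))).
  move=> ac eb th; exact: (fourier_limit_ge0 (fun h : nat => avg_autocov j c e h%:Z) (psd j c e ac eb)
     (fun theta => 2 * pi * complex.Re (innerC U (avg_curve j c e) (F theta (avg_curve j c e))))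
     (fun x => fourier_sum_cvg_spectral j c e ac eb x) theta th).
have pi2 : 0 < 2 * pi :> R by rewrite mulr_gt0.
have q1_ge theta j c e : a <= c -> e <= b -> 0 < avg_autocov j c e 0 ->
    ((spectral_quotient P U X F theta (avg_curve j c e))%:E <= q1 theta)%E.
  move=> ac eb gp; apply: ereal_sup_ubound; exists (avg_curve j c e) => //.
  exact: PhiH0.
have leb_piE (A : set R) : leb_pi A = leb (A `&` `[- pi, pi]%classic) by [].
(* Up to a positive factor, the quotient of one nondegenerate average is a limit of Fejer means,
   hence nonnegative at every frequency. Together with M_1 <= M < +oo this makes [qs] finite. *)
have qs_ge0 : (0 <= qs)%E.
  apply: ess_sup_gee.
    rewrite leb_piE (_ : [set: _] `&` _ = `[- pi, pi]%classic :> set R); last by rewrite setTI.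
    rewrite /= lebesgue_measure_itv/= lte_fin.
    have -> : - pi < pi :> R by lra.
    by rewrite -EFinB lte_fin; lra.
  exists (~` `[- pi, pi]); split.
  - exact: measurableC.
  - by rewrite leb_piE (_ : _ `&` _ = set0) ?measure0//; rewrite setICl.
  - move=> theta H thI; apply: H => /=.
    apply: le_trans (q1_ge theta j0 c0 e0 ac0 eb0 g0).
    rewrite lee_fin quotE//; apply: divr_ge0; last exact: ltW.
    by rewrite -(pmulr_rge0 _ pi2); apply: Re_ge0.
have qs_lty : (qs < +oo)%E.
  apply: (@le_lt_trans _ _ (ess_sup (@leb_pi R) (fun theta => ereal_sup [set (spectral_quotient P U X F theta Phi)%:E |
                Phi in [set Phi | H0p P U X Phi /\ True]]))).
    apply: le_ess_sup; apply: nearW => theta; apply: ereal_sup_le => _ [Phi [H _] <-].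
    by exists Phi.
  move: stab_fin; rewrite /stability /stability_on.
  set z := ess_sup _ _; case: z => [r _|| _]; rewrite ?ltry ?ltNyr//.
  by rewrite mulry gtr0_sg// mul1e.
have qs_fin : qs \is a fin_num by rewrite ge0_fin_numE.
pose K := 16 * pi * (2 * pi * fine qs).
have K0 : 0 <= K by rewrite !mulr_ge0 ?fine_ge0// ltW.
have bnd j c e n (cc : nat -> R) : a <= c -> e <= b ->
     \int[P]_w ((\sum_(s < n) cc s * path_avg (s.+1)%:Z j c e w) ^+ 2) <=
     K * avg_autocov j c e 0 * \sum_(s < n) cc s ^+ 2.
  move=> ac eb; have [gle0|gp] := leP (avg_autocov j c e 0) 0; first exact: zero_case.
  rewrite path_avg_gram//.
  (* The frequencies at which the supremum over Phi exceeds its essential supremum lie in a null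
     set; it becomes the exceptional set of the Toeplitz bound. *)
  have [N [mN N0 NP]] := ess_sup_ge (@leb_pi R) q1.
  have mE : measurable (N `&` `[- pi, pi]%classic : set R) by exact: measurableI.
  have gle x : - pi <= x <= pi -> ~ (N `&` `[- pi, pi]%classic) x ->
      2 * pi * complex.Re (innerC U (avg_curve j c e) (F x (avg_curve j c e))) <= 2 * pi * fine qs * avg_autocov j c e 0.
    move=> xpi Nx; have q1x : (q1 x <= qs)%E.
      apply: contrapT => H; apply: Nx; split; first exact: NP.
      by rewrite /= in_itv.
    have : spectral_quotient P U X F x (avg_curve j c e) <= fine qs.
      by rewrite -lee_fin (fineK qs_fin); exact: le_trans (q1_ge x j c e ac eb gp) q1x.
    rewrite quotE// ler_pdivrMr// => H.
    by rewrite -[leRHS]mulrA ler_pM2l.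
  have B0 : 0 <= 2 * pi * fine qs * avg_autocov j c e 0.
    apply: mulr_ge0; last exact: ltW.
    by apply: mulr_ge0; [exact: ltW|exact: fine_ge0].
  have := toeplitz_bound (fun h : nat => avg_autocov j c e h%:Z)
     (fun theta => 2 * pi * complex.Re (innerC U (avg_curve j c e) (F theta (avg_curve j c e))))
     (2 * pi * fine qs * avg_autocov j c e 0) (psd j c e ac eb)
     (fun x => fourier_sum_cvg_spectral j c e ac eb x) B0 _ mE N0 gle cc n.
  by rewrite /K !mulrA.
(* K > 0 follows from the bound for a single nondegenerate average with n = 1: its variance is at
   most K times itself. *)
exists K; split=> //; right; split.
  rewrite lt_neqAle K0 andbT; apply/negP => /eqP KE.
  have := bnd j0 c0 e0 1%N (fun=> 1) ac0 eb0; rewrite -KE !mul0r.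
  rewrite (path_avg_gram j0 c0 e0 1%N (fun=> 1) ac0 eb0).
  rewrite !big_ord1 !mul1r.
  have -> : natdist (@ord0 0) ord0 = 0%N by [].
  by move=> /(lt_le_trans g0); rewrite ltxx.
rewrite M1E -[in LHS](fineK qs_fin) -EFinM; congr EFin; rewrite /K.
by rewrite [in RHS]mulrAC divff ?mul1r// mulf_neq0 ?pnatr_eq0// gt_eqF.
Qed.

(** Polarization: the centred squared norms of x Y + y Z and x Y - y Z differ by 4 x y times the
    centred sum of the products Y Z. The weights x and y bring both variances to at most 1, so that
    the bound scales with the product of the variances, not with the square of their sum. *)
Lemma avg_cov_error_moment j k c e c' e' x y K n q :
  (forall j c e n (cc : nat -> R), a <= c -> e <= b ->
     \int[P]_w ((\sum_(s < n) cc s * path_avg (s.+1)%:Z j c e w) ^+ 2) <=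
     K * avg_autocov j c e 0 * \sum_(s < n) cc s ^+ 2) ->
  0 <= K -> a <= c -> e <= b -> a <= c' -> e' <= b -> 0 < x -> 0 < y -> (0 < n)%N ->
  x ^+ 2 * avg_autocov j c e 0 <= 1 -> y ^+ 2 * avg_autocov k c' e' 0 <= 1 ->
  \int[P]_w ((n%:R^-1 * \sum_(s < n) (path_avg s.+1%:Z j c e w * path_avg s.+1%:Z k c' e' w -
      \int[P]_w (path_avg s.+1%:Z j c e w * path_avg s.+1%:Z k c' e' w))) ^+ (2 * q)) <=
  (64 * K ^+ 2 * q%:R * (2 * q + n)%:R / n%:R ^+ 2 * (x ^+ 2)^-1 * (y ^+ 2)^-1) ^+ q.
Proof.
move=> HK K0 ac eb ac' eb' x0 y0 n0 xj yk.
(* q >= 1 will be needed for 2 <= 2^q, when the moments of the two signs are added. *)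
have [->|qpos] := posnP q.
  under eq_Rintegral do rewrite muln0 expr0.
  by rewrite (exp_cst _ _ SE) expr0.
pose Y (s : nat) := path_avg s.+1%:Z j c e; pose Z (s : nat) := path_avg s.+1%:Z k c' e'.
have SY s : all_moments P (Y s) by exact: path_avg_all_moments.
have SZ s : all_moments P (Z s) by exact: path_avg_all_moments.
have SYZ s : all_moments P (fun w => Y s w * Z s w) by exact: SM.
pose z (sg : R) (i : 'I_n) := avg_comb j k c e c' e' x (sg * y) i.+1%:Z.
have zE sg i w : z sg i w = x * Y i w + sg * y * Z i w by [].
have Sz sg i : all_moments P (z sg i) by exact: avg_comb_all_moments.
have S_add := mom_add _ _ SE.
have Slin (u : nat -> T -> R) (cc : 'I_n -> R) : (forall i, all_moments P (u i)) -> all_moments P (fun w => \sum_(i < n) cc i * u i w).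
  by move=> Su; apply: (mom_sum _ _ SE) => i; apply: SM => //; exact: Sc.
pose V sg := centered_sq_norm (E := fun f => \int[P]_w f w) (z sg).
(* Since (A + B)^2 <= 2 A^2 + 2 B^2, each of the two normalized averages contributes 2 K. *)
have covK sg : sg ^+ 2 = 1 -> forall cc : 'I_n -> R, \int[P]_w (lincomb (z sg) cc w ^+ 2) <= 4 * K * \sum_(i < n) cc i ^+ 2.
  move=> sg1 cc.
  pose ccn (s : nat) := if insub s is Some i then cc i else 0.
  have ccE (i : 'I_n) : ccn i = cc i by rewrite /ccn valK.
  have HY := HK j c e n ccn ac eb; have HZ := HK k c' e' n ccn ac' eb'.
  have S2 : \sum_(i < n) ccn i ^+ 2 = \sum_(i < n) cc i ^+ 2 by apply: eq_bigr => i _; rewrite ccE.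
  rewrite S2 in HY HZ.
  have s0 : 0 <= \sum_(i < n) cc i ^+ 2 by apply: sumr_ge0 => i _; exact: sqr_ge0.
  pose A w := \sum_(i < n) ccn i * Y i w; pose B w := \sum_(i < n) ccn i * Z i w.
  have SA : all_moments P A by apply: Slin.
  have SB : all_moments P B by apply: Slin.
  have SA2 : all_moments P (fun w => A w ^+ 2) by exact: (mom_exp _ _ SE).
  have SB2 : all_moments P (fun w => B w ^+ 2) by exact: (mom_exp _ _ SE).
  have LE w : lincomb (z sg) cc w = x * A w + sg * y * B w.
    rewrite /lincomb /A /B !mulr_sumr -big_split/=; apply: eq_bigr => i _.
    by rewrite zE ccE; ring.
  apply: (@le_trans _ _ (\int[P]_w (2 * x ^+ 2 * A w ^+ 2 + 2 * y ^+ 2 * B w ^+ 2))).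
    apply: (exp_mono _ _ SE).
    - by rewrite /lincomb; apply: (mom_exp _ _ SE); apply: (mom_sum _ _ SE) => i; apply: SM => //; exact: Sc.
    - by apply: S_add; apply: SM => //; exact: Sc.
    - move=> w; rewrite LE.
      have -> : 2 * y ^+ 2 * B w ^+ 2 = 2 * (sg * y * B w) ^+ 2 by rewrite !exprMn sg1; ring.
      by have := sqr_ge0 (x * A w - sg * y * B w); nra.
  rewrite (expD _ _ SE); [|by apply: SM => //; exact: Sc|by apply: SM => //; exact: Sc].
  rewrite !(expZ _ _ SE)//.
  have h1 : 2 * x ^+ 2 * \int[P]_w (A w ^+ 2) <= 2 * K * \sum_(i < n) cc i ^+ 2.
    apply: (@le_trans _ _ (2 * x ^+ 2 * (K * avg_autocov j c e 0 * \sum_(i < n) cc i ^+ 2))).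
      by apply: ler_wpM2l => //; rewrite mulr_ge0// sqr_ge0.
    rewrite (_ : _ * _ = (x ^+ 2 * avg_autocov j c e 0) * (2 * K * \sum_(i < n) cc i ^+ 2)); last by ring.
    by apply: ler_piMl => //; rewrite !mulr_ge0.
  have h2 : 2 * y ^+ 2 * \int[P]_w (B w ^+ 2) <= 2 * K * \sum_(i < n) cc i ^+ 2.
    apply: (@le_trans _ _ (2 * y ^+ 2 * (K * avg_autocov k c' e' 0 * \sum_(i < n) cc i ^+ 2))).
      by apply: ler_wpM2l => //; rewrite mulr_ge0// sqr_ge0.
    rewrite (_ : _ * _ = (y ^+ 2 * avg_autocov k c' e' 0) * (2 * K * \sum_(i < n) cc i ^+ 2)); last by ring.
    by apply: ler_piMl => //; rewrite !mulr_ge0.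
  have -> : 4 * K * \sum_(i < n) cc i ^+ 2 = 2 * K * \sum_(i < n) cc i ^+ 2 + 2 * K * \sum_(i < n) cc i ^+ 2 by ring.
  exact: lerD.
have mV sg : sg ^+ 2 = 1 -> \int[P]_w (V sg w ^+ (2 * q)) <= (8 * (4 * K) ^+ 2 * q%:R * (2 * q + n)%:R) ^+ q.
  move=> sg1; apply: (gaussian_sq_norm_moment SE) => //.
  - move=> i; have [_ m0 _ _] := avg_comb_moments j k c e c' e' x (sg * y) ac eb ac' eb' 1 (fun=> i.+1%:Z) (fun=> 1).
    rewrite -[RHS]m0; apply: eq_Rintegral => w _.
    by rewrite big_ord1 mul1r.
  - move=> cc m; have [_ _ _ rec] := avg_comb_moments j k c e c' e' x (sg * y) ac eb ac' eb' n (fun i => i.+1%:Z) cc.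
    exact: rec.
  - by rewrite mulr_ge0.
  - exact: covK.
have VE sg w : V sg w = \sum_(i < n) (z sg i w ^+ 2 - \int[P]_w (z sg i w * z sg i w)).
  by rewrite /V /centered_sq_norm sumrB.
have zzE sg i : \int[P]_w (z sg i w * z sg i w) =
    x ^+ 2 * \int[P]_w (Y i w ^+ 2) + (sg * y) ^+ 2 * \int[P]_w (Z i w ^+ 2) + 2 * x * (sg * y) * \int[P]_w (Y i w * Z i w).
  have SY2 : all_moments P (fun w => Y i w ^+ 2) by exact: (mom_exp _ _ SE).
  have SZ2 : all_moments P (fun w => Z i w ^+ 2) by exact: (mom_exp _ _ SE).
  have SS f cst0 : all_moments P f -> all_moments P (fun w => cst0 * f w) by move=> Sf; apply: SM => //; exact: Sc.
  have S1 := SS _ (x ^+ 2) SY2; have S2 := SS _ ((sg * y) ^+ 2) SZ2; have S3 := SS _ (2 * x * (sg * y)) (SYZ i).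
  transitivity (\int[P]_w (x ^+ 2 * Y i w ^+ 2 + (sg * y) ^+ 2 * Z i w ^+ 2 + 2 * x * (sg * y) * (Y i w * Z i w))).
    apply: eq_Rintegral => w _.
    by rewrite zE; ring.
  by rewrite (expD _ _ SE _ _ (S_add _ _ S1 S2) S3) (expD _ _ SE _ _ S1 S2) !(expZ _ _ SE).
have VV w : V 1 w - V (-1) w = 4 * x * y * \sum_(s < n) (Y s w * Z s w - \int[P]_w (Y s w * Z s w)).
  rewrite !VE -sumrB mulr_sumr; apply: eq_bigr => i _.
  rewrite !zzE !zE.
  move: (\int[P]_w (Y i w ^+ 2)) (\int[P]_w (Z i w ^+ 2)) (\int[P]_w (Y i w * Z i w)) (Y i w) (Z i w) => p1 p2 p3 yy zz.
  by ring.
have nR : (0 : R) < n%:R by rewrite ltr0n.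
have xy0 : 0 < 4 * x * y * n%:R by rewrite !mulr_gt0.
have DE w : n%:R^-1 * \sum_(s < n) (Y s w * Z s w - \int[P]_w (Y s w * Z s w)) = (4 * x * y * n%:R)^-1 * (V 1 w - V (-1) w).
  rewrite VV; set S := \sum_(_ < _) _.
  by field; rewrite (gt_eqF x0) (gt_eqF y0) (gt_eqF nR).
have conv (r s : R) m : (r - s) ^+ (2 * m) <= 4 ^+ m * (r ^+ (2 * m) + s ^+ (2 * m)).
  rewrite !exprM.
  have h : (r - s) ^+ 2 <= 4 * Num.max (r ^+ 2) (s ^+ 2).
    have h1 : r ^+ 2 <= Num.max (r ^+ 2) (s ^+ 2) by rewrite le_max lexx.
    have h2 : s ^+ 2 <= Num.max (r ^+ 2) (s ^+ 2) by rewrite le_max lexx orbT.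
    by have := sqr_ge0 (r + s); nra.
  apply: (@le_trans _ _ ((4 * Num.max (r ^+ 2) (s ^+ 2)) ^+ m)).
    by apply: lerXn2r => //; rewrite nnegrE ?sqr_ge0// mulr_ge0// le_max sqr_ge0.
  rewrite exprMn; apply: ler_wpM2l; first exact: exprn_ge0.
  have r0 : 0 <= (r ^+ 2) ^+ m by apply: exprn_ge0; exact: sqr_ge0.
  have s0 : 0 <= (s ^+ 2) ^+ m by apply: exprn_ge0; exact: sqr_ge0.
  case: (leP (r ^+ 2) (s ^+ 2)) => _.
    by rewrite lerDr.
  by rewrite lerDl.
have SV sg : all_moments P (V sg).
  rewrite [X in all_moments P X](_ : _ = fun w => \sum_(i < n) (z sg i w ^+ 2 + - \int[P]_w (z sg i w * z sg i w))).
    by apply: (mom_sum _ _ SE) => i; apply: S_add; [exact: (mom_exp _ _ SE)|exact: Sc].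
  by apply/funext => w; rewrite VE.
have SVq sg : all_moments P (fun w => V sg w ^+ (2 * q)) by exact: (mom_exp _ _ SE).
pose lam := (4 * x * y * n%:R)^-1.
have lam0 : 0 < lam by rewrite /lam invr_gt0.
apply: (@le_trans _ _ (\int[P]_w (lam ^+ (2 * q) * 4 ^+ q * (V 1 w ^+ (2 * q) + V (-1) w ^+ (2 * q))))).
  apply: (exp_mono _ _ SE).
  - apply: (mom_exp _ _ SE); apply: SM; first exact: Sc.
    by apply: (mom_sum _ _ SE) => i; apply: S_add; [exact: SYZ|exact: Sc].
  - by apply: SM; [exact: Sc|apply: S_add].
  - move=> w; rewrite DE -/lam exprMn -[leRHS]mulrA; apply: ler_wpM2l; first by rewrite exprn_ge0// ltW.
    exact: conv.
rewrite (expZ _ _ SE); last exact: S_add.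
rewrite (expD _ _ SE)//.
have m1 := mV 1 (expr1n _ _); have m2 : \int[P]_w (V (-1) w ^+ (2 * q)) <= (8 * (4 * K) ^+ 2 * q%:R * (2 * q + n)%:R) ^+ q.
  by apply: mV; rewrite sqrrN expr1n.
set BB := 8 * (4 * K) ^+ 2 * q%:R * (2 * q + n)%:R in m1 m2.
have BB0 : 0 <= BB by rewrite !mulr_ge0// sqr_ge0.
apply: (@le_trans _ _ (lam ^+ (2 * q) * 4 ^+ q * (2 ^+ q * BB ^+ q))).
  apply: ler_wpM2l; first by rewrite mulr_ge0// exprn_ge0// ltW.
  have h2 : 2 * BB ^+ q <= 2 ^+ q * BB ^+ q.
    apply: ler_wpM2r; first exact: exprn_ge0.
    by rewrite -[leLHS]expr1; apply: ler_weXn2l; rewrite ?ler1n.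
  apply: le_trans h2; have -> : 2 * BB ^+ q = BB ^+ q + BB ^+ q by ring.
  exact: (lerD m1 m2).
(* The 64 is 4 from the power of a difference, 2 from the two signs and 8 * 16 from the norm bound
   with 4 K, divided by the 16 of polarization. *)
rewrite exprM -!exprMn; set lhs := (X in X ^+ q <= _); set rhs := (X in _ <= X ^+ q).
suff -> : lhs = rhs by [].
rewrite /lhs /rhs /lam /BB; field.
by rewrite (gt_eqF x0) (gt_eqF y0) (gt_eqF nR).
Qed.

Lemma avg_near (f : R -> R) c e s eps : c < e -> leb.-integrable `[c, e] (EFin \o f) ->
  (forall v, c <= v <= e -> `|f v - s| <= eps) ->
  `|(e - c)^-1 * \int[leb]_(v in `[c, e]) f v - s| <= eps.
Proof.
move=> ce If H.
have ec : 0 < e - c by rewrite subr_gt0.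
have lE : fine (leb (`[c, e]%classic : set R)) = e - c.
  by rewrite lebesgue_measure_itv/= lte_fin ce.
have Ik k : leb.-integrable `[c, e] (EFin \o (fun=> k : R)).
  apply: continuous_compact_integrable; first exact: segment_compact.
  by apply: continuous_subspaceT => u; exact: cvg_cst.
have cstE k : \int[leb]_(v in `[c, e]) (k : R) = k * (e - c) by rewrite Rintegral_cst// lE.
have up : \int[leb]_(v in `[c, e]) f v <= (s + eps) * (e - c).
  rewrite -cstE; apply: le_Rintegral => // v; rewrite /= in_itv/= => vI.
  by have := H v vI; rewrite ler_norml => /andP[_]; lra.
have lo : (s - eps) * (e - c) <= \int[leb]_(v in `[c, e]) f v.
  rewrite -cstE; apply: le_Rintegral => // v; rewrite /= in_itv/= => vI.
  by have := H v vI; rewrite ler_norml => /andP[]; lra.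
rewrite ler_norml; apply/andP; split.
  by rewrite -lerBlDr opprK ler_pdivlMl// mulrC addrC.
by rewrite lerBlDr ler_pdivrMl// mulrC addrC.
Qed.

(** Continuity at the diagonal point (u, u) puts all covariances on a small square within eps of the
    variance s at u; the expanded square is then s - 2 s + s up to 3 eps. *)
Lemma path_avg_approx j u eps : {within U `*` U, continuous (fun z : R * R => autocov P X 0 j j z.1 z.2)} ->
  U u -> 0 < eps -> exists c e, [/\ a <= c, e <= b,
    avg_autocov j c e 0 <= autocov P X 0 j j u u + eps &
    forall t, \int[P]_w ((X t j u w - path_avg t j c e w) ^+ 2) <= 3 * eps].
Proof.
move=> /subspace_continuousP/(_ (u, u)) cont Uu eps0.
have /cvgrPdist_le/(_ _ eps0) := cont (conj Uu Uu).
rewrite near_withinE => /nbhs_ballP[r /= r0 Hr].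
move: (Uu); rewrite /= in_itv/= => /andP[au ub].
(* The interval around u is cut at the ends of [a, b]; as a < b, it stays nondegenerate when u is an
   endpoint. *)
pose c := Num.max a (u - r / 2); pose e := Num.min b (u + r / 2).
have ac : a <= c by rewrite /c le_max lexx.
have eb : e <= b by rewrite /e ge_min lexx.
have ce : c < e.
  rewrite /c /e gt_max !lt_min ab/=; apply/andP; split; first by lra.
  by apply/andP; split; lra.
have cI v : c <= v <= e -> U v /\ `|u - v| < r.
  rewrite /c /e ge_max le_min => /andP[/andP[h1 h2] /andP[h3 h4]]; split; first by rewrite /= in_itv/= h1.
  by rewrite ltr_norml; apply/andP; split; lra.
have uI : c <= u <= e.
  by rewrite /c /e ge_max le_min au ub/=; apply/andP; split; lra.
have close v v' : c <= v <= e -> c <= v' <= e ->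
    `|autocov P X 0 j j v v' - autocov P X 0 j j u u| <= eps.
  move=> /cI[Uv dv] /cI[Uv' dv']; rewrite distrC.
  have := Hr (v, v'); apply; last by split.
  by split; rewrite /ball/=.
have Iv v : U v -> leb.-integrable `[c, e] (EFin \o (fun v' => autocov P X 0 j j v v')).
  move=> Uv; have H := fubini_average_integrable (0 + 0) j c e (X 0 j v) ac eb (curve_value_measurable 0 j v Uv)
      (curve_value_sqr_integrable 0 j v Uv).
  apply: eq_integrable H => // v' v'I; rewrite /=.
  under eq_Rintegral do rewrite mulrC.
  rewrite autocovE//.
  move: v'I; rewrite inE /= in_itv/= => /andP[cv ve].
  by rewrite /= in_itv/= (le_trans ac cv) (le_trans ve eb).
have Im : leb.-integrable `[c, e] (EFin \o (fun v => (e - c)^-1 * \int[leb]_(v' in `[c, e]) autocov P X 0 j j v v')).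
  have H := fubini_average_integrable 0 j c e (path_avg (0 + 0) j c e) ac eb (path_avg_measurable j c e ac eb _) (path_avg_sqr_integrable j c e ac eb _).
  apply: eq_integrable H => // v vI.
  rewrite /= path_avg_value_cov//.
  by move: vI; rewrite inE /= in_itv/= => /cI[].
set s := autocov P X 0 j j u u in close *.
have g : `|avg_autocov j c e 0 - s| <= eps.
  apply: avg_near => // v vI; apply: avg_near => //; first exact: Iv (cI v vI).1.
  by move=> v' v'I; exact: close.
have g1 : `|(e - c)^-1 * \int[leb]_(v in `[c, e]) autocov P X 0 j j u v - s| <= eps.
  by apply: avg_near => //; [exact: Iv|move=> v vI; exact: close].
exists c, e; split=> //.
  by move: g; rewrite ler_norml => /andP[_]; lra.
move=> t.
have I1 := curve_value_sqr_integrable t j u Uu.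
have I2 := path_avg_sqr_integrable j c e ac eb t.
have I12 := (fubini_average t j c e (X t j u) ac eb (curve_value_measurable t j u Uu) I1).1.
have I12' : P.-integrable setT (EFin \o (fun w => X t j u w * path_avg t j c e w)).
  have := integrable_scalel P setT (e - c)^-1 _ measurableT I12; apply: eq_integrable => // w _.
  by rewrite /= /path_avg; congr EFin; ring.
have E1 : \int[P]_w (X t j u w ^+ 2) = s.
  rewrite /s -(autocovE t 0 j j u u Uu Uu) addr0; apply: eq_Rintegral => w _.
  by rewrite expr2.
have E2 : \int[P]_w (path_avg t j c e w ^+ 2) = avg_autocov j c e 0.
  rewrite -(path_avg_cov j c e ac eb t 0) addr0; apply: eq_Rintegral => w _.
  by rewrite expr2.
have E12 : \int[P]_w (X t j u w * path_avg t j c e w) = (e - c)^-1 * \int[leb]_(v in `[c, e]) autocov P X 0 j j u v.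
  by rewrite -(path_avg_value_cov j c e ac eb t 0 u Uu) addr0.
have J1 := integrable_scalel P setT (-2) _ measurableT I12'.
have J2 := integrable_addl P setT _ _ measurableT J1 I2.
have -> : \int[P]_w ((X t j u w - path_avg t j c e w) ^+ 2) =
    \int[P]_w (X t j u w ^+ 2 + (-2 * (X t j u w * path_avg t j c e w) + path_avg t j c e w ^+ 2)).
  apply: eq_Rintegral => w _.
  by ring.
rewrite RintegralD// RintegralD// RintegralZl// E1 E2 E12.
move: g g1; rewrite !ler_norml => /andP[g2 g3] /andP[g4 g5].
by lra.
Qed.

(** The bound for averages is used with the weights (variance + del)^(-1/2). The term [del] keeps
    them finite where the variance vanishes, and leaves room for an average whose variance slightly
    exceeds that of the point value. *)
Lemma pointwise_moment j k u v K n q del : 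
  (forall j, {within U `*` U, continuous (fun z : R * R => autocov P X 0 j j z.1 z.2)}) ->
  (forall j c e n (cc : nat -> R), a <= c -> e <= b ->
     \int[P]_w ((\sum_(s < n) cc s * path_avg (s.+1)%:Z j c e w) ^+ 2) <=
     K * avg_autocov j c e 0 * \sum_(s < n) cc s ^+ 2) ->
  0 <= K -> (0 < n)%N -> 0 < del -> U u -> U v ->
  (\int[P]_w ((n%:R^-1 * \sum_(s < n) (X s.+1%:Z j u w * X s.+1%:Z k v w) - autocov P X 0 j k u v) ^+ (2 * q))%:E <=
  ((64 * K ^+ 2 * q%:R * (2 * q + n)%:R / n%:R ^+ 2 *
     ((autocov P X 0 j j u u + del) * (autocov P X 0 k k v v + del))) ^+ q)%:E)%E.
Proof.
move=> cont HK K0 n0 del0 Uu Uv.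
have var_ge0 l x : U x -> 0 <= autocov P X 0 l l x x.
  move=> Ux; rewrite -(autocovE 0 0 l l x x Ux Ux); apply: Rintegral_ge0 => w _.
  by rewrite addr0 -expr2 sqr_ge0.
set sj := autocov P X 0 j j u u; set sk := autocov P X 0 k k v v.
have sj0 : 0 < sj + del by rewrite ltr_wpDl// var_ge0.
have sk0 : 0 < sk + del by rewrite ltr_wpDl// var_ge0.
have nR : (0 : R) < n%:R by rewrite ltr0n.
have mX t l x : U x -> measurable_fun setT (X t l x) by exact: curve_value_measurable.
apply: moment_limit.
  apply: measurable_funB; last exact: measurable_cst.
  apply: measurable_funM; first exact: measurable_cst.
  by apply: measurable_sum => i; apply: measurable_funM; apply: mX.
move=> tau tau0.
have C00 : 0 <= C0 by apply: le_trans (C0P j u u Uu Uu); exact: normr_ge0.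
(* The error budget: the squares of the curve values carry the small factor [kap], while their
   distances to the averages carry [kap^-1 + 1] and are made small afterwards through [eps]. Each
   part takes tau / 4; the other tau / 2 pays for replacing the mean of the product of averages by
   the covariance. *)
pose kap := tau / (8 * (C0 + 1)).
have kap0 : 0 < kap by rewrite /kap divr_gt0// mulr_gt0// ltr_wpDl.
pose eps := Num.min del (tau / (24 * (kap^-1 + 1))).
have ki : 0 < kap^-1 by rewrite invr_gt0.
have eps0 : 0 < eps.
  rewrite /eps lt_min del0/= divr_gt0// mulr_gt0//.
  by lra.
have eps1 : eps <= del by rewrite /eps ge_min lexx.
have eps2 : (kap^-1 + 1) * (6 * eps) <= tau / 4.
  have : eps <= tau / (24 * (kap^-1 + 1)) by rewrite /eps ge_min lexx orbT.
  rewrite ler_pdivlMr; last by rewrite mulr_gt0//; lra.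
  by rewrite (_ : eps * _ = 4 * ((kap^-1 + 1) * (6 * eps))); [lra|ring].
have [c [e [ac eb gj Ej]]] := path_avg_approx j u eps (cont j) Uu eps0.
have [c' [e' [ac' eb' gk Ek]]] := path_avg_approx k v eps (cont k) Uv eps0.
pose Y t := path_avg t j c e; pose Z t := path_avg t k c' e'.
have IY t := path_avg_sqr_integrable j c e ac eb t.
have IZ t := path_avg_sqr_integrable k c' e' ac' eb' t.
have mY t : measurable_fun setT (Y t) := path_avg_measurable j c e ac eb t.
have mZ t : measurable_fun setT (Z t) := path_avg_measurable k c' e' ac' eb' t.
have SYZ t : all_moments P (fun w => Y t w * Z t w) by apply: SM; exact: path_avg_all_moments.
have IYZ t : P.-integrable setT (EFin \o (fun w => Y t w * Z t w)).
  by have [_ /(_ 1%N)] := SYZ t; apply: eq_integrable.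
have IXX t := curve_valueM_integrable t j u t k v Uu Uv.
pose G0 t w := kap * (X t j u w ^+ 2 + X t k v w ^+ 2) + (kap^-1 + 1) * ((X t j u w - Y t w) ^+ 2 + (X t k v w - Z t w) ^+ 2).
have G0le t w : `|X t j u w * X t k v w - Y t w * Z t w| <= G0 t w.
  rewrite /G0; move: (X t j u w) (X t k v w) (Y t w) (Z t w) => f f' g g'.
  have am (r s : R) : `|r * s| <= kap * r ^+ 2 + kap^-1 * s ^+ 2.
    rewrite normrM -[r ^+ 2]real_normK ?num_real// -[s ^+ 2]real_normK ?num_real//.
    rewrite -(@ler_pM2l _ kap)// mulrDr [kap * (kap^-1 * _)]mulrA mulfV ?gt_eqF// mul1r.
    have := normr_ge0 r; have := normr_ge0 s; move: `|r| `|s| => r' s' h1 h2.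
    have h3 := mulr_ge0 h1 h2; have := sqr_ge0 (kap * r' - s'); have := mulr_ge0 (ltW kap0) h3.
    by nra.
  have -> : f * f' - g * g' = f * (f' - g') + f' * (f - g) - (f - g) * (f' - g') by ring.
  have h1 := am f (f' - g'); have h2 := am f' (f - g).
  have h3 : `|(f - g) * (f' - g')| <= (f - g) ^+ 2 + (f' - g') ^+ 2.
    rewrite ler_norml; apply/andP; split.
      by have := sqr_ge0 ((f - g) + (f' - g')); have := sqr_ge0 (f - g); have := sqr_ge0 (f' - g'); nra.
    by have := sqr_ge0 ((f - g) - (f' - g')); have := sqr_ge0 (f - g); have := sqr_ge0 (f' - g'); nra.
  apply: (le_trans (ler_normB _ _)); apply: (le_trans (lerD (ler_normD _ _) (lexx _))).
  apply: (le_trans (lerD (lerD h1 h2) h3)).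
  by rewrite le_eqVlt; apply/orP; left; apply/eqP; ring.
have sqB (f g : T -> R) : measurable_fun setT f -> measurable_fun setT g ->
   P.-integrable setT (EFin \o (fun w => f w ^+ 2)) -> P.-integrable setT (EFin \o (fun w => g w ^+ 2)) ->
   P.-integrable setT (EFin \o (fun w => (f w - g w) ^+ 2)).
  move=> mf mg If Ig.
  have I2 := integrable_scalel P setT 2 _ measurableT (integrable_addl P setT _ _ measurableT If Ig).
  apply: le_integrable I2 => //.
    by apply: measurable_sqrE; exact: measurable_funB.
  move=> w _ /=; rewrite !lee_fin !ger0_norm ?sqr_ge0//; last by rewrite mulr_ge0// addr_ge0// sqr_ge0.
  by have := sqr_ge0 (f w + g w); nra.
have Ijh t : P.-integrable setT (EFin \o (fun w => (X t j u w - Y t w) ^+ 2)).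
  by apply: sqB => //; [exact: mX|exact: curve_value_sqr_integrable|exact: IY].
have Ikh t : P.-integrable setT (EFin \o (fun w => (X t k v w - Z t w) ^+ 2)).
  by apply: sqB => //; [exact: mX|exact: curve_value_sqr_integrable|exact: IZ].
have IX2 t := integrable_addl P setT _ _ measurableT (curve_value_sqr_integrable t j u Uu) (curve_value_sqr_integrable t k v Uv).
have Ih t := integrable_addl P setT _ _ measurableT (Ijh t) (Ikh t).
have IG1 t := integrable_scalel P setT kap _ measurableT (IX2 t).
have IG2 t := integrable_scalel P setT (kap^-1 + 1) _ measurableT (Ih t).
have IG0 t : P.-integrable setT (EFin \o G0 t) := integrable_addl P setT _ _ measurableT (IG1 t) (IG2 t).
have EG0 t : \int[P]_w G0 t w <= tau / 2.
  rewrite /G0 (RintegralD measurableT (IG1 t) (IG2 t)) (RintegralZl _ measurableT (IX2 t)) (RintegralZl _ measurableT (Ih t)).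
  rewrite (RintegralD measurableT (curve_value_sqr_integrable t j u Uu) (curve_value_sqr_integrable t k v Uv)).
  rewrite (RintegralD measurableT (Ijh t) (Ikh t)).
  have h1 := curve_value_var_le t j u Uu; have h2 := curve_value_var_le t k v Uv.
  have h3 := Ej t; have h4 := Ek t.
  have l1 : kap * (\int[P]_w (X t j u w ^+ 2) + \int[P]_w (X t k v w ^+ 2)) <= tau / 4.
    apply: (@le_trans _ _ (kap * (2 * (C0 + 1)))).
      by apply: ler_wpM2l; [exact: ltW|lra].
    have -> : kap * (2 * (C0 + 1)) = tau / 4 by rewrite /kap; field; rewrite gt_eqF// ltr_wpDl.
    exact: lexx.
  have l2 : (kap^-1 + 1) * (\int[P]_w ((X t j u w - Y t w) ^+ 2) + \int[P]_w ((X t k v w - Z t w) ^+ 2)) <= tau / 4.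
    apply: le_trans eps2; apply: ler_wpM2l; first by lra.
    apply: (le_trans (lerD h3 h4)).
    by have -> : 3 * eps + 3 * eps = 6 * eps by ring.
  by apply: (le_trans (lerD l1 l2)); lra.
have EXX t : \int[P]_w (X t j u w * X t k v w) = autocov P X 0 j k u v.
  by rewrite -(autocovE t 0 j k u v Uu Uv) addr0.
have dE t : `|autocov P X 0 j k u v - \int[P]_w (Y t w * Z t w)| <= tau / 2.
  apply: le_trans (EG0 t); rewrite -(EXX t) -(RintegralB measurableT (IXX t) (IYZ t)).
  have IB : P.-integrable setT (EFin \o (fun w => X t j u w * X t k v w - Y t w * Z t w)).
    have := integrable_addl P setT _ _ measurableT (IXX t) (integrable_scalel P setT (-1) _ measurableT (IYZ t)).
    by apply: eq_integrable => // w _ /=; rewrite mulN1r.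
  apply: (le_trans (le_normr_Rintegral measurableT IB)).
  apply: le_Rintegral => //.
  by have := integrable_norm IB; apply: eq_integrable.
pose De w := n%:R^-1 * \sum_(s < n) (Y s.+1%:Z w * Z s.+1%:Z w - \int[P]_w (Y s.+1%:Z w * Z s.+1%:Z w)).
pose G w := n%:R^-1 * \sum_(s < n) (G0 s.+1%:Z w + tau / 2).
have IGs (r : seq 'I_n) : P.-integrable setT (EFin \o (fun w => \sum_(s <- r) (G0 s.+1%:Z w + tau / 2))) /\
    \int[P]_w (\sum_(s <- r) (G0 s.+1%:Z w + tau / 2)) <= (size r)%:R * tau.
  elim: r => [|s r [IH1 IH2]].
    split.
      apply: (@eq_integrable _ _ _ P setT _ (cst 0%E)) => //; last exact: integrable0.
      by move=> w _; rewrite /= big_nil.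
    under eq_Rintegral do rewrite big_nil.
    by rewrite Rintegral_cst// !mul0r.
  have Ic : P.-integrable setT (EFin \o (fun=> tau / 2)) by exact: finite_measure_integrable_cst.
  have I1 := integrable_addl P setT _ _ measurableT (IG0 s.+1%:Z) Ic.
  split.
    have := integrable_addl P setT _ _ measurableT I1 IH1; apply: eq_integrable => // w _.
    by rewrite /= big_cons.
  under eq_Rintegral do rewrite big_cons.
  rewrite (RintegralD measurableT I1 IH1) (RintegralD measurableT (IG0 s.+1%:Z) Ic).
  rewrite Rintegral_cst// (_ : fine (P setT) = 1); last by rewrite probability_setT.
  rewrite mulr1 /=; have -> : (size r).+1%:R * tau = tau + (size r)%:R * tau by rewrite -natr1; ring.
  apply: lerD => //.
  by have := EG0 s.+1%:Z; lra.
have SDe : all_moments P De.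
  apply: SM; first exact: Sc.
  apply: (mom_sum _ _ SE) => i; apply: (mom_add _ _ SE); first exact: SYZ.
  exact: Sc.
have [IG EG] := IGs (index_enum 'I_n).
have IG' : P.-integrable setT (EFin \o G) := integrable_scalel P setT (n%:R^-1) _ measurableT IG.
exists De, G; split.
- exact: SDe.
- exact: IG'.
- move=> w; rewrite /De /G.
  have -> : autocov P X 0 j k u v = n%:R^-1 * \sum_(s < n) autocov P X 0 j k u v.
    by rewrite sumr_const card_ord -[X in _ * X]mulr_natl mulrA mulVf ?mul1r// gt_eqF.
  have ni : 0 <= n%:R^-1 :> R by rewrite invr_ge0 ler0n.
  rewrite -!mulrBr normrM (ger0_norm ni); apply: ler_wpM2l => //.
  rewrite -!sumrB; apply: (le_trans (ler_norm_sum _ _ _)); apply: ler_sum => s _.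
  set XX := X _ _ _ _ * X _ _ _ _; set YZ := Y _ _ * Z _ _; set EYZ := \int[P]_w _.
  have -> : XX - autocov P X 0 j k u v - (YZ - EYZ) = (XX - YZ) - (autocov P X 0 j k u v - EYZ) by ring.
  by apply: (le_trans (ler_normB _ _)); apply: lerD; [exact: G0le|exact: dE].
- rewrite /G (RintegralZl _ measurableT IG) ler_pdivrMl//; apply: (le_trans EG).
  by rewrite -[X in size X]enumT size_enum_ord.
- have aj : 0 < (Num.sqrt (sj + del))^-1 by rewrite invr_gt0 sqrtr_gt0.
  have ak : 0 < (Num.sqrt (sk + del))^-1 by rewrite invr_gt0 sqrtr_gt0.
  have H := @avg_cov_error_moment j k c e c' e' (Num.sqrt (sj + del))^-1 (Num.sqrt (sk + del))^-1 K n q HK K0 ac eb ac' eb' aj ak n0.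
  have qj : ((Num.sqrt (sj + del))^-1) ^+ 2 = (sj + del)^-1 by rewrite exprVn sqr_sqrtr// ltW.
  have qk : ((Num.sqrt (sk + del))^-1) ^+ 2 = (sk + del)^-1 by rewrite exprVn sqr_sqrtr// ltW.
  have hj : avg_autocov j c e 0 <= sj + del by apply: (le_trans gj); rewrite lerD2l.
  have hk : avg_autocov k c' e' 0 <= sk + del by apply: (le_trans gk); rewrite lerD2l.
  have hj' : ((Num.sqrt (sj + del))^-1) ^+ 2 * avg_autocov j c e 0 <= 1 by rewrite qj ler_pdivrMl// mulr1.
  have hk' : ((Num.sqrt (sk + del))^-1) ^+ 2 * avg_autocov k c' e' 0 <= 1 by rewrite qk ler_pdivrMl// mulr1.
  have := H hj' hk'; rewrite qj qk !invrK [in X in _ -> X]mulrA.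
  exact.
Qed.

(** The value at u is a mean-square limit of averages, which all have variance 0 here. *)
Lemma curve_var_eq0 j u : {within U `*` U, continuous (fun z : R * R => autocov P X 0 j j z.1 z.2)} ->
  (forall c e, a <= c -> e <= b -> avg_autocov j c e 0 <= 0) -> U u -> autocov P X 0 j j u u = 0.
Proof.
move=> cont H Uu.
have s0 : 0 <= autocov P X 0 j j u u.
  rewrite -(autocovE 0 0 j j u u Uu Uu); apply: Rintegral_ge0 => w _.
  by rewrite addr0 -expr2 sqr_ge0.
apply/eqP; rewrite eq_le s0 andbT; apply/ler_addgt0Pr => eps eps0; rewrite add0r.
have e6 : 0 < eps / 6 by rewrite divr_gt0.
have [c [e [ac eb _ E]]] := path_avg_approx j u (eps / 6) cont Uu e6.
have I1 := curve_value_sqr_integrable 0 j u Uu.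
have I2 := path_avg_sqr_integrable j c e ac eb 0.
have g0 : \int[P]_w (path_avg 0 j c e w ^+ 2) <= 0.
  apply: le_trans (H c e ac eb); rewrite -(path_avg_cov j c e ac eb 0 0) addr0 le_eqVlt; apply/orP; left; apply/eqP.
  by apply: eq_Rintegral => w _; rewrite expr2.
have E1 : \int[P]_w (X 0 j u w ^+ 2) = autocov P X 0 j j u u.
  rewrite -(autocovE 0 0 j j u u Uu Uu) addr0; apply: eq_Rintegral => w _.
  by rewrite expr2.
have I12 := (fubini_average 0 j c e (X 0 j u) ac eb (curve_value_measurable 0 j u Uu) I1).1.
have I12' : P.-integrable setT (EFin \o (fun w => X 0 j u w * path_avg 0 j c e w)).
  have := integrable_scalel P setT (e - c)^-1 _ measurableT I12; apply: eq_integrable => // w _.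
  by rewrite /= /path_avg; congr EFin; ring.
have J1 := integrable_scalel P setT (-2) _ measurableT I12'.
have J2 := integrable_addl P setT _ _ measurableT J1 I2.
have J3 := integrable_addl P setT _ _ measurableT I1 J2.
have J4 : P.-integrable setT (EFin \o (fun w => (X 0 j u w - path_avg 0 j c e w) ^+ 2)).
  apply: eq_integrable J3 => // w _ /=; congr EFin.
  by ring.
have K1 := integrable_scalel P setT 2 _ measurableT J4.
have K2 := integrable_scalel P setT 2 _ measurableT I2.
rewrite -E1; apply: (@le_trans _ _ (\int[P]_w (2 * (X 0 j u w - path_avg 0 j c e w) ^+ 2 + 2 * path_avg 0 j c e w ^+ 2))).
  apply: le_Rintegral => //; first exact: integrable_addl.
  move=> w _; move: (X 0 j u w) (path_avg 0 j c e w) => x y.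
  by have := sqr_ge0 (x - 2 * y); nra.
rewrite (RintegralD measurableT K1 K2) (RintegralZl _ measurableT J4) (RintegralZl _ measurableT I2).
by have := E 0; lra.
Qed.

Lemma curve_moment_bound :
  (forall j, {within U `*` U, continuous (fun z : R * R => autocov P X 0 j j z.1 z.2)}) ->
  exists K, [/\ 0 <= K,
    (forall j k u v n q del, (0 < n)%N -> 0 < del -> U u -> U v ->
      (\int[P]_w ((n%:R^-1 * \sum_(s < n) (X s.+1%:Z j u w * X s.+1%:Z k v w) - autocov P X 0 j k u v) ^+ (2 * q))%:E <=
      ((64 * K ^+ 2 * q%:R * (2 * q + n)%:R / n%:R ^+ 2 *
         ((autocov P X 0 j j u u + del) * (autocov P X 0 k k v v + del))) ^+ q)%:E)%E) &
    ((forall j u, U u -> autocov P X 0 j j u u = 0) \/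
      (0 < K /\ stability1 P U X F = (K / (16 * pi))%:E))].
Proof.
move=> cont; have [K [K0 HK Kcase]] := stability_variance_bound.
exists K; split=> //.
  by move=> j k u v n q del n0 del0 Uu Uv; exact: pointwise_moment.
case: Kcase => [Kz|]; [left|by right].
move=> j u Uu; apply: curve_var_eq0 => // c e ac eb.
have := HK j c e 1%N (fun=> 1) ac eb; rewrite Kz !mul0r => H.
rewrite (path_avg_gram j c e 1%N (fun=> 1) ac eb) in H.
move: H; rewrite !big_ord1 !mul1r.
by have -> : natdist (@ord0 0) ord0 = 0%N by [].
Qed.

End RandomCurveMoments.

(** * From pointwise moments to the tail of an integrated square *)

Lemma power_tangent {R : realFieldType} m (c y : R) : 0 <= c -> 0 <= y ->
  m.+1%:R * c ^+ m * y <= y ^+ m.+1 + m%:R * c ^+ m.+1.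
Proof.
move=> c0 y0; elim: m => [|m IH].
  by rewrite expr0 expr1 mul0r addr0 !mul1r.
have h1 := ler_wpM2l y0 IH.
have h2 : 0 <= m.+1%:R * c ^+ m * (y - c) ^+ 2 by apply: mulr_ge0; [rewrite mulr_ge0// exprn_ge0|exact: sqr_ge0].
rewrite -subr_ge0.
have -> : y ^+ m.+2 + m.+1%:R * c ^+ m.+2 - m.+2%:R * c ^+ m.+1 * y =
  (y * (y ^+ m.+1 + m%:R * c ^+ m.+1) - y * (m.+1%:R * c ^+ m * y)) + m.+1%:R * c ^+ m * (y - c) ^+ 2.
  by rewrite -!natr1 !exprS; ring.
by apply: addr_ge0 => //; rewrite subr_ge0.
Qed.

Lemma product_sigma_finite {R : realType} {d1 d2 : measure_display} {T1 : measurableType d1} {T2 : measurableType d2}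
    (m1 : {sigma_finite_measure set T1 -> \bar R}) (m2 : {sigma_finite_measure set T2 -> \bar R}) :
  sigma_finite setT (m1 \x m2)%E.
Proof.
have /sigma_finiteP[A [AT And Afin]] := sigma_finiteT m1.
have /sigma_finiteP[B [BT Bnd Bfin]] := sigma_finiteT m2.
exists (fun k => A k `*` B k).
  apply/seteqP; split => [[x y] _|//].
  have [i _ Ax] : (\bigcup_i A i) x by rewrite -AT.
  have [k _ By] : (\bigcup_i B i) y by rewrite -BT.
  exists (maxn i k) => //; split => /=.
    by apply: (subsetPset _ _ (And _ _ (leq_maxl i k))).
  by apply: (subsetPset _ _ (Bnd _ _ (leq_maxr i k))).
move=> k; have [mA fA] := Afin k; have [mB fB] := Bfin k.
split; first exact: measurableX.
by rewrite product_measure1E// lte_mul_pinfty// ge0_fin_numE.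
Qed.

(* The product measure of two sigma-finite measures is not inferred to be
   sigma-finite, because a canonical instance for probabilities shadows it. *)
Lemma iterated_integral_measure {R : realType} {d1 d2 : measure_display} {T1 : measurableType d1} {T2 : measurableType d2}
    (m1 : {sigma_finite_measure set T1 -> \bar R}) (m2 : {sigma_finite_measure set T2 -> \bar R}) :
  exists mu : {sigma_finite_measure set (T1 * T2)%type -> \bar R},
    forall f : (T1 * T2)%type -> \bar R, measurable_fun setT f -> (forall z, 0 <= f z)%E ->
    (\int[mu]_z f z = \int[m1]_x \int[m2]_y f (x, y))%E.
Proof.
pose mu : {sigma_finite_measure set (T1 * T2)%type -> \bar R} := HB.pack (product_measure1 m1 m2)
  (Measure_isSigmaFinite.Build _ _ _ (product_measure1 m1 m2) (product_sigma_finite m1 m2)).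
exists mu => f mf f0; rewrite -[RHS](fubini_tonelli1 f mf f0).
by [].
Qed.

Lemma section_integral_measurable {R : realType} {d d2 : measure_display} {T : measurableType d} {T2 : measurableType d2}
    (mu : {sigma_finite_measure set T2 -> \bar R}) (f : T * T2 -> \bar R) :
  measurable_fun setT f -> (forall y, 0 <= f y)%E -> measurable_fun setT (fun w => \int[mu]_z f (w, z))%E.
Proof.
by move=> mf f0; exact: (measurable_fun_fubini_tonelli_F _ mf f0).
Qed.

(** In substance, Jensen's inequality for D^2 / W under the measure W dmu, then Markov's inequality
    for G, the integral of D^(2m+2) W^(-m), whose mean is at most B^(m+1) L. The tangent inequality
    at c takes the place of Jensen's, since only an upper bound L on the mass of W dmu is given. *)
Lemma weighted_moment_tail {R : realType} {d d2 : measure_display} {T : measurableType d} {T2 : measurableType d2}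
    (P : probability T R) (mu : {sigma_finite_measure set T2 -> \bar R}) (D : T * T2 -> R) (W : T2 -> R) m (B L c : R) :
  measurable_fun setT D -> measurable_fun setT W -> (forall z, 0 <= W z) ->
  (forall w z, W z = 0 -> D (w, z) = 0) -> 0 <= B -> 0 < c -> 0 < L ->
  (forall z, (\int[P]_w (D (w, z) ^+ (2 * m.+1))%:E <= ((B * W z) ^+ m.+1)%:E)%E) ->
  (\int[mu]_z (W z)%:E <= L%:E)%E ->
  (P [set w | ((c * L)%:E < \int[mu]_z (D (w, z) ^+ 2)%:E)%E] <= ((B / c) ^+ m.+1)%:E)%E.
Proof.
move=> mD mW W0 WD B0 c0 L0 HB HL.
(* Where W vanishes so does D, so the value of the inverse at 0 does not matter. *)
pose g (wz : T * T2) : \bar R := (D wz ^+ (2 * m.+1) * (W wz.2 `^ (-1)) ^+ m)%:E.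
have mWi : measurable_fun [set: T2] (fun z => W z `^ (-1)).
  by apply: (measurableT_comp (measurable_powR _)).
have mg : measurable_fun setT g.
  apply/measurable_EFinP; apply: measurable_funM; first exact: measurable_funX.
  apply: measurable_funX.
  exact: (measurableT_comp mWi measurable_snd).
have Dq_ge0 wz : 0 <= D wz ^+ (2 * m.+1) by rewrite exprM exprn_ge0// sqr_ge0.
have g0 wz : (0 <= g wz)%E.
  by rewrite lee_fin mulr_ge0// exprn_ge0// powR_ge0.
pose G w := (\int[mu]_z g (w, z))%E.
have mG : measurable_fun setT G by exact: (measurable_fun_fubini_tonelli_F _ mg g0).
have G0 w : (0 <= G w)%E by apply: integral_ge0 => z _; exact: g0.
have sec w (f : T * T2 -> R) : measurable_fun setT f -> measurable_fun setT (fun z => f (w, z)).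
  by move=> mf; apply: (measurableT_comp mf); exact: measurable_pair1.
have sec2 z (f : T * T2 -> R) : measurable_fun setT f -> measurable_fun setT (fun w => f (w, z)).
  by move=> mf; apply: (measurableT_comp mf); exact: measurable_pair2.
have cm0 : 0 < m.+1%:R * c ^+ m by rewrite mulr_gt0// exprn_gt0.
have pw w z : m.+1%:R * c ^+ m * D (w, z) ^+ 2 <=
   D (w, z) ^+ (2 * m.+1) * (W z `^ (-1)) ^+ m + m%:R * c ^+ m.+1 * W z.
  have [Wz|Wz] := eqVneq (W z) 0.
    by rewrite (WD w z Wz) Wz mulr0 expr0n/= mulr0 addr_ge0// mulr_ge0// mulr_ge0// ?exprn_ge0 ?powR_ge0.
  have Wp : 0 < W z by rewrite lt_neqAle eq_sym Wz W0.
  rewrite powR_inv1//.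
  have y0 : 0 <= D (w, z) ^+ 2 / W z by rewrite divr_ge0// sqr_ge0.
  have := ler_wpM2l (W0 z) (power_tangent m c _ (ltW c0) y0).
  have -> : W z * (m.+1%:R * c ^+ m * (D (w, z) ^+ 2 / W z)) = m.+1%:R * c ^+ m * D (w, z) ^+ 2 by field.
  have -> : W z * ((D (w, z) ^+ 2 / W z) ^+ m.+1 + m%:R * c ^+ m.+1) =
     D (w, z) ^+ (2 * m.+1) * (W z)^-1 ^+ m + m%:R * c ^+ m.+1 * W z.
    rewrite mulrDr exprM expr_div_n exprVn; congr (_ + _); last by rewrite mulrC.
    by rewrite [W z ^+ m.+1]exprS; field; rewrite expf_neq0.
  by [].
(* If G were below c^(m+1) L, integrating the tangent inequality would bound (m + 1) c^m times the
   integral of D^2 by (m + 1) c^(m+1) L. *)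
have key w : ((c * L)%:E < \int[mu]_z (D (w, z) ^+ 2)%:E)%E -> ((c ^+ m.+1 * L)%:E <= G w)%E.
  move=> Hw; rewrite leNgt; apply/negP => Gl.
  have I1 : ((m.+1%:R * c ^+ m)%:E * \int[mu]_z (D (w, z) ^+ 2)%:E <= G w + (m%:R * c ^+ m.+1)%:E * \int[mu]_z (W z)%:E)%E.
    rewrite -ge0_integralZl//; first last.
    - by rewrite lee_fin ltW.
    - by move=> z _; rewrite lee_fin sqr_ge0.
    - by apply/measurable_EFinP; apply: measurable_funX; exact: sec.
    have mc0 : 0 <= m%:R * c ^+ m.+1 by rewrite mulr_ge0// exprn_ge0// ltW.
    rewrite -ge0_integralZl//; first last.
    - by move=> z _; rewrite lee_fin.
    - by apply/measurable_EFinP.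
    have mgw : measurable_fun setT (fun z => g (w, z)).
      by apply: (measurableT_comp mg); exact: measurable_pair1.
    have mcw : measurable_fun setT (fun z => ((m%:R * c ^+ m.+1)%:E * (W z)%:E)%E).
      under eq_fun do rewrite -EFinM.
      by apply/measurable_EFinP; apply: measurable_funM => //; exact: measurable_cst.
    rewrite /G -ge0_integralD//; last by move=> z _; rewrite -EFinM lee_fin mulr_ge0.
    apply: ge0_le_integral => //.
    - by move=> z _; rewrite -EFinM lee_fin mulr_ge0 ?sqr_ge0// ltW.
    - under eq_fun do rewrite -EFinM.
      by apply/measurable_EFinP; apply: measurable_funM; [exact: measurable_cst|apply: measurable_funX; exact: sec].
    - exact: emeasurable_funD.
    - move=> z _; rewrite -!EFinM -EFinD lee_fin.
      exact: pw.
  have I2 : (\int[mu]_z (D (w, z) ^+ 2)%:E <= (c * L)%:E)%E; last by move: Hw; rewrite ltNge I2.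
  rewrite -(@lee_pmul2l _ (m.+1%:R * c ^+ m)%:E)//.
  apply: (le_trans I1).
  apply: (@le_trans _ _ ((c ^+ m.+1 * L)%:E + (m%:R * c ^+ m.+1)%:E * L%:E)%E).
    apply: leeD; first exact: ltW.
    apply: lee_wpmul2l => //.
    by rewrite lee_fin mulr_ge0// exprn_ge0// ltW.
  rewrite -!EFinM -EFinD lee_fin -natr1 !exprS.
  by rewrite le_eqVlt; apply/orP; left; apply/eqP; ring.
have EG : (\int[P]_w G w <= (B ^+ m.+1 * L)%:E)%E.
  rewrite /G (fubini_tonelli _ mg g0).
  apply: (@le_trans _ _ (\int[mu]_z ((B ^+ m.+1)%:E * (W z)%:E))%E); last first.
    rewrite ge0_integralZl//; first by rewrite EFinM lee_wpmul2l// lee_fin exprn_ge0.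
    - by apply/measurable_EFinP.
    - by move=> z _; rewrite lee_fin.
    - by rewrite lee_fin exprn_ge0.
  apply: ge0_le_integral => //.
  - by move=> z _; apply: integral_ge0 => w _; exact: g0.
  - exact: (measurable_fun_fubini_tonelli_G _ mg g0).
  - under eq_fun do rewrite -EFinM.
    by apply/measurable_EFinP; apply: measurable_funM => //; exact: measurable_cst.
  - move=> z _; rewrite /g /=.
    under eq_integral do rewrite mulrC EFinM.
    rewrite ge0_integralZl//; first last.
    - by rewrite lee_fin exprn_ge0// powR_ge0.
    - by move=> w _; rewrite lee_fin.
    - by apply/measurable_EFinP; apply: measurable_funX; exact: sec2.
    have wz0 : 0 <= (W z `^ (-1)) ^+ m by rewrite exprn_ge0// powR_ge0.
    apply: (@le_trans _ _ (((W z `^ (-1)) ^+ m)%:E * ((B * W z) ^+ m.+1)%:E)%E).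
      by apply: lee_wpmul2l => //.
    rewrite -!EFinM lee_fin powR_inv1//.
    have [->|Wz] := eqVneq (W z) 0; first by rewrite !mulr0 expr0n/= mulr0.
    rewrite le_eqVlt; apply/orP; left; apply/eqP.
    rewrite exprMn exprVn [W z ^+ m.+1]exprS; field.
    by rewrite expf_neq0.
have cL0 : 0 < c ^+ m.+1 * L by rewrite mulr_gt0// exprn_gt0.
have mS : measurable [set w | ((c ^+ m.+1 * L)%:E <= G w)%E].
  by rewrite -[X in measurable X]setTI; exact: emeasurable_fun_c_infty.
have mS0 : measurable [set w | ((c * L)%:E < \int[mu]_z (D (w, z) ^+ 2)%:E)%E].
  rewrite -[X in measurable X]setTI; apply: emeasurable_fun_o_infty => //.
  apply: (@measurable_fun_fubini_tonelli_F _ _ _ _ _ mu (fun wz => (D wz ^+ 2)%:E)).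
    by apply/measurable_EFinP; exact: measurable_funX.
  by move=> wz; rewrite lee_fin sqr_ge0.
apply: (@le_trans _ _ (P [set w | ((c ^+ m.+1 * L)%:E <= G w)%E])).
  apply: le_measure; rewrite ?inE//.
rewrite -(@lee_pmul2l _ (c ^+ m.+1 * L)%:E)//.
have mk : ((c ^+ m.+1 * L)%:E * P (setT `&` [set x | ((c ^+ m.+1 * L)%:E <= `|G x|)%E]) <= \int[P]_x `|G x|)%E.
  by apply: (@le_integral_comp_abse _ _ _ P setT measurableT G _ id).
apply: (@le_trans _ _ (B ^+ m.+1 * L)%:E).
  apply: le_trans EG; move: mk; rewrite setTI /=.
  rewrite (_ : [set x | _ <= `|G x|]%E = [set w | ((c ^+ m.+1 * L)%:E <= G w)%E]); last first.
    by apply/seteqP; split => w /=; rewrite gee0_abs.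
  by under eq_integral do rewrite gee0_abs//.
rewrite -EFinM lee_fin expr_div_n le_eqVlt; apply/orP; left; apply/eqP.
have : c ^+ m.+1 != 0 by rewrite expf_neq0// gt_eqF.
move: (c ^+ m.+1) => ck ck0.
by field.
Qed.

(** * The Hilbert-Schmidt error as an integral over the plane *)

Section CovarianceError.
Context {R : realType} {d : measure_display} {T : measurableType d}.
Variables (P : probability T R) (a b : R) (p : nat) (X : int -> 'I_p -> R -> T -> R).
Local Notation leb := (@lebesgue_measure R).
Local Notation U := (`[a, b]%classic : set R).
Local Notation RM := (measurableTypeR R).
Hypothesis rc : random_curves U X.
Hypothesis mz : mean_zero P U X.
Hypothesis cs : cov_stationary P U X.

Let mU : measurable (U : set RM).
Proof.
exact: measurable_itv.
Qed.

(* The curves are extended by zero outside [U] to integrate over the plane. *)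
Let g t j : T * RM -> R := (fun z : T * RM => X t j z.2 z.1) \_ ([set: T] `*` (U : set RM)).

Let gE t j w u : g t j (w, u) = \1_U u * X t j u w.
Proof.
rewrite /g patchE indicE.
have -> : ((w, u) \in [set: T] `*` (U : set RM)) = (u \in (U : set R)).
  by rewrite in_setX in_setT.
case: (u \in _) => /=.
  by rewrite mul1r.
by rewrite !mul0r.
Qed.

Let mg t j : measurable_fun setT (g t j).
Proof.
apply/(measurable_restrictT _ _).1; first by apply: measurableX.
exact: (rc.1 t j).
Qed.

Let h t j k (y : T * (RM * RM)) : R := g t j (y.1, y.2.1) * g t k (y.1, y.2.2).

Let mh t j k : measurable_fun setT (h t j k).
Proof.
apply: measurable_funM.
  apply: (measurableT_comp (mg t j)); apply: measurable_fun_pair; first exact: measurable_fst.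
  exact: (measurableT_comp measurable_fst measurable_snd).
apply: (measurableT_comp (mg t k)); apply: measurable_fun_pair; first exact: measurable_fst.
exact: (measurableT_comp measurable_snd measurable_snd).
Qed.

(** The covariance of the extended curves, in a form whose measurability in (u, v) follows from
    Tonelli's theorem, also for distinct j and k, where no continuity is assumed. *)
Let sig j k (z : RM * RM) : R := fine (\int[P]_w (h 0 j k (w, z))%:E).

Let msig j k : measurable_fun setT (sig j k).
Proof.
rewrite (_ : sig j k = fine \o (fun z => \int[P]_w (h 0 j k (w, z))%:E)%E) //.
apply: measurableT_comp => //.
have mE : measurable_fun setT (EFin \o h 0 j k) by apply/measurable_EFinP; exact: mh.
have -> : (fun z => \int[P]_w (h 0 j k (w, z))%:E)%E =
   (fun z => (\int[P]_w ((EFin \o h 0 j k)^\+ (w, z))) - (\int[P]_w ((EFin \o h 0 j k)^\- (w, z))))%E.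
  apply/funext => z; rewrite [LHS]integralE; congr (_ - _)%E; apply: eq_integral => w _.
    by rewrite !funeposE.
  by rewrite !funenegE.
apply: emeasurable_funB.
  apply: (measurable_fun_fubini_tonelli_G _ _ _) => //.
  exact: measurable_funepos.
apply: (measurable_fun_fubini_tonelli_G _ _ _) => //.
exact: measurable_funeneg.
Qed.

Let sigE j k u v : sig j k (u, v) = \1_U u * \1_U v * autocov P X 0 j k u v.
Proof.
have [uU|uU] := boolP (u \in (U : set R)); last first.
  rewrite indicE (negPf uU) !mul0r /sig /h.
  under eq_integral do rewrite gE indicE (negPf uU) !mul0r.
  by rewrite integral0.
have [vU|vU] := boolP (v \in (U : set R)); last first.
  rewrite !indicE (negPf vU) mulr0 mul0r /sig /h.
  under eq_integral do rewrite !gE !indicE (negPf vU) mul0r mulr0.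
  by rewrite integral0.
rewrite !indicE uU vU !mul1r -(autocovE P a b p X mz cs 0 0 j k u v (set_mem uU) (set_mem vU)).
rewrite /sig /Rintegral; congr fine; apply: eq_integral => w _.
by rewrite /h !gE !indicE uU vU !mul1r addr0.
Qed.

Variables (n : nat) (j k : 'I_p).

Let D (y : T * (RM * RM)) : R := n%:R^-1 * \sum_(s < n) h s.+1%:Z j k y - sig j k y.2.

Let mD : measurable_fun setT D.
Proof.
apply: measurable_funB; last exact: (measurableT_comp (msig j k) measurable_snd).
apply: measurable_funM; first exact: measurable_cst.
by apply: measurable_sum => s; exact: mh.
Qed.

Let sampleE u v w : n%:R^-1 * \sum_(s < n) (X s.+1%:Z j u w * X s.+1%:Z k v w) - autocov P X 0 j k u v =
  cov_error P X n w j k u v.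
Proof.
by rewrite /cov_error /sample_cov0 big_add1 /= big_mkord.
Qed.

Let DE w u v : D (w, (u, v)) = \1_U u * \1_U v * cov_error P X n w j k u v.
Proof.
rewrite -sampleE /D sigE mulrBr; congr (_ - _).
rewrite mulrCA; congr (_ * _); rewrite mulr_sumr; apply: eq_bigr => s _.
by rewrite /h !gE; ring.
Qed.

Let mD2 : measurable_fun setT (fun y => (D y ^+ 2)%:E).
Proof.
by apply/measurable_EFinP; exact: measurable_funX.
Qed.

Let plane_measure := {sigma_finite_measure set (RM * RM)%type -> \bar R}.
Let iterated (mu : plane_measure) := forall f : RM * RM -> \bar R, measurable_fun setT f -> (forall z, 0 <= f z)%E ->
    (\int[mu]_z f z = \int[leb]_x \int[leb]_y f (x, y))%E.

Let hs2E (mu : plane_measure) (muE : iterated mu) w : (\int[leb]_(u in U) \int[leb]_(v in U) (cov_error P X n w j k u v ^+ 2)%:E =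
  \int[mu]_z (D (w, z) ^+ 2)%:E)%E.
Proof.
rewrite muE; [|exact: (measurableT_comp mD2 (measurable_pair1 w))|by move=> z; rewrite lee_fin sqr_ge0].
rewrite integral_mkcond; apply: eq_integral => u _; rewrite patchE.
case: ifPn => uU.
  rewrite [LHS]integral_mkcond; congr (integral _ _ _); apply/funext => v; rewrite patchE.
  case: ifPn => vU.
    by rewrite DE !indicE uU vU !mul1r.
  by rewrite DE !indicE (negPf vU) mulr0 mul0r expr0n.
rewrite -[LHS](integral0 leb [set: R]); congr (integral _ _ _); apply/funext => v.
by rewrite DE indicE (negPf uU) !mul0r expr0n.
Qed.

Lemma hs_norm_cov_error_measurable : measurable_fun setT
  (fun w => \int[leb]_(u in U) \int[leb]_(v in U) (cov_error P X n w j k u v ^+ 2)%:E)%E.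
Proof.
have [mu muE] := iterated_integral_measure leb leb.
have Hm := section_integral_measurable mu (fun y => (D y ^+ 2)%:E) mD2 (fun y => sqr_ge0 (D y)).
apply: eq_measurable_fun Hm => w _.
by rewrite (hs2E mu muE).
Qed.

Lemma curve_var_ge0 l u : U u -> 0 <= autocov P X 0 l l u u.
Proof.
move=> Uu; rewrite -(autocovE P a b p X mz cs 0 0 l l u u Uu Uu); apply: Rintegral_ge0 => w _.
by rewrite addr0 -expr2 sqr_ge0.
Qed.

Variables (K lam del : R).
Hypothesis HM : forall u v q, U u -> U v ->
  (\int[P]_w ((n%:R^-1 * \sum_(s < n) (X s.+1%:Z j u w * X s.+1%:Z k v w) - autocov P X 0 j k u v) ^+ (2 * q))%:E <=
   ((64 * K ^+ 2 * q%:R * (2 * q + n)%:R / n%:R ^+ 2 *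
         ((autocov P X 0 j j u u + del) * (autocov P X 0 k k v v + del))) ^+ q)%:E)%E.
Hypothesis del0 : 0 < del.
Hypothesis ab : a < b.
Hypothesis lamP : forall l, (\int[leb]_(u in U) (autocov P X 0 l l u u)%:E <= lam%:E)%E.

(** The moments at (u, v) scale with the product of two such factors, which is the weight of the
    tail bound. The summand [del] makes the weight positive on U, so that it vanishes only where the
    extended error does. *)
Let wt l (u : RM) : R := \1_U u * (sig l l (u, u) + del).

Let wtE l u : U u -> wt l u = autocov P X 0 l l u u + del.
Proof.
by move=> Uu; rewrite /wt sigE !indicE (mem_set Uu) !mul1r.
Qed.

Let mwt l : measurable_fun setT (wt l).
Proof.
apply: measurable_funM; first exact: measurable_indic.
apply: measurable_funD; last exact: measurable_cst.
apply: (measurableT_comp (msig l l)).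
by apply: measurable_fun_pair; exact: measurable_id.
Qed.

Let wt_ge0 l u : 0 <= wt l u.
Proof.
have [uU|uU] := boolP (u \in (U : set R)).
  rewrite (wtE l u (set_mem uU)); apply: addr_ge0; last exact: ltW.
  by apply: curve_var_ge0; exact: set_mem.
by rewrite /wt indicE (negPf uU) mul0r.
Qed.

Let wt_int l : (\int[leb]_u (wt l u)%:E <= (lam + del * (b - a))%:E)%E.
Proof.
have -> : (\int[leb]_u (wt l u)%:E = \int[leb]_(u in U) ((autocov P X 0 l l u u)%:E + del%:E))%E.
  rewrite [RHS]integral_mkcond; apply: eq_integral => u _; rewrite patchE.
  case: ifPn => uU.
    by rewrite wtE ?EFinD//; exact: set_mem.
  by rewrite /wt indicE (negPf uU) mul0r.
have mA : measurable_fun U (fun u => (autocov P X 0 l l u u)%:E).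
  apply/measurable_EFinP; apply: (@eq_measurable_fun _ _ _ _ _ (fun u : RM => wt l u - del)).
    move=> u uU; rewrite wtE ?addrK//.
    exact: set_mem.
  apply: measurable_funTS; apply: measurable_funB; last exact: measurable_cst.
  exact: mwt.
rewrite ge0_integralD//; last first.
- by move=> u _; rewrite lee_fin ltW.
- by move=> u Uu; rewrite lee_fin curve_var_ge0.
rewrite EFinD; apply: leeD; first exact: lamP.
rewrite integral_cst//.
have e : leb (U : set RM) = (b - a)%:E by rewrite lebesgue_measure_itv/= lte_fin ab EFinB.
rewrite [X in (_ * X)%E](_ : _ = (b - a)%:E) -?EFinM ?lexx//.
Qed.

(** The weight is a product of functions of u and of v, so its integral factorizes into two
    integrals of at most lam + del (b - a) each. *)
Lemma cov_error_hs_tail m c : 0 < c -> 0 < lam + del * (b - a) -> (0 < n)%N ->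
  (P [set w | ((c * (lam + del * (b - a)) ^+ 2)%:E <
     \int[leb]_(u in U) \int[leb]_(v in U) (cov_error P X n w j k u v ^+ 2)%:E)%E] <=
   ((64 * K ^+ 2 * m.+1%:R * (2 * m.+1 + n)%:R / n%:R ^+ 2 / c) ^+ m.+1)%:E)%E.
Proof.
move=> c0 L0 n0; set L := lam + _ in L0 *.
have [mu muE] := iterated_integral_measure leb leb.
rewrite [X in P X](_ : _ = [set w | ((c * L ^+ 2)%:E < \int[mu]_z (D (w, z) ^+ 2)%:E)%E]); last first.
  by apply/seteqP; split => w /=; rewrite (hs2E mu muE).
have mW : measurable_fun setT (fun z : RM * RM => wt j z.1 * wt k z.2).
  apply: measurable_funM; first exact: (measurableT_comp (mwt j) measurable_fst).
  exact: (measurableT_comp (mwt k) measurable_snd).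
have BB0 : 0 <= 64 * K ^+ 2 * m.+1%:R * (2 * m.+1 + n)%:R / n%:R ^+ 2.
  apply: divr_ge0; last exact: sqr_ge0.
  apply: mulr_ge0 => //; apply: mulr_ge0 => //; apply: mulr_ge0 => //.
  exact: sqr_ge0.
apply: (weighted_moment_tail P mu D (fun z => wt j z.1 * wt k z.2)) => //.
- by move=> z; rewrite mulr_ge0.
- move=> w [u v] /=; rewrite DE.
  have [uU|uU] := boolP (u \in (U : set R)); last by rewrite indicE (negPf uU) !mul0r.
  have [vU|vU] := boolP (v \in (U : set R)); last by rewrite !indicE (negPf vU) mulr0 mul0r.
  rewrite !wtE; [|exact: set_mem|exact: set_mem].
  move/eqP; rewrite mulf_eq0 !gt_eqF//; apply: ltr_wpDl => //.
    by apply: curve_var_ge0; exact: set_mem.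
  by apply: curve_var_ge0; exact: set_mem.
- by rewrite exprn_gt0.
- move=> [u v] /=.
  have [uU|uU] := boolP (u \in (U : set R)); last first.
    under eq_integral do rewrite DE indicE (negPf uU) !mul0r expr0n/=.
    rewrite integral0 lee_fin exprn_ge0// mulr_ge0//; last by rewrite mulr_ge0.
  have [vU|vU] := boolP (v \in (U : set R)); last first.
    under eq_integral do rewrite DE !indicE (negPf vU) mulr0 mul0r expr0n/=.
    rewrite integral0 lee_fin exprn_ge0// mulr_ge0//; last by rewrite mulr_ge0.
  have Uu := set_mem uU; have Uv := set_mem vU.
  rewrite !wtE//; apply: le_trans (HM u v m.+1 Uu Uv); rewrite le_eqVlt; apply/orP; left; apply/eqP.
  apply: eq_integral => w _.
  by rewrite DE !indicE uU vU !mul1r sampleE.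
- rewrite muE; [|by apply/measurable_EFinP|by move=> z; rewrite lee_fin mulr_ge0].
  have mk : measurable_fun setT (fun v => (wt k v)%:E) by apply/measurable_EFinP; exact: mwt.
  have mj : measurable_fun setT (fun v => (wt j v)%:E) by apply/measurable_EFinP; exact: mwt.
  have i0 l : (0 <= \int[leb]_v (wt l v)%:E)%E by apply: integral_ge0 => v _; rewrite lee_fin.
  have -> : (\int[leb]_u \int[leb]_v (wt j u * wt k v)%:E =
     (\int[leb]_v (wt k v)%:E) * (\int[leb]_u (wt j u)%:E))%E.
    transitivity (\int[leb]_u ((\int[leb]_v (wt k v)%:E) * (wt j u)%:E))%E; last first.
      by apply: ge0_integralZl; [exact: measurableT|exact: mj|move=> u _; rewrite lee_fin|exact: i0].
    apply: eq_integral => u _; rewrite /= muleC.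
    transitivity (\int[leb]_v ((wt j u)%:E * (wt k v)%:E))%E; first by apply: eq_integral => v _; rewrite EFinM.
    by apply: ge0_integralZl; [exact: measurableT|exact: mk|move=> v _; rewrite lee_fin|rewrite lee_fin].
  apply: (@le_trans _ _ (L * L)%:E).
    by rewrite EFinM; apply: lee_pmul => //; exact: wt_int.
  by first [rewrite lee_fin expr2|rewrite lee_fin].
Qed.

End CovarianceError.

Lemma measurable_gt_hs_norm {R : realType} {d : measure_display} {T : measurableType d} (H : T -> \bar R) (r : R) :
  (forall w, 0 <= H w)%E -> 0 <= r -> measurable_fun setT H ->
  [set w | (r%:E < sqrte (H w))%E] = [set w | ((r ^+ 2)%:E < H w)%E] /\
  measurable [set w | (r%:E < sqrte (H w))%E].
Proof.
move=> H0 r0 mH.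
have e : [set w | (r%:E < sqrte (H w))%E] = [set w | ((r ^+ 2)%:E < H w)%E].
  apply/seteqP; split => w /=; rewrite !ltNge => h; apply: contra h => h.
    by rewrite -[r]ger0_norm// -sqrtr_sqr -[(_)%:E]/(sqrte (r ^+ 2)%:E) lee_sqrt// lee_fin sqr_ge0.
  rewrite -[r]ger0_norm// -sqrtr_sqr -[(_)%:E]/(sqrte (r ^+ 2)%:E) lee_sqrt// in h.
  by rewrite lee_fin sqr_ge0.
split=> //; rewrite e -[X in measurable X]setTI.
exact: emeasurable_fun_o_infty.
Qed.

(** * Choice of the moment order *)

Section TailConstant.
Variable R : realType.

(** 2^14 pi^2 is the factor 64 (16 pi)^2 of the moment bound, 3 collects the two parts 2 q^2 and q n
    of q (2q + n), and e brings the base of the q-th power down to at most 1/e. *)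
Definition tail_constant : R := (3 * 2 ^+ 14 * pi ^+ 2 * expR 1)^-1.

Lemma tail_constant_gt0 : 0 < tail_constant.
Proof.
by rewrite /tail_constant invr_gt0 !mulr_gt0 ?expR_gt0 ?exprn_gt0 ?pi_gt0.
Qed.

(** The factor 4 of the tail has to absorb the e that is lost when the order is rounded down. *)
Lemma expR1_le4 : expR 1 <= 4 :> R.
Proof.
have h : 2^-1 <= expR (- 2^-1) :> R by have := expR_ge1Dx (- 2^-1 : R); lra.
have h2 : expR (2^-1) <= 2 :> R.
  by rewrite -[expR _]invrK -expRN -[leRHS]invrK lef_pV2// ?posrE ?expR_gt0.
have -> : expR 1 = expR 2^-1 * expR 2^-1 :> R by rewrite -expRD; congr expR; lra.
by have := expR_gt0 (2^-1 : R); nra.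
Qed.

(** The order q is the integer part of the exponent x of the claim; the moment bound is then at most
    e^(-q) <= e^(1-x). For q = 0 the trivial bound 1 serves. *)
Lemma moment_tail_optimization (n : nat) (eta : R) (pr : \bar R) : (0 < n)%N -> 0 < eta -> (pr <= 1)%E ->
  (forall m, (pr <= ((64 * (16 * pi) ^+ 2 * m.+1%:R * (2 * m.+1 + n)%:R / n%:R ^+ 2 / eta ^+ 2) ^+ m.+1)%:E)%E) ->
  (pr <= (4 * expR (- (tail_constant * n%:R * Num.min (eta ^+ 2) eta)))%:E)%E.
Proof.
move=> n0 eta0 pr1 H; set c := tail_constant; set mn := Num.min _ _.
have c0 : 0 < c := tail_constant_gt0.
have nR : (0 : R) < n%:R by rewrite ltr0n.
have mn0 : 0 < mn by rewrite /mn lt_min eta0 exprn_gt0.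
have mn1 : mn <= eta ^+ 2 by rewrite /mn ge_min lexx.
have mn2 : mn <= eta by rewrite /mn ge_min lexx orbT.
set x := c * n%:R * mn.
have x0 : 0 < x by rewrite !mulr_gt0.
pose q := Num.trunc x.
have /andP[qx xq] : q%:R <= x < q.+1%:R by apply: truncn_itv; exact: ltW.
have e4 := expR1_le4.
have fin : expR (- q%:R) <= 4 * expR (- x).
  apply: (@le_trans _ _ (expR (1 - x))).
    by rewrite ler_expR; move: xq; rewrite -natr1; lra.
  by rewrite expRD ler_wpM2r// expR_ge0.
case E : q => [|m].
  apply: (le_trans pr1); rewrite lee_fin; apply: le_trans fin.
  by rewrite E oppr0 expR0.
apply: (le_trans (H m)); rewrite lee_fin; apply: le_trans fin; rewrite E.
have -> : expR (- m.+1%:R) = (expR 1)^-1 ^+ m.+1 :> R.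
  by rewrite exprVn -expRM_natr mul1r expRN.
rewrite E in qx; set qq := m.+1%:R in qx *.
have q0 : 0 < qq by rewrite ltr0n.
have pe : 4 <= pi ^+ 2 :> R by have := @pi_ge2 R; nra.
have e1 : 1 <= expR 1 :> R by rewrite -[leLHS]expR0 ler_expR.
have c1 : c <= 1.
  rewrite /c /tail_constant invf_le1; first by nra.
  by rewrite mulr_gt0 ?expR_gt0// mulr_gt0// exprn_gt0// pi_gt0.
have ne0 : 0 < n%:R ^+ 2 * eta ^+ 2 by rewrite mulr_gt0// exprn_gt0.
(* Both entries of the minimum are used: min <= eta, with [c1], controls q^2, and min <= eta^2
   controls q n. *)
have qne : qq * (2 * m.+1 + n)%:R <= 3 * c * (n%:R ^+ 2 * eta ^+ 2).
  rewrite natrD natrM -/qq mulrDr.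
  have h1 : qq * qq <= c * (n%:R ^+ 2 * eta ^+ 2).
    apply: (@le_trans _ _ (x * x)); first by apply: ler_pM => //; exact: ltW.
    have -> : x * x = (c * n%:R ^+ 2) * (c * (mn * mn)) by rewrite /x; ring.
    rewrite [leRHS]mulrA; apply: ler_wpM2l; first by rewrite mulr_ge0 ?exprn_ge0// ltW.
    apply: (@le_trans _ _ (1 * (mn * mn))).
      by apply: ler_wpM2r => //; rewrite mulr_ge0// ltW.
    by rewrite mul1r expr2; apply: ler_pM => //; exact: ltW.
  have h2 : qq * n%:R <= c * (n%:R ^+ 2 * eta ^+ 2).
    apply: (@le_trans _ _ (x * n%:R)); first by apply: ler_wpM2r.
    have -> : x * n%:R = c * (n%:R ^+ 2 * mn) by rewrite /x; ring.
    by apply: ler_wpM2l; [exact: ltW|apply: ler_wpM2l => //; exact: exprn_ge0].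
  have -> : qq * (2%:R * qq) = 2 * (qq * qq) by ring.
  by lra.
apply: lerXn2r; rewrite ?nnegrE.
- by rewrite !mulr_ge0 ?invr_ge0 ?exprn_ge0 ?ler0n// ?mulr_ge0// ltW// pi_gt0.
- by rewrite invr_ge0 expR_ge0.
have -> : 64 * (16 * pi) ^+ 2 * qq * (2 * m.+1 + n)%:R / n%:R ^+ 2 / eta ^+ 2 =
    2 ^+ 14 * pi ^+ 2 * (qq * (2 * m.+1 + n)%:R) / (n%:R ^+ 2 * eta ^+ 2) :> R.
  by field; rewrite !gt_eqF.
rewrite ler_pdivrMr//; apply: (@le_trans _ _ (2 ^+ 14 * pi ^+ 2 * (3 * c * (n%:R ^+ 2 * eta ^+ 2)))).
  by apply: ler_wpM2l => //; rewrite mulr_ge0// sqr_ge0.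
rewrite le_eqVlt; apply/orP; left; apply/eqP; rewrite /c /tail_constant.
move: (pi_gt0 R) (expR_gt0 (1 : R)); move: (expR 1) (@pi R) => y z z0 y0; field.
by rewrite (gt_eqF y0) (gt_eqF z0).
Qed.

End TailConstant.

Lemma hs_norm_degenerate_eq0 {R : realType} (a : R) (f : R -> R -> R) : hs_norm `[a, a]%classic f = 0%E.
Proof.
rewrite /hs_norm set_itv1 integral_set1 sqrte0.
by [].
Qed.

(** * Tails for one entry and for the maximum *)

Section CovarianceTail.
Context {R : realType} {d : measure_display} {T : measurableType d}.
Variables (P : probability T R) (a b : R) (p n : nat) (X : int -> 'I_p -> R -> T -> R).
Variable F : R -> curve R p R -> curve R p R[i].
Local Notation leb := (@lebesgue_measure R).
Local Notation U := (`[a, b]%classic : set R).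
Local Notation M1 := (stability1 P U X F).
Local Notation lam0 := (lambda0 P U X).
Hypothesis ab : a <= b.
Hypothesis p0 : (0 < p)%N.
Hypothesis n0 : (0 < n)%N.
Hypothesis rc : random_curves U X.
Hypothesis mz : mean_zero P U X.
Hypothesis cs : cov_stationary P U X.
Hypothesis jg : jointly_gaussian P U X.
Hypothesis sd : is_spectral_density P U X F.
Hypothesis stab_fin : (stability P U X F < +oo)%E.
Hypothesis cont : forall j : 'I_p, {within U `*` U, continuous (fun z : R * R => autocov P X 0 j j z.1 z.2)}.
Hypothesis bdd : exists C : R, forall (j : 'I_p) (u v : R), U u -> U v -> `|autocov P X 0 j j u v| <= C.
Hypothesis lam_fin : (lam0 < +oo)%E.

Let H j k w : \bar R := (\int[leb]_(u in U) \int[leb]_(v in U) (cov_error P X n w j k u v ^+ 2)%:E)%E.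

Let H0 j k w : (0 <= H j k w)%E.
Proof.
by apply: integral_ge0 => u _; apply: integral_ge0 => v _; rewrite lee_fin sqr_ge0.
Qed.

Let mH j k : measurable_fun setT (H j k).
Proof.
exact: (hs_norm_cov_error_measurable P a b p X rc mz cs n j k).
Qed.

Let var_int_ge0 l : (0 <= \int[leb]_(u in U) (autocov P X 0 l l u u)%:E)%E.
Proof.
apply: integral_ge0 => u Uu; rewrite lee_fin.
exact: (curve_var_ge0 P a b p X mz cs).
Qed.

Let lam0_ub l : (\int[leb]_(u in U) (autocov P X 0 l l u u)%:E <= lam0)%E.
Proof.
by rewrite /lambda0; apply: (le_bigmax_cond _ (fun l => \int[leb]_(u in U) (autocov P X 0 l l u u)%:E)%E).
Qed.

Let lam0_ge0 : (0 <= lam0)%E.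
Proof.
apply: le_trans (lam0_ub (Ordinal p0)).
exact: var_int_ge0.
Qed.

Let lam0_fineK : (fine lam0)%:E = lam0.
Proof.
by rewrite fineK// ge0_fin_numE ?lam0_ge0 ?lam_fin.
Qed.

(** With lam = 0 only del (b - a) remains in the tail bound. At m = 0 it gives probability at most B
    / c for arbitrarily large c, with [del] adjusted so that the threshold stays at tau; hence the
    error vanishes almost surely. *)
Let hs_pos_null j k : lam0 = 0%E -> P [set w | (0 < hs_norm U (cov_error P X n w j k))%E] = 0%E.
Proof.
move=> l0; have [eab|ltab] := eqVneq a b.
  rewrite [X in P X](_ : _ = set0) ?measure0//; apply/seteqP; split => w //=.
  by rewrite -eab hs_norm_degenerate_eq0 ltxx.
have ltab' : a < b by rewrite lt_neqAle ltab.
have [C0 C0P] := bdd.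
have [K [K0 HK _]] := curve_moment_bound P a b p X rc mz cs ltab' C0 C0P jg F sd stab_fin cont.
pose B := 64 * K ^+ 2 * 1%:R * (2 * 1 + n)%:R / n%:R ^+ 2.
have B0 : 0 <= B by rewrite /B divr_ge0 ?sqr_ge0// !mulr_ge0// sqr_ge0.
have small tau : 0 < tau -> P [set w | (tau%:E < H j k w)%E] = 0%E.
  move=> tau0; apply/eqP; rewrite eq_le measure_ge0 andbT.
  apply/lee_addgt0Pr => eps eps0; rewrite add0e.
  pose c := (B + 1) / eps.
  have c0 : 0 < c by rewrite /c divr_gt0// ltr_wpDl.
  have ba : 0 < b - a by rewrite subr_gt0.
  pose del := Num.sqrt (tau / c) / (b - a).
  have del0 : 0 < del by rewrite /del divr_gt0// sqrtr_gt0 divr_gt0.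
  have dE : 0 + del * (b - a) = Num.sqrt (tau / c) by rewrite add0r /del divfK// gt_eqF.
  have L0 : 0 < 0 + del * (b - a) by rewrite dE sqrtr_gt0 divr_gt0.
  have lP l : (\int[leb]_(u in U) (autocov P X 0 l l u u)%:E <= (0 : R)%:E)%E by rewrite -[(0 : R)%:E]l0.
  have := cov_error_hs_tail P a b p X rc mz cs n j k K 0 del
    (fun u v q Uu Uv => HK j k u v n q del n0 del0 Uu Uv) del0 ltab' lP 0 c c0 L0 n0.
  rewrite dE sqr_sqrtr; last by rewrite divr_ge0 ?ltW.
  rewrite [c * _]mulrC divfK ?gt_eqF// expr1 -/B => h; apply: (le_trans h); rewrite lee_fin.
  rewrite ler_pdivrMr// /c mulrC divfK ?gt_eqF//.
  by rewrite lerDl.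
have mS tau : measurable [set w | (tau%:E < H j k w)%E].
  rewrite -[X in measurable X]setTI.
  exact: emeasurable_fun_o_infty.
have sub : [set w | (0 < hs_norm U (cov_error P X n w j k))%E] `<=` \bigcup_m [set w | ((m.+1%:R^-1)%:E < H j k w)%E].
  move=> w /= hw; have Hp : (0 < H j k w)%E.
    rewrite lt_neqAle H0 andbT; apply/negP => /eqP e0; move: hw.
    by rewrite /hs_norm -/(H j k w) -e0 sqrte0 ltxx.
  case E : (H j k w) Hp => [r|//|//].
    rewrite lte_fin => r0; exists (Num.trunc r^-1) => //=; rewrite E lte_fin.
    rewrite invf_plt ?posrE ?ltr0n//.
    exact: truncnS_gt.
  by move=> _; exists 0%N => //=; rewrite E ltry.
have mA : measurable [set w | (0 < hs_norm U (cov_error P X n w j k))%E].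
  by have [_] := measurable_gt_hs_norm (H j k) 0 (H0 j k) (lexx 0) (mH j k).
apply/eqP; rewrite eq_le measure_ge0 andbT.
apply: (le_trans (measure_sigma_subadditive P _ mA sub)).
  by move=> m; exact: mS.
by rewrite eseries0// => m _ _; apply: small; rewrite invr_gt0.
Qed.

Lemma threshold_measurable j k (r : \bar R) :
  measurable [set w | (r < hs_norm U (cov_error P X n w j k))%E].
Proof.
case: r => [r||].
- have [r0|r0] := leP 0 r.
    by have [_] := measurable_gt_hs_norm (H j k) r (H0 j k) r0 (mH j k).
  rewrite (_ : [set w | _] = setT)//; apply/seteqP; split => w //= _.
  by apply: lt_le_trans (sqrte_ge0 _); rewrite lte_fin.
- by rewrite (_ : [set w | _] = set0)//; apply/seteqP; split => w //=; rewrite ltNge leey.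
- rewrite (_ : [set w | _] = setT)//; apply/seteqP; split => w //= _.
  by apply: lt_le_trans (sqrte_ge0 _); rewrite ltNy0.
Qed.

Lemma entry_tail (eta : R) j k : 0 < eta ->
  (P [set w | (2%:E * M1 * lam0 * eta%:E < hs_norm U (cov_error P X n w j k))%E]
   <= (4 * expR (- (tail_constant R * n%:R * Num.min (eta ^+ 2) eta)))%:E)%E.
Proof.
move=> eta0; have rhs0 : (0 <= (4 * expR (- (tail_constant R * n%:R * Num.min (eta ^+ 2) eta)))%:E)%E.
  by rewrite lee_fin mulr_ge0// expR_ge0.
(* A product with 0 is 0 in the extended reals even if M_1 is infinite, so for lambda_0 = 0 the
   threshold is 0 and the event is null. *)
have [l0|lp] := eqVneq lam0 0%E.
  by rewrite l0 mule0 mul0e hs_pos_null.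
have ltab : a < b.
  rewrite lt_neqAle ab andbT; apply/negP => /eqP eab; move/eqP: lp; apply.
  apply/eqP; rewrite eq_le lam0_ge0 andbT /lambda0; apply: bigmax_le; first exact: leNye.
  by move=> l _; rewrite -eab set_itv1 integral_set1.
have [C0 C0P] := bdd.
have [K [K0 HK Kcase]] := curve_moment_bound P a b p X rc mz cs ltab C0 C0P jg F sd stab_fin cont.
have [Kz|[Kp M1E]] := Kcase.
  exfalso; move/eqP: lp; apply; apply/eqP; rewrite eq_le lam0_ge0 andbT /lambda0; apply: bigmax_le; first exact: leNye.
  move=> l _; rewrite (eq_integral (fun=> 0%E)) ?integral0// => u uU.
  by rewrite Kz//; exact: set_mem.
set l := fine lam0; have lE : lam0 = l%:E by rewrite lam0_fineK.
have lpos : 0 < l by rewrite -lte_fin -lE lt_neqAle eq_sym lp lam0_ge0.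
have pi0 := @pi_gt0 R.
pose r := 2 * (K / (16 * pi)) * l * eta.
have r0 : 0 < r.
  rewrite /r; apply: mulr_gt0 => //; apply: mulr_gt0 => //; apply: mulr_gt0 => //.
  by rewrite divr_gt0// mulr_gt0.
have -> : (2%:E * M1 * lam0 * eta%:E = r%:E)%E by rewrite M1E lE -!EFinM.
have [-> _] := measurable_gt_hs_norm (H j k) r (H0 j k) (ltW r0) (mH j k).
have ba : 0 < b - a by rewrite subr_gt0.
(* This makes lam + del (b - a) equal to 2 lambda_0: the factor 2 of the threshold pays exactly for
   [del]. *)
pose del := l / (b - a).
have del0 : 0 < del by rewrite divr_gt0.
have dE : l + del * (b - a) = 2 * l by rewrite /del divfK ?gt_eqF//; lra.
have L0 : 0 < l + del * (b - a) by rewrite dE mulr_gt0.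
have lP i : (\int[leb]_(u in U) (autocov P X 0 i i u u)%:E <= l%:E)%E by rewrite -lE.
(* c (2 l)^2 is the squared threshold, and K cancels against c in the moment bound, which leaves a
   constant independent of the process. *)
pose c := (K / (16 * pi) * eta) ^+ 2.
have c0 : 0 < c by rewrite exprn_gt0// mulr_gt0// divr_gt0// mulr_gt0.
apply: moment_tail_optimization => //.
  apply: probability_le1; rewrite -[X in measurable X]setTI.
  exact: emeasurable_fun_o_infty.
move=> m; have := cov_error_hs_tail P a b p X rc mz cs n j k K l del
    (fun u v q Uu Uv => HK j k u v n q del n0 del0 Uu Uv) del0 ltab lP m c c0 L0 n0.
rewrite dE.
have -> : c * (2 * l) ^+ 2 = r ^+ 2 by rewrite /c /r; move: (K / (16 * pi)) => z; ring.
have -> : 64 * K ^+ 2 * m.+1%:R * (2 * m.+1 + n)%:R / n%:R ^+ 2 / c =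
  64 * (16 * pi) ^+ 2 * m.+1%:R * (2 * m.+1 + n)%:R / n%:R ^+ 2 / eta ^+ 2 :> R.
  have nR : (0 : R) < n%:R by rewrite ltr0n.
  rewrite /c; move: (pi0); move: (@pi R) (m.+1%:R : R) ((2 * m.+1 + n)%:R : R) => z x y z0; field.
  by rewrite (gt_eqF z0) (gt_eqF nR) (gt_eqF eta0) (gt_eqF Kp).
by [].
Qed.

Let max_set (r : \bar R) : [set w | (r < max_norm U (cov_error P X n w))%E] =
  \big[setU/set0]_(jk : 'I_p * 'I_p) [set w | (r < hs_norm U (cov_error P X n w jk.1 jk.2))%E].
Proof.
rewrite -bigcup_seq; apply/seteqP; split => w /=.
  move=> h; apply: contrapT => nh; move: h; apply/negP; rewrite -leNgt /max_norm.
  apply: bigmax_le; first exact: leNye.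
  move=> j _; apply: bigmax_le; first exact: leNye.
  move=> k _; rewrite leNgt; apply/negP => h; apply: nh.
  by exists (j, k) => //=; rewrite mem_index_enum.
move=> [[j k] _ /= h]; apply: (lt_le_trans h); rewrite /max_norm.
apply: (@le_trans _ _ (\big[maxe/-oo%E]_(k < p) hs_norm U (cov_error P X n w j k))).
  exact: (le_bigmax_cond _ (fun k => hs_norm U (cov_error P X n w j k))).
exact: (le_bigmax_cond _ (fun j => \big[maxe/-oo%E]_(k < p) hs_norm U (cov_error P X n w j k))).
Qed.

Lemma max_threshold_measurable (r : \bar R) : measurable [set w | (r < max_norm U (cov_error P X n w))%E].
Proof.
rewrite max_set; apply: bigsetU_measurable => jk _.
exact: threshold_measurable.
Qed.

(** Union bound over the p^2 entries. *)
Lemma max_tail (eta : R) : 0 < eta ->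
  (P [set w | (2%:E * M1 * lam0 * eta%:E < max_norm U (cov_error P X n w))%E]
   <= (4 * p%:R ^+ 2 * expR (- (tail_constant R * n%:R * Num.min (eta ^+ 2) eta)))%:E)%E.
Proof.
move=> eta0; rewrite max_set; set E := expR _.
have HU (s : seq ('I_p * 'I_p)) : (P (\big[setU/set0]_(jk <- s)
    [set w | (2%:E * M1 * lam0 * eta%:E < hs_norm U (cov_error P X n w jk.1 jk.2))%E]) <= (4 * (size s)%:R * E)%:E)%E.
  elim: s => [|jk s IH].
    by rewrite big_nil measure0 lee_fin mulr0 mul0r.
  rewrite big_cons; apply: (le_trans (measureU2 _ _ _)).
  - exact: threshold_measurable.
  - by apply: bigsetU_measurable => i _; exact: threshold_measurable.
  - apply: (le_trans (leeD (entry_tail eta jk.1 jk.2 eta0) IH)).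
    rewrite -EFinD lee_fin -/E /= -natr1 le_eqVlt; apply/orP; left; apply/eqP.
    by ring.
apply: (le_trans (HU _)).
by rewrite -[X in size X]enumT -cardT card_prod card_ord natrM -expr2.
Qed.

End CovarianceTail.

Theorem theorem2 (R : realType) :
  exists c : R, 0 < c /\
  forall (a b : R) (p n : nat)
    (d : measure_display) (T : measurableType d) (P : probability T R)
    (X : int -> 'I_p -> R -> T -> R)
    (F : R -> curve R p R -> curve R p R[i]),
  let U : set R := `[a, b]%classic in
  let M1 := stability1 P U X F in
  let lam0 := lambda0 P U X in
  a <= b -> (0 < p)%N -> (0 < n)%N ->
  random_curves U X ->
  mean_zero P U X ->
  cov_stationary P U X ->
  jointly_gaussian P U X ->
  is_spectral_density P U X F ->
  (stability P U X F < +oo)%E ->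
  (forall j : 'I_p, {within U `*` U,
     continuous (fun z : R * R => autocov P X 0 j j z.1 z.2)}) ->
  (exists C : R, forall (j : 'I_p) (u v : R), U u -> U v ->
     `|autocov P X 0 j j u v| <= C) ->
  (lam0 < +oo)%E ->
  (forall (eta : R) (j k : 'I_p), 0 < eta ->
     (P [set w | 2%:E * M1 * lam0 * eta%:E
                 < hs_norm U (cov_error P X n w j k)]
      <= (4 * expR (- (c * n%:R * Num.min (eta ^+ 2) eta)))%:E)%E) /\
  (forall eta : R, 0 < eta ->
     (P [set w | 2%:E * M1 * lam0 * eta%:E
                 < max_norm U (cov_error P X n w)]
      <= (4 * p%:R ^+ 2 * expR (- (c * n%:R * Num.min (eta ^+ 2) eta)))%:E)%E) /\
  (forall rho : R, Num.sqrt 2 * c `^ (- 2^-1) < rho ->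
     rho ^+ 2 * ln p%:R <= n%:R ->
     ((1 - 4 * p%:R `^ (2 - c * rho ^+ 2))%:E
      < P [set w | max_norm U (cov_error P X n w)
                   <= 2%:E * M1 * lam0 * (rho * Num.sqrt (ln p%:R / n%:R))%:E])%E).
Proof.
set c1 := tail_constant R; have c10 : 0 < c1 := tail_constant_gt0 R.
(* The last claim is a strict inequality while the union bound yields a weak one; halving the
   constant opens the gap p^(2 - c1 rho^2) < p^(2 - c1 rho^2 / 2) for p >= 2. *)
exists (c1 / 2); split; first by rewrite divr_gt0.
move=> a b p n d T P X F U M1 lam0 ab p0 n0 rc mz cs jg sd stab_fin cont bdd lam_fin.
have entry := entry_tail P a b p n X F ab p0 n0 rc mz cs jg sd stab_fin cont bdd lam_fin.
have maxt := max_tail P a b p n X F ab p0 n0 rc mz cs jg sd stab_fin cont bdd lam_fin.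
have nR : (0 : R) < n%:R by rewrite ltr0n.
have weaken eta : 0 < eta -> expR (- (c1 * n%:R * Num.min (eta ^+ 2) eta)) <=
    expR (- (c1 / 2 * n%:R * Num.min (eta ^+ 2) eta)).
  move=> eta0; rewrite ler_expR lerN2.
  have m0 : 0 <= n%:R * Num.min (eta ^+ 2) eta by rewrite mulr_ge0 ?ltW// lt_min eta0 exprn_gt0.
  by rewrite -!mulrA; apply: ler_pM => //; lra.
split; [|split].
- move=> eta j k eta0; apply: (le_trans (entry eta j k eta0)).
  by rewrite lee_fin ler_wpM2l// weaken.
- move=> eta eta0; apply: (le_trans (maxt eta eta0)).
  by rewrite lee_fin ler_wpM2l ?weaken// mulr_ge0// sqr_ge0.
move=> rho Hrho Hn.
have mA r : measurable [set w | (r < max_norm U (cov_error P X n w))%E].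
  exact: (max_threshold_measurable P a b p n X rc mz cs r).
rewrite (_ : [set w | _] = ~` [set w | (2%:E * M1 * lam0 * (rho * Num.sqrt (ln p%:R / n%:R))%:E < max_norm U (cov_error P X n w))%E]); last first.
  by apply/seteqP; split => w /=; [move=> h; apply/negP; rewrite -leNgt|move/negP; rewrite -leNgt].
rewrite probability_setC//.
have rho0 : 0 < rho by apply: le_lt_trans Hrho; rewrite mulr_ge0 ?powR_ge0// sqrtr_ge0.
(* For p = 1 the logarithm is 0 and no positive eta is available, but the lower bound 1 - 4 is
   negative. *)
have [p1|p2] := leqP p 1.
  have p_eq1 : p = 1%N by apply/eqP; rewrite eqn_leq p1 p0.
  have -> : p%:R = 1 :> R by rewrite p_eq1.
  rewrite powR1 mulr1; apply: (@lt_le_trans _ _ 0%E); first by rewrite lte_fin; lra.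
  by rewrite sube_ge0 ?probability_le1// fin_num_measure.
have lnp : 0 < ln p%:R :> R by rewrite ln_gt0// ltr1n.
set eta := rho * Num.sqrt (ln p%:R / n%:R).
have q0 : 0 < ln p%:R / n%:R :> R by rewrite divr_gt0.
have eta0 : 0 < eta by rewrite mulr_gt0// sqrtr_gt0.
have eta2 : eta ^+ 2 = rho ^+ 2 * (ln p%:R / n%:R) by rewrite exprMn sqr_sqrtr// ltW.
(* This is the condition on the sample size; the minimum is then eta^2, and n cancels in the
   exponent. *)
have eta_le1 : eta <= 1.
  rewrite -(@expr_le1 _ 2 eta isT (ltW eta0)) eta2; apply: (@le_trans _ _ (n%:R / n%:R)); last by rewrite divff// gt_eqF.
  by rewrite mulrA; apply: ler_wpM2r => //; rewrite invr_ge0 ler0n.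
have minE : Num.min (eta ^+ 2) eta = eta ^+ 2.
  by apply: min_l; rewrite expr2 ler_piMl// ltW.
have pR : (0 : R) < p%:R by rewrite ltr0n.
have expE : 4 * p%:R ^+ 2 * expR (- (c1 * n%:R * Num.min (eta ^+ 2) eta)) = 4 * p%:R `^ (2 - c1 * rho ^+ 2).
  rewrite minE eta2 /powR gt_eqF// mulrBl expRD -mulrA; congr (_ * (_ * _)).
    by rewrite -powR_mulrn ?ltW// /powR gt_eqF.
  congr expR; rewrite -mulNr; field.
  by rewrite gt_eqF.
have strict : p%:R `^ (2 - c1 * rho ^+ 2) < p%:R `^ (2 - c1 / 2 * rho ^+ 2).
  rewrite /powR gt_eqF// ltr_expR ltr_pM2r// ltrD2l ltrN2 ltr_pM2r ?exprn_gt0//.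
  by rewrite ltr_pdivrMr//; lra.
have := maxt eta eta0; rewrite expE => H.
apply: (@lt_le_trans _ _ (1 - 4 * p%:R `^ (2 - c1 * rho ^+ 2))%:E).
  by rewrite lte_fin ltrD2l ltrN2 ltr_pM2l.
by rewrite EFinB; apply: leeB.
Qed.
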